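(* The following holds in $\mathrm{HA}+\mathrm{EM}_2$. For every $k\ge 2$ and for every recursive coloring $c_a:[\mathbb{N}]^2\to k$, there exists an Erd\H{o}s' tree $T$ for the coloring $c_a$ which satisfies the following properties: (a) there exists some $\Delta^0_2$ predicate in $\mathrm{HA}$ which represents $x\in T$; (b) $T$ has a unique infinite branch $r$, defined by some predicate of $\mathrm{HA}$; (c) for every color $h$, if there exist infinitely many edges with color $h$ in $T$, then there are infinitely many edges with color $h$ in $r$.
   Context: The natural number $k$ is identified with $\{0,\dots,k-1\}$; $[\mathbb{N}]^2$ is the set of two-element subsets of $\mathbb{N}$, and an edge $\{x,y\}$ is directed from $\min\{x,y\}$ to $\max\{x,y\}$. A coloring $c_a$ belongs to a recursive family $\{c_a\mid a\in\mathbb{N}\}$ of recursive colorings with parameter $a$. $\mathrm{HA}$ is intuitionistic first-order Heyting Arithmetic with full induction, symbols for all primitive recursive functions, and symbols for finitely many total recursive functions (used for the colorings); there are no function or set variables, so trees and branches are given by arithmetical predicates. $\mathrm{EM}_2$ is Excluded Middle for $\Sigma^0_2$ formulas: for every parameter $a$, $\exists x\,P(x,a)\vee\neg\exists x\,P(x,a)$, for $P\in\Pi^0_1$. An Erd\H{o}s' tree in $k$ colors for a coloring $c:[\mathbb{N}]^2\to k$ is a $k$-ary tree $T$ whose nodes are natural numbers, whose proper ancestor relation $\prec_T$ is included in the complete directed graph on $\mathbb{N}$ (so $x\prec_T y$ implies $x<y$), in which each node $x$ has at most one child number $i$ for each color $i<k$, and such that for all nodes $x$, all $i<k$, and all $y,z$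 that are equal to or descendants of the child number $i$ of $x$, the edges $\{x,y\}$ and $\{x,z\}$ both have color $i$. An edge of $T$ is a pair consisting of a node $x$ and a child $y$ of $x$ in $T$, with color $c(\{x,y\})$. A branch of $T$ is a set of nodes totally ordered by $\prec_T$ and closed under ancestors. Uniqueness of $r$ means that any arithmetical predicate defining an infinite branch defines the same branch. *)

(* Defs.v *)
From Stdlib Require Import List Arith.
From Stdlib Require Vector Fin.
Import ListNotations.
Open Scope list_scope.

Set Implicit Arguments.
Unset Strict Implicit.

Notation vec := Vector.t.
Notation vnil := (@Vector.nil _).
Notation vcons x v := (@Vector.cons _ x _ v).

Inductive pr : nat -> Set :=
| PZero : pr 0
| PSucc : pr 1
| PProj n (i : Fin.t n) : pr n
| PComp n m (f : pr m) (gs : vec (pr n) m) : pr n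
| PRec n (f : pr n) (g : pr (S (S n))) : pr (S n).

(* [PRec f g] recurses on its first argument:
   h(0,v) = f(v) and h(x+1,v) = g(x, h(x,v), v). *)
Fixpoint pr_eval n (p : pr n) : vec nat n -> nat :=
  match p in pr n return vec nat n -> nat with
  | PZero => fun _ => 0
  | PSucc => fun v => S (Vector.hd v)
  | PProj i => fun v => Vector.nth v i
  | PComp f gs => fun v => pr_eval f (Vector.map (fun g => pr_eval g v) gs)
  | PRec f g => fun v =>
      nat_rect (fun _ => nat) (pr_eval f (Vector.tl v))
        (fun x y => pr_eval g (vcons x (vcons y (Vector.tl v)))) (Vector.hd v)
  end.

(* A total recursive function in Kleene normal form:
   v |-> out (least z such that test(z,v) = 0), where such a z always exists. *)
Record recfun : Set := Recfun {
  rf_arity : nat;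
  rf_test : pr (S rf_arity);
  rf_out : pr 1;
  rf_total : forall v : vec nat rf_arity,
    exists z, pr_eval rf_test (vcons z v) = 0 }.

(* The finitely many total recursive functions which get a function symbol,
   in addition to the primitive recursive ones. *)
Record signature : Set := Signature {
  nrec : nat;
  recs : Fin.t nrec -> recfun }.

Inductive fsym (L : signature) : nat -> Set :=
| Fpr n (p : pr n) : fsym L n
| Frec (i : Fin.t (nrec L)) : fsym L (rf_arity (recs i)).

Inductive term (L : signature) : Set :=
| Var (i : nat) : term L
| App n (f : fsym L n) (ts : vec (term L) n) : term L.

Inductive form (L : signature) : Set :=
| Bot : form L
| Eq (s t : term L) : form L
| And (p q : form L) : form L
| Or (p q : form L) : form L
| Imp (p q : form L) : form L
| All (p : form L) : form L
| Ex (p : form L) : form L.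

Arguments Var {L} i.
Arguments Bot {L}.

Fixpoint tsubst L (s : nat -> term L) (t : term L) : term L :=
  match t with
  | Var i => s i
  | App f ts => App f (Vector.map (tsubst s) ts)
  end.

(* [up n t] is [t] read below [n] additional binders. *)
Definition up L (n : nat) (t : term L) : term L := tsubst (fun i => Var (n + i)) t.

Definition scons L (t : term L) (s : nat -> term L) : nat -> term L :=
  fun i => match i with 0 => t | S i => s i end.

Definition lift L (s : nat -> term L) : nat -> term L :=
  scons (Var 0) (fun i => up 1 (s i)).

Fixpoint subst L (s : nat -> term L) (p : form L) : form L :=
  match p with
  | Bot => Bot
  | Eq t u => Eq (tsubst s t) (tsubst s u)
  | And p q => And (subst s p) (subst s q)
  | Or p q => Or (subst s p) (subst s q)
  | Imp p q => Imp (subst s p) (subst s q)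
  | All p => All (subst (lift s) p)
  | Ex p => Ex (subst (lift s) p)
  end.

Definition fup L (p : form L) : form L := subst (fun i => Var (S i)) p.
Definition inst L (p : form L) (t : term L) : form L := subst (scons t Var) p.

Definition Neg L (p : form L) : form L := Imp p Bot.
Definition Iff L (p q : form L) : form L := And (Imp p q) (Imp q p).

Declare Scope ha_scope.
Delimit Scope ha_scope with ha.
Bind Scope ha_scope with form.
Notation "s == t" := (Eq s t) (at level 70) : ha_scope.
Notation "p ∧ q" := (And p q) (at level 80, right associativity) : ha_scope.
Notation "p ∨ q" := (Or p q) (at level 85, right associativity) : ha_scope.
Notation "¬ p" := (Neg p) (at level 75, right associativity) : ha_scope.
Notation "p ⇒ q" := (Imp p q) (at level 90, right associativity) : ha_scope.
Notation "p ⇔ q" := (Iff p q) (at level 95) : ha_scope.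
Local Open Scope ha_scope.

Definition zero L : term L := App (Fpr L PZero) vnil.
Definition succ L (t : term L) : term L := App (Fpr L PSucc) (vcons t vnil).
Fixpoint num L (n : nat) : term L :=
  match n with 0 => zero L | S n => succ (num L n) end.
Arguments zero {L}.
Arguments num {L} n.

Definition pr_pred : pr 1 := PRec PZero (PProj Fin.F1).

(* Truncated subtraction, subtrahend first: pr_eval pr_sub [y; x] = x - y. *)
Definition pr_sub : pr 2 :=
  PRec (PProj Fin.F1)
    (PComp pr_pred (vcons (PProj (Fin.FS Fin.F1)) vnil)).

Definition sub L (x y : term L) : term L :=
  App (Fpr L pr_sub) (vcons y (vcons x vnil)).

Definition lt L (x y : term L) : form L := sub (succ x) y == zero.
Notation "x < y" := (lt x y) (at level 70) : ha_scope.

Lemma pr_sub_eval x y : pr_eval pr_sub (vcons y (vcons x vnil)) = x - y.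
Proof.
  assert (P : forall n, pr_eval pr_pred (vcons n vnil) = Nat.pred n)
    by now intros [|n].
  induction y as [|y IH].
  - symmetry; apply Nat.sub_0_r.
  - rewrite Nat.sub_succ_r, <- IH, <- P; reflexivity.
Qed.

(* Free variables are read universally: an axiom may be used in any context,
   also below the eigenvariable of [AllI]. *)
Inductive prv L (Ax : form L -> Prop) : list (form L) -> form L -> Prop :=
| ByAx G p : Ax p -> prv Ax G p
| Hyp G p : In p G -> prv Ax G p
| BotE G p : prv Ax G Bot -> prv Ax G p
| AndI G p q : prv Ax G p -> prv Ax G q -> prv Ax G (p ∧ q)
| AndE1 G p q : prv Ax G (p ∧ q) -> prv Ax G p
| AndE2 G p q : prv Ax G (p ∧ q) -> prv Ax G q
| OrI1 G p q : prv Ax G p -> prv Ax G (p ∨ q)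
| OrI2 G p q : prv Ax G q -> prv Ax G (p ∨ q)
| OrE G p q r :
    prv Ax G (p ∨ q) -> prv Ax (p :: G) r -> prv Ax (q :: G) r -> prv Ax G r
| ImpI G p q : prv Ax (p :: G) q -> prv Ax G (p ⇒ q)
| ImpE G p q : prv Ax G (p ⇒ q) -> prv Ax G p -> prv Ax G q
| AllI G p : prv Ax (map (@fup L) G) p -> prv Ax G (All p)
| AllE G p t : prv Ax G (All p) -> prv Ax G (inst p t)
| ExI G p t : prv Ax G (inst p t) -> prv Ax G (Ex p)
| ExE G p q :
    prv Ax G (Ex p) -> prv Ax (p :: map (@fup L) G) (fup q) -> prv Ax G q.

Inductive HA (L : signature) : form L -> Prop :=
| HA_refl t : HA (t == t)
| HA_leibniz p s t : HA (s == t ⇒ inst p s ⇒ inst p t)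
| HA_succ_ne t : HA (¬ (succ t == zero))
| HA_succ_inj s t : HA (succ s == succ t ⇒ s == t)
| HA_proj n (i : Fin.t n) ts : HA (App (Fpr L (PProj i)) ts == Vector.nth ts i)
| HA_comp n m (f : pr m) (gs : vec (pr n) m) ts :
    HA (App (Fpr L (PComp f gs)) ts ==
        App (Fpr L f) (Vector.map (fun g => App (Fpr L g) ts) gs))
| HA_rec0 n (f : pr n) g ts :
    HA (App (Fpr L (PRec f g)) (vcons zero ts) == App (Fpr L f) ts)
| HA_recS n (f : pr n) g t ts :
    HA (App (Fpr L (PRec f g)) (vcons (succ t) ts) ==
        App (Fpr L g)
          (vcons t (vcons (App (Fpr L (PRec f g)) (vcons t ts)) ts)))
  (* exists z, test(z,ts) = 0, test(w,ts) <> 0 for all w < z, f(ts) = out(z) *)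
| HA_recfun (i : Fin.t (nrec L)) ts :
    let test z us := App (Fpr L (rf_test (recs i))) (vcons z us) in
    let out z := App (Fpr L (rf_out (recs i))) (vcons z vnil) in
    HA (Ex (test (Var 0) (Vector.map (up 1) ts) == zero
            ∧ All (Var 0 < Var 1 ⇒
                   ¬ (test (Var 0) (Vector.map (up 2) ts) == zero))
            ∧ App (Frec i) (Vector.map (up 1) ts) == out (Var 0)))
| HA_induction p :
    HA (inst p zero
        ⇒ All (p ⇒ subst (scons (succ (Var 0)) (fun i => Var (S i))) p)
        ⇒ All p).

Inductive Delta0 (L : signature) : form L -> Prop :=
| D0_bot : Delta0 Bot
| D0_eq s t : Delta0 (s == t)
| D0_and p q : Delta0 p -> Delta0 q -> Delta0 (p ∧ q)
| D0_or p q : Delta0 p -> Delta0 q -> Delta0 (p ∨ q)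
| D0_imp p q : Delta0 p -> Delta0 q -> Delta0 (p ⇒ q)
| D0_all t p : Delta0 p -> Delta0 (All (Var 0 < up 1 t ⇒ p))
| D0_ex t p : Delta0 p -> Delta0 (Ex (Var 0 < up 1 t ∧ p)).

Definition Sigma1 L (p : form L) : Prop := exists q, Delta0 q /\ p = Ex q.
Definition Pi1 L (p : form L) : Prop := exists q, Delta0 q /\ p = All q.
Definition Sigma2 L (p : form L) : Prop := exists q, Pi1 q /\ p = Ex q.
Definition Pi2 L (p : form L) : Prop := exists q, Sigma1 q /\ p = All q.

(* The parameters are the remaining free variables of [p]. *)
Inductive EM2 (L : signature) : form L -> Prop :=
| EM2_intro p : Pi1 p -> EM2 (Ex p ∨ ¬ Ex p).

Definition HA_EM2 L (p : form L) : Prop := HA p \/ EM2 p.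

Notation "'HA+EM₂' ⊢ p" := (prv (@HA_EM2 _) nil p%ha) (at level 99).

Definition Delta2 L (p : form L) : Prop :=
  exists s q, Sigma2 s /\ Pi2 q /\ (HA+EM₂ ⊢ p ⇔ s) /\ (HA+EM₂ ⊢ p ⇔ q).

(* An [n]-ary predicate is a formula whose arguments are its free variables
   0, ..., n-1. In [p @ ts] all other variables of [p] are replaced by 0, so
   that [p] has no parameters beyond [ts]. *)
Definition papp L (p : form L) (ts : list (term L)) : form L :=
  subst (fun i => List.nth i ts zero) p.
Notation "p @ ts" := (papp p ts) (at level 30, no associativity) : ha_scope.

(* The leftmost argument is bound outermost. A term coming from outside has to
   be shifted explicitly, with [up n], below the [n] quantifiers. *)
Definition all1 L (p : term L -> form L) := All (p (Var 0)).
Definition all2 L (p : term L -> term L -> form L) :=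
  All (All (p (Var 1) (Var 0))).
Definition all3 L (p : term L -> term L -> term L -> form L) :=
  All (All (All (p (Var 2) (Var 1) (Var 0)))).
Definition all4 L (p : term L -> term L -> term L -> term L -> form L) :=
  All (All (All (All (p (Var 3) (Var 2) (Var 1) (Var 0))))).
Definition all5 L (p : term L -> term L -> term L -> term L -> term L -> form L) :=
  All (All (All (All (All (p (Var 4) (Var 3) (Var 2) (Var 1) (Var 0)))))).
Definition ex1 L (p : term L -> form L) := Ex (p (Var 0)).
Definition ex2 L (p : term L -> term L -> form L) :=
  Ex (Ex (p (Var 1) (Var 0))).

(* The color of the edge {x,y} under c_a, for x < y. *)
Definition color L (c : fsym L 3) (a x y : term L) : term L :=
  App c (vcons a (vcons x (vcons y vnil))).

Definition is_coloring L (c : fsym L 3) (k : nat) (a : term L) : form L :=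
  all2 (fun x y => x < y ⇒ color c (up 2 a) x y < num k).

(* A labelled tree on natural numbers, uniformly in the parameter a. *)
Record tree (L : signature) := Tree {
  node_ : form L;      (* (x, a): x is a node *)
  anc_ : form L;       (* (x, y, a): x is a proper ancestor of y *)
  child_ : form L }.   (* (i, x, y, a): y is the child number i of x *)

Definition node L (T : tree L) a x := node_ T @ [x; a].
Definition anc L (T : tree L) a x y := anc_ T @ [x; y; a].
Definition child L (T : tree L) a i x y := child_ T @ [i; x; y; a].
Definition anc_eq L (T : tree L) a x y := x == y ∨ anc T a x y.

(* The third clause together with the first clause of [erdos_tree] makes [anc]
   the transitive closure of the child relation, by induction on y - x. *)
Definition is_tree L (T : tree L) (k : nat) (a : term L) : form L :=
  all3 (fun i x y => let a := up 3 a in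
    child T a i x y ⇒ i < num k ∧ node T a x ∧ node T a y)
  ∧ all5 (fun i x j z y => let a := up 5 a in
    child T a i x y ∧ child T a j z y ⇒ i == j ∧ x == z)
  ∧ all2 (fun x y =>
    anc T (up 2 a) x y
    ⇔ ex2 (fun i z => child T (up 4 a) i (up 2 x) z
                      ∧ anc_eq T (up 4 a) z (up 2 y)))
  ∧ ex1 (fun r => node T (up 1 a) r
    ∧ all1 (fun x => node T (up 2 a) x ⇒ anc_eq T (up 2 a) (up 1 r) x))
  ∧ all4 (fun i x y z => let a := up 4 a in
    child T a i x y ∧ child T a i x z ⇒ y == z).

Definition erdos_tree L (c : fsym L 3) (k : nat) (T : tree L) (a : term L)
  : form L :=
  all2 (fun x y => anc T (up 2 a) x y ⇒ x < y)
  ∧ is_tree T k a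
  ∧ all5 (fun i x w y z => let a := up 5 a in
      child T a i x w ∧ anc_eq T a w y ∧ anc_eq T a w z
      ⇒ color c a x y == i ∧ color c a x z == i).

(* (x,y) is an edge of T with color h. *)
Definition edge L (c : fsym L 3) (T : tree L) (a h x y : term L) : form L :=
  ex1 (fun i => child T (up 1 a) i (up 1 x) (up 1 y)) ∧ color c a x y == h.

(* In the next definitions [ps] are the parameters of the unary predicate [r]. *)
Definition infinite_branch L (T : tree L) (a : term L)
    (r : form L) (ps : list (term L)) : form L :=
  let ps1 := map (up 1) ps in
  let ps2 := map (up 2) ps in
  all1 (fun x => r @ (x :: ps1) ⇒ node T (up 1 a) x)
  ∧ all2 (fun x y => r @ (x :: ps2) ∧ r @ (y :: ps2)
                     ⇒ x == y ∨ anc T (up 2 a) x y ∨ anc T (up 2 a) y x)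
  ∧ all2 (fun x y => r @ (y :: ps2) ∧ anc T (up 2 a) x y ⇒ r @ (x :: ps2))
  ∧ all1 (fun n => ex1 (fun x => up 1 n < x ∧ r @ (x :: ps2))).

(* A set of edges is infinite iff the larger endpoints are unbounded. *)
Definition inf_edges L (c : fsym L 3) (T : tree L) (a h : term L) : form L :=
  all1 (fun n => ex2 (fun x y => up 2 n < y ∧ edge c T (up 3 a) (up 3 h) x y)).

Definition inf_edges_in L (c : fsym L 3) (T : tree L) (a h : term L)
    (r : form L) (ps : list (term L)) : form L :=
  let ps3 := map (up 3) ps in
  all1 (fun n => ex2 (fun x y =>
    up 2 n < y ∧ r @ (x :: ps3) ∧ r @ (y :: ps3)
    ∧ edge c T (up 3 a) (up 3 h) x y)).

Definition same_set L (r : form L) (ps : list (term L))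
    (s : form L) (qs : list (term L)) : form L :=
  all1 (fun x => r @ (x :: map (up 1) ps) ⇔ s @ (x :: map (up 1) qs)).

(* Main.v *)
(* The tree [T] grows by deciding for n = 0, 1, 2, ... whether n is a node. Every y
   which is not yet decided follows, by its colors, a path of nodes. Two such y
   whose paths part at a node v are compared as follows. The threshold of y at v is
   the least, over the colors h that y uses from v on, of the last node above v at
   which the path has color h (0 if there is none); y is better if its threshold is
   larger, or if the thresholds agree and it leaves v with a smaller color. Then n
   becomes a node iff no y > n is better than n. A finite piece of T is correct iff
   a Pi^0_1 and Sigma^0_1 condition holds, so T is Delta^0_2.

   At a node w of the branch r only finitely many nodes leave w with a color other
   than the best one which stays possible at all stages; this best color is found by
   deciding Sigma^0_2 formulas, and r follows it. If a color h is used by infinitely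
   many edges of T, then below every node v of r the threshold on r must drop below
   the last h above v, which forces a color that was not used for long to recur;
   after at most k such steps this color is h. *)

(* The rule of comparison serves two purposes. A late node that leaves a branch point [w] with a
   color other than the best would be beaten by a surviving candidate; this makes [r] unique. And a
   node [t] off [r] must have withstood those candidates where it left [r], so its threshold at any
   branch point [v] above it is at least the one that survives on [r]. Hence a color that [r] has
   long neglected cannot live on in side branches, which is the core of (c). The obstacle is the
   weakness of [EM2]: it decides a single existential over a single universal quantifier, while [T]
   is itself Delta2. So no question is asked about [T] directly. A number [b] codes a finite piece
   of [T] by its digits and bounds, by its size, the witnesses for the numbers left out; its
   correctness is then Pi1, and matrices that read [b] instead of [T] remain Delta0. Derivability is
   handled semantically: a statement is proved in a context [G] for arbitrary terms, and is
   transported to all larger contexts. *)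
Require Import Defs.
From Stdlib Require Import List Arith Lia Setoid Morphisms.
From Stdlib Require Vector Fin.
Import ListNotations.
Open Scope list_scope.
Open Scope ha_scope.
Set Implicit Arguments.
Unset Strict Implicit.

(** * Substitution *)

Section Terms.
Variable L : signature.
Implicit Types (s t u : term L) (p q : form L).

Lemma term_rect_vec (P : term L -> Prop) :
  (forall i, P (Var i)) ->
  (forall n (f : fsym L n) ts, Vector.Forall P ts -> P (App f ts)) ->
  forall t, P t.
Proof.
intros HV HA; fix F 1; intros [i|n f ts]; [apply HV|].
apply HA; revert n ts f; fix Fs 2; intros n [|t m ts] f; constructor.
- apply F.
(* [Fs] abstracts over a symbol of the arity of the vector, so any symbol serves for the tail: here
   the constant 0 of arity [m]. *)
- exact (Fs m ts (Fpr L (PComp PZero vnil))).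
Qed.

Lemma map_ext_Forall A B n (f g : A -> B) (ts : vec A n) :
  Vector.Forall (fun x => f x = g x) ts -> Vector.map f ts = Vector.map g ts.
Proof. induction 1; simpl; congruence. Qed.

Lemma tsubst_ext (f g : nat -> term L) t :
  (forall i, f i = g i) -> tsubst f t = tsubst g t.
Proof.
intros H; induction t using term_rect_vec; simpl; auto.
f_equal; now apply map_ext_Forall.
Qed.

Lemma tsubst_Var t : tsubst Var t = t.
Proof.
induction t using term_rect_vec; simpl; auto.
f_equal; clear f; induction H as [|? ? ? E _ IH]; simpl; [|rewrite E, IH]; auto.
Qed.

Lemma tsubst_comp (f g : nat -> term L) t :
  tsubst g (tsubst f t) = tsubst (fun i => tsubst g (f i)) t.
Proof.
induction t using term_rect_vec; simpl; auto.
f_equal; clear f0; induction H as [|? ? ? E _ IH]; simpl; [|rewrite E, IH]; auto.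
Qed.

Lemma tsubst_up (f : nat -> term L) n t :
  tsubst f (up n t) = tsubst (fun i => f (n + i)) t.
Proof. unfold up; rewrite tsubst_comp; now apply tsubst_ext. Qed.

Lemma up_tsubst (f : nat -> term L) n t :
  up n (tsubst f t) = tsubst (fun i => up n (f i)) t.
Proof. unfold up; now rewrite tsubst_comp. Qed.

Lemma lift_ext (f g : nat -> term L) :
  (forall i, f i = g i) -> forall i, lift f i = lift g i.
Proof. intros H [|i]; simpl; congruence. Qed.

Lemma subst_ext p : forall f g, (forall i, f i = g i) -> subst f p = subst g p.
Proof.
induction p; simpl; intros f g H; f_equal; auto using tsubst_ext, lift_ext.
Qed.

Lemma lift_Var i : lift Var i = Var i :> term L.
Proof. now destruct i. Qed.

Lemma subst_Var p : subst Var p = p.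
Proof.
induction p; simpl; rewrite ?tsubst_Var; try congruence; f_equal;
  rewrite <- IHp at 2; apply subst_ext, lift_Var.
Qed.

Lemma lift_comp (f g : nat -> term L) i :
  tsubst (lift g) (lift f i) = lift (fun i => tsubst g (f i)) i.
Proof.
destruct i as [|i]; simpl; auto.
now rewrite tsubst_up, up_tsubst.
Qed.

Lemma subst_comp p : forall f g,
  subst g (subst f p) = subst (fun i => tsubst g (f i)) p.
Proof.
induction p; simpl; intros f g; f_equal; rewrite ?tsubst_comp; auto;
  rewrite IHp; apply subst_ext, lift_comp.
Qed.

Lemma subst_inst f p t : subst f (inst p t) = inst (subst (lift f) p) (tsubst f t).
Proof.
unfold inst; rewrite !subst_comp; apply subst_ext; intros [|i]; simpl; auto.
now rewrite tsubst_up; simpl; rewrite tsubst_Var.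
Qed.

Lemma subst_fup f p : subst (lift f) (fup p) = fup (subst f p).
Proof. unfold fup; rewrite !subst_comp; now apply subst_ext. Qed.

Lemma inst_fup p t : inst (fup p) t = p.
Proof.
unfold inst, fup; rewrite subst_comp; transitivity (subst Var p); [now apply subst_ext|apply subst_Var].
Qed.

Lemma up_lift f n t : tsubst (lift f) (up (S n) t) = up 1 (tsubst f (up n t)).
Proof.
rewrite !tsubst_up, up_tsubst; now apply tsubst_ext.
Qed.

Lemma up_up n m t : up n (up m t) = up (n + m) t.
Proof.
unfold up; rewrite tsubst_comp; apply tsubst_ext; simpl; intros; f_equal; lia.
Qed.

Lemma up_0 t : up 0 t = t.
Proof. unfold up; simpl; apply tsubst_Var. Qed.

Lemma up_scons u f n t : tsubst (scons u f) (up (S n) t) = tsubst f (up n t).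
Proof. rewrite !tsubst_up; now apply tsubst_ext. Qed.

Lemma Delta0_subst p : Delta0 p -> forall f, Delta0 (subst f p).
Proof.
induction 1; intros f; simpl; try (constructor; auto; fail).
- unfold lt, sub, succ; simpl; rewrite up_lift, up_0.
  apply (@D0_all L (tsubst f t)); auto.
- unfold lt, sub, succ; simpl; rewrite up_lift, up_0.
  apply (@D0_ex L (tsubst f t)); auto.
Qed.

Lemma map_map_vec A B C n (f : A -> B) (g : B -> C) (v : vec A n) :
  Vector.map g (Vector.map f v) = Vector.map (fun x => g (f x)) v.
Proof. induction v; simpl; congruence. Qed.

Lemma map_ext_vec A B n (f g : A -> B) (v : vec A n) :
  (forall x, f x = g x) -> Vector.map f v = Vector.map g v.
Proof. intros H; induction v; simpl; congruence. Qed.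

Lemma HA_subst p : HA p -> forall h, HA (subst h p).
Proof.
intros H h; destruct H; simpl.
- apply HA_refl.
- rewrite !subst_inst; apply HA_leibniz.
- apply HA_succ_ne.
- apply HA_succ_inj.
- replace (tsubst h (Vector.nth ts i)) with (Vector.nth (Vector.map (tsubst h) ts) i).
  + apply HA_proj.
  + symmetry; clear; induction ts; [inversion i|].
    now apply (Fin.caseS' i).
- rewrite map_map_vec; simpl.
  apply HA_comp.
- apply HA_rec0.
- apply HA_recS.
- pose proof (@HA_recfun L i (Vector.map (tsubst h) ts)) as H.
  assert (E1 : Vector.map (tsubst (lift h)) (Vector.map (up 1) ts)
               = Vector.map (up 1) (Vector.map (tsubst h) ts)).
  { rewrite !map_map_vec; apply map_ext_vec; intros; now rewrite up_lift, up_0. }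
  assert (E2 : Vector.map (tsubst (lift (lift h))) (Vector.map (up 2) ts)
               = Vector.map (up 2) (Vector.map (tsubst h) ts)).
  { rewrite !map_map_vec; apply map_ext_vec; intros.
    now rewrite !up_lift, up_0, up_up. }
  unfold test, out, lt, sub, succ in *; simpl; rewrite E1, E2; exact H.
- rewrite subst_inst; simpl.
  replace (subst (lift h) (subst (scons (succ (Var 0)) (fun i => Var (S i))) p))
    with (subst (scons (succ (Var 0)) (fun i => Var (S i))) (subst (lift h) p)).
  + apply HA_induction.
  + rewrite !subst_comp; apply subst_ext; intros [|i]; simpl; auto.
    rewrite tsubst_up; reflexivity.
Qed.

Lemma EM2_subst p : EM2 p -> forall f, EM2 (subst f p).
Proof.
destruct 1 as [p [q [H ->]]]; intros f; simpl.
apply (@EM2_intro L (All (subst (lift (lift f)) q))).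
eexists; split; [|reflexivity]; now apply Delta0_subst.
Qed.

Lemma HA_EM2_subst p f : HA_EM2 p -> HA_EM2 (subst f p).
Proof. intros [H|H]; [left; now apply HA_subst|right; now apply EM2_subst]. Qed.

(** The axioms are schemes closed under substitution. This turns a derivation about a fresh free
    variable into one about an eigenvariable. *)
Lemma prv_subst G p : prv (@HA_EM2 L) G p ->
  forall f, prv (@HA_EM2 L) (map (subst f) G) (subst f p).
Proof.
assert (E : forall f G, map (subst (lift f)) (map (@fup L) G)
                        = map (@fup L) (map (subst f) G)).
{ intros f G0; rewrite !map_map; apply map_ext; intros; apply subst_fup. }
induction 1; intros h; simpl in *.
- now apply ByAx, HA_EM2_subst.
- now apply Hyp, in_map.
- now apply BotE.
- now apply AndI.
- eapply AndE1; eauto.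
- eapply AndE2; eauto.
- now apply OrI1.
- now apply OrI2.
- eapply OrE; eauto.
- now apply ImpI.
- eapply ImpE; eauto.
- apply AllI; rewrite <- E; auto.
- rewrite subst_inst; apply AllE; auto.
- apply ExI with (tsubst h t); rewrite <- subst_inst; auto.
- eapply ExE; eauto.
  rewrite <- E, <- subst_fup; auto.
Qed.

Lemma prv_weak G G' p : incl G G' -> prv (@HA_EM2 L) G p -> prv (@HA_EM2 L) G' p.
Proof.
intros HG H; revert G' HG; induction H; intros G' HG.
- now apply ByAx.
- apply Hyp; auto.
- apply BotE; auto.
- apply AndI; auto.
- eapply AndE1; auto.
- eapply AndE2; eauto.
- apply OrI1; auto.
- apply OrI2; auto.
- eapply OrE; [now apply IHprv1|apply IHprv2|apply IHprv3];
    intros x [->|Hx]; simpl; auto.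
- apply ImpI, IHprv; intros x [->|Hx]; simpl; auto.
- eapply ImpE; eauto.
- apply AllI, IHprv; now apply incl_map.
- apply AllE; auto.
- apply ExI with t; auto.
- eapply ExE; [now apply IHprv1|apply IHprv2].
  intros x [->|Hx]; [now left|right].
  revert x Hx; now apply incl_map.
Qed.

(** Finite support supplies the fresh variable of [all_i], and lets the congruence lemmas replace a
    substitution in finitely many steps. *)
Lemma term_support t : exists N, forall f g,
  (forall i, (i < N)%nat -> f i = g i) -> tsubst f t = tsubst g t.
Proof.
induction t using term_rect_vec.
- exists (S i); intros f g H; apply H; auto.
- assert (E : exists N, forall f g : nat -> term L, (forall i, (i < N)%nat -> f i = g i) ->
    Vector.map (tsubst f) ts = Vector.map (tsubst g) ts).
  { clear f; induction H as [|m t ts [N1 H1] _ [N2 H2]].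
    - now exists 0.
    - exists (N1 + N2); intros f g H; simpl; f_equal; [apply H1|apply H2];
      intros; apply H; lia. }
  destruct E as [N E]; exists N; intros; simpl; f_equal; auto.
Qed.

Lemma form_support p : exists N, forall f g,
  (forall i, (i < N)%nat -> f i = g i) -> subst f p = subst g p.
Proof.
assert (B : forall p, (exists N, forall f g : nat -> term L,
    (forall i, (i < N)%nat -> f i = g i) -> subst f p = subst g p) ->
  exists N, forall f g : nat -> term L,
    (forall i, (i < N)%nat -> f i = g i) -> subst (lift f) p = subst (lift g) p).
{ intros q [N H]; exists N; intros f g E; apply H; intros [|i] Hi; simpl; auto.
  rewrite E; auto; lia. }
induction p as [|s t|p [N1 H1] q [N2 H2]|p [N1 H1] q [N2 H2]|p [N1 H1] q [N2 H2]
  |p IH|p IH].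
- now exists 0.
- destruct (term_support s) as [N1 H1], (term_support t) as [N2 H2].
  exists (N1 + N2); intros f g E; simpl; f_equal; [apply H1|apply H2]; intros; apply E; lia.
- exists (N1 + N2); intros f g E; simpl; f_equal; [apply H1|apply H2]; intros; apply E; lia.
- exists (N1 + N2); intros f g E; simpl; f_equal; [apply H1|apply H2]; intros; apply E; lia.
- exists (N1 + N2); intros f g E; simpl; f_equal; [apply H1|apply H2]; intros; apply E; lia.
- destruct (B p IH) as [N H]; exists N; intros; simpl; f_equal; auto.
- destruct (B p IH) as [N H]; exists N; intros; simpl; f_equal; auto.
Qed.

Lemma ctx_support G : exists N, forall f g,
  (forall i, (i < N)%nat -> f i = g i) -> map (subst f) G = map (@subst L g) G.
Proof.
induction G as [|p G [N1 H1]].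
- now exists 0.
- destruct (form_support p) as [N2 H2]; exists (N1 + N2); intros f g E; simpl.
  f_equal; [apply H2|apply H1]; intros; apply E; lia.
Qed.

End Terms.

(** * Natural deduction with terms in place of eigenvariables *)

Notation "G ⊩ p" := (prv (@HA_EM2 _) G p%ha) (at level 99, p at level 98).

Section Rules.
Variable L : signature.
Implicit Types (s t u : term L) (p q r : form L) (G : list (form L)).

(* The renaming below turns the fresh variable [N] into the eigenvariable [0]. *)
Lemma all_i G p : (forall t, G ⊩ inst p t) -> G ⊩ All p.
Proof.
intros H.
destruct (ctx_support G) as [N1 H1], (form_support p) as [N2 H2].
set (N := N1 + N2).
pose (f := fun i => if Nat.eqb i N then Var 0 else @Var L (S i)).
apply AllI.
specialize (prv_subst (H (Var N)) f) as K.
replace (map (@fup L) G) with (map (subst f) G).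
- replace p with (subst f (inst p (Var N))) at 1; [exact K|].
  unfold inst; rewrite subst_comp; transitivity (subst Var p); [apply H2|apply subst_Var].
  intros [|i] Hi; simpl; unfold f.
  + now rewrite Nat.eqb_refl.
  + replace (Nat.eqb i N) with false; auto.
    symmetry; apply Nat.eqb_neq; lia.
- unfold fup; apply H1; intros i Hi; unfold f.
  replace (Nat.eqb i N) with false; auto.
  symmetry; apply Nat.eqb_neq; lia.
Qed.

Lemma imp_i G p q :
  (forall G', incl G G' -> (G' ⊩ p) -> (G' ⊩ q)) -> G ⊩ p ⇒ q.
Proof.
intros H; apply ImpI, H; [intros x Hx; now right|apply Hyp; now left].
Qed.

Lemma imp_e G p q : (G ⊩ p ⇒ q) -> (G ⊩ p) -> G ⊩ q.
Proof. apply ImpE. Qed.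

Lemma or_e G p q r : (G ⊩ p ∨ q) ->
  (forall G', incl G G' -> (G' ⊩ p) -> (G' ⊩ r)) ->
  (forall G', incl G G' -> (G' ⊩ q) -> (G' ⊩ r)) -> G ⊩ r.
Proof.
intros H H1 H2; eapply OrE; [exact H|apply H1|apply H2];
  try (apply Hyp; now left); intros x Hx; now right.
Qed.

(** A derivable existential yields no witness in Rocq. Elimination therefore takes a continuation,
    for an arbitrary term in an arbitrary larger context; most existence lemmas below have this
    form. *)
Lemma ex_e G p r : (G ⊩ Ex p) ->
  (forall G' t, incl G G' -> (G' ⊩ inst p t) -> (G' ⊩ r)) -> G ⊩ r.
Proof.
intros H H1; eapply ImpE with (Ex p); [|exact H].
assert (K : G ⊩ All (p ⇒ fup r)).
{ apply all_i; intros t; cbn; change (G ⊩ inst p t ⇒ inst (fup r) t).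
  rewrite inst_fup.
  apply imp_i; intros G' HG H2; eapply H1; eauto. }
apply ImpI; eapply ExE; [apply Hyp; now left|].
eapply ImpE; [|apply Hyp; now left].
(* Below the eigenvariable of [ExE], this implication is the instance at [Var 0] of [K] shifted by
   one variable. *)
assert (E : Imp p (fup r) =
  inst (subst (scons (Var 0) (fun i => Var (S (S i)))) (Imp p (fup r))) (Var 0)).
{ unfold inst; rewrite subst_comp; transitivity (subst Var (Imp p (fup r))); [symmetry; apply subst_Var|].
  apply subst_ext; now intros [|i]. }
rewrite E; apply AllE.
eapply prv_weak; [|exact (prv_subst K (fun i => Var (S i)))].
{ intros x Hx; right; right; exact Hx. }
Qed.
End Rules.

(** * Computation of substitutions *)

Section Simp.
Variable L : signature.
Implicit Types (s t u : term L) (p q : form L) (f : nat -> term L).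
Lemma subst_Bot f : subst f Bot = Bot. Proof. reflexivity. Qed.
Lemma subst_Eq f s t : subst f (s == t) = (tsubst f s == tsubst f t). Proof. reflexivity. Qed.
Lemma subst_And f p q : subst f (p ∧ q) = (subst f p ∧ subst f q). Proof. reflexivity. Qed.
Lemma subst_Or f p q : subst f (p ∨ q) = (subst f p ∨ subst f q). Proof. reflexivity. Qed.
Lemma subst_Imp f p q : subst f (p ⇒ q) = (subst f p ⇒ subst f q). Proof. reflexivity. Qed.
Lemma subst_Neg f p : subst f (¬ p) = (¬ subst f p). Proof. reflexivity. Qed.
Lemma subst_Iff f p q : subst f (p ⇔ q) = (subst f p ⇔ subst f q). Proof. reflexivity. Qed.
Lemma subst_All f p : subst f (All p) = All (subst (lift f) p). Proof. reflexivity. Qed.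
Lemma subst_Ex f p : subst f (Ex p) = Ex (subst (lift f) p). Proof. reflexivity. Qed.
Lemma subst_lt f s t : subst f (s < t) = (tsubst f s < tsubst f t). Proof. reflexivity. Qed.
Lemma tsubst_Var_app f i : tsubst f (Var i) = f i. Proof. reflexivity. Qed.
Lemma scons_0 f t : scons t f 0 = t. Proof. reflexivity. Qed.
Lemma scons_S f t i : scons t f (S i) = f i. Proof. reflexivity. Qed.
Lemma lift_0 f : lift f 0 = Var 0. Proof. reflexivity. Qed.
Lemma lift_S f i : lift f (S i) = up 1 (f i). Proof. reflexivity. Qed.
Lemma up_Var n i : up n (Var i) = Var (n + i) :> term L. Proof. reflexivity. Qed.
Lemma tsubst_zero f : tsubst f zero = zero. Proof. reflexivity. Qed.
Lemma tsubst_succ f t : tsubst f (succ t) = succ (tsubst f t). Proof. reflexivity. Qed.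
Lemma tsubst_num f n : tsubst f (num n) = num n.
Proof. induction n; [reflexivity|]. change (succ (tsubst f (num n)) = succ (num n)). now rewrite IHn. Qed.
Lemma tsubst_color c f t s u :
  tsubst f (color c t s u) = color c (tsubst f t) (tsubst f s) (tsubst f u).
Proof. reflexivity. Qed.
End Simp.

#[export] Hint Rewrite subst_Bot subst_Eq subst_And subst_Or subst_Imp subst_Neg subst_Iff
  subst_All subst_Ex subst_lt tsubst_Var_app scons_0 scons_S lift_0 lift_S up_Var
  tsubst_zero tsubst_succ tsubst_num tsubst_color tsubst_Var up_0 up_up up_scons up_lift : ha.

Definition ball L (n : term L) (F : term L -> form L) : form L :=
  All (Var 0 < up 1 n ⇒ F (Var 0)).
Definition bex L (n : term L) (F : term L -> form L) : form L :=
  Ex (Var 0 < up 1 n ∧ F (Var 0)).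

Ltac simp_unfold := unfold inst, ball, bex, all1, all2, all3, all4, all5, ex1, ex2, Iff.
Ltac simp_step := repeat (progress (autorewrite with ha; cbn [Nat.add])).
Ltac simp := simp_unfold; simp_step.
Tactic Notation "simp" "in" hyp(H) :=
  unfold inst, ball, bex, all1, all2, all3, all4, all5, ex1, ex2, Iff in H;
  repeat (progress (autorewrite with ha in H; cbn [Nat.add] in H)).

(** * Equality *)

Definition teq L (G : list (form L)) (s t : term L) : Prop := G ⊩ s == t.
Definition fle L (G : list (form L)) (p q : form L) : Prop := G ⊩ p ⇔ q.

Section Equality.
Variable L : signature.
Implicit Types (s t u : term L) (p q : form L) (G : list (form L)).

Lemma ax_ha G p : HA p -> G ⊩ p.
Proof. intros H; apply ByAx; now left. Qed.

Lemma eq_refl_ G t : G ⊩ t == t.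
Proof. apply ax_ha, HA_refl. Qed.

Lemma leibniz (P : term L -> form L) p G s t : (forall u, inst p u = P u) ->
  (G ⊩ s == t) -> (G ⊩ P s) -> G ⊩ P t.
Proof.
intros E H1 H2; rewrite <- E in *.
eapply imp_e; [eapply imp_e; [|exact H1]|exact H2].
apply ax_ha, HA_leibniz.
Qed.

Lemma eq_sym_ G s t : (G ⊩ s == t) -> G ⊩ t == s.
Proof.
intros H; apply (@leibniz (fun u => u == s) (Var 0 == up 1 s) G s t); auto.
- intros u; now simp.
- apply eq_refl_.
Qed.

Lemma eq_trans_ G s t u : (G ⊩ s == t) -> (G ⊩ t == u) -> G ⊩ s == u.
Proof.
intros H1 H2; apply (@leibniz (fun u => s == u) (up 1 s == Var 0) G t u); auto.
intros v; now simp.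
Qed.

#[export] Instance teq_equiv G : Equivalence (teq G).
Proof.
split; red; unfold teq.
- apply eq_refl_.
- apply eq_sym_.
- apply eq_trans_.
Qed.

(** The Leibniz axiom has a single hole, so [f] is changed into [g] one variable at a time; by
    [term_support] finitely many steps suffice. *)
Lemma tsubst_cong G t (f g : nat -> term L) :
  (forall i, teq G (f i) (g i)) -> teq G (tsubst f t) (tsubst g t).
Proof.
intros H.
pose (h := fun j i => if Nat.ltb i j then g i else f i).
assert (step : forall j, teq G (tsubst (h j) t) (tsubst (h (S j)) t)).
{ intros j; pose (k := fun u i => if Nat.eqb i j then u else h j i).
  assert (E0 : tsubst (h j) t = tsubst (k (f j)) t).
  { apply tsubst_ext; intros i; unfold k, h.
    destruct (Nat.eqb_spec i j) as [->|]; auto; now rewrite Nat.ltb_irrefl. }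
  assert (E1 : tsubst (h (S j)) t = tsubst (k (g j)) t).
  { apply tsubst_ext; intros i; unfold k, h.
    destruct (Nat.eqb_spec i j) as [->|].
    - destruct (Nat.ltb_spec j (S j)); auto; lia.
    - destruct (Nat.ltb_spec i j), (Nat.ltb_spec i (S j)); auto; lia. }
  rewrite E1.
  apply (@leibniz (fun u => tsubst (h j) t == tsubst (k u) t)
    (up 1 (tsubst (h j) t) ==
     tsubst (fun i => if Nat.eqb i j then Var 0 else up 1 (h j i)) t) G (f j)).
  - intros u; unfold inst; simpl; simp_step; f_equal.
    rewrite tsubst_comp; apply tsubst_ext; intros i; unfold k.
    destruct (Nat.eqb i j); simp_step; reflexivity.
  - apply H.
  - rewrite E0; apply eq_refl_. }
assert (chain : forall j, teq G (tsubst (h 0) t) (tsubst (h j) t)).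
{ induction j; [reflexivity|]; etransitivity; eauto. }
destruct (term_support t) as [N HN].
transitivity (tsubst (h N) t).
- replace (tsubst f t) with (tsubst (h 0) t); [apply chain|now apply tsubst_ext].
- replace (tsubst (h N) t) with (tsubst g t); [reflexivity|].
  apply HN; intros i Hi; unfold h; destruct (Nat.ltb_spec i N); auto; lia.
Qed.

Inductive veq G : forall n, vec (term L) n -> vec (term L) n -> Prop :=
| veq_nil : veq G vnil vnil
| veq_cons n s t (us vs : vec _ n) : teq G s t -> veq G us vs ->
    veq G (vcons s us) (vcons t vs).

Fixpoint vars n : vec (term L) n :=
  match n with 0 => vnil | S n => vcons (Var 0) (Vector.map (up 1) (vars n)) end.

Fixpoint vfun n (us : vec (term L) n) : nat -> term L :=
  match us with Vector.nil _ => Var | Vector.cons _ u _ us => scons u (vfun us) end.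

Lemma map_vars n (us : vec (term L) n) : Vector.map (tsubst (vfun us)) (vars n) = us.
Proof.
induction us as [|u n us IH]; simpl; f_equal.
transitivity (Vector.map (tsubst (vfun us)) (vars n)); [|exact IH].
rewrite map_map_vec; apply map_ext_vec; intros t.
now rewrite up_scons, up_0.
Qed.

(** A vector of arguments is the vector [vars n] under a substitution, which reduces the claim to
    [tsubst_cong]. *)
Lemma App_cong G n (us vs : vec (term L) n) (f : fsym L n) :
  veq G us vs -> teq G (App f us) (App f vs).
Proof.
intros H.
rewrite <- (map_vars us), <- (map_vars vs).
apply (@tsubst_cong G (App f (vars n)) (vfun us) (vfun vs)).
clear f; induction H as [|n s t us vs Hst _ IH]; intros i; simpl; [reflexivity|].
destruct i; simpl; auto.
Qed.

#[export] Instance veq_equiv G n : Equivalence (@veq G n).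
Proof.
split; red.
- induction x; constructor; auto; reflexivity.
- induction 1; constructor; auto; now symmetry.
- intros x y z H; revert z; induction H; intros z Hz; auto.
  inversion Hz; subst.
  match goal with E : existT _ _ _ = existT _ _ _ |- _ =>
    apply Eqdep_dec.inj_pair2_eq_dec in E; [|apply Nat.eq_dec]; subst end.
  constructor; [etransitivity; eauto|].
  apply IHveq; match goal with E : existT _ _ _ = existT _ _ _ |- _ =>
    apply Eqdep_dec.inj_pair2_eq_dec in E; [|apply Nat.eq_dec]; subst end; auto.
Qed.

#[export] Instance App_proper G n (f : fsym L n) : Proper (@veq G n ==> teq G) (App f).
Proof. intros us vs; apply App_cong. Qed.

#[export] Instance Eq_proper G : Proper (teq G ==> teq G ==> fle G) (@Eq L).
Proof.
intros s s' H t t' K; unfold fle; apply AndI; apply imp_i; intros G' HG E;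
  apply (prv_weak HG) in H, K.
- exact (eq_trans_ (eq_sym_ H) (eq_trans_ E K)).
- exact (eq_trans_ H (eq_trans_ E (eq_sym_ K))).
Qed.

End Equality.
#[export] Instance fle_equiv L G : Equivalence (@fle L G).
Proof.
unfold fle; split; red.
- intros p; apply AndI; apply imp_i; auto.
- intros p q H; apply AndI; [exact (AndE2 H)|exact (AndE1 H)].
- intros p q r H K; apply AndI; apply imp_i; intros G' HG E;
    apply (prv_weak HG) in H, K.
  + exact (imp_e (AndE1 K) (imp_e (AndE1 H) E)).
  + exact (imp_e (AndE2 H) (imp_e (AndE2 K) E)).
Qed.
#[export] Instance prv_proper L G : Proper (fle G ==> iff) (prv (@HA_EM2 L) G).
Proof.
intros p q H; split; intros K; [exact (imp_e (AndE1 H) K)|exact (imp_e (AndE2 H) K)].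
Qed.
#[export] Instance And_proper L G : Proper (fle G ==> fle G ==> fle G) (@And L).
Proof.
intros p p' H q q' H'; apply AndI; apply imp_i; intros G' HG E;
  apply (prv_weak HG) in H, H'; apply AndI.
- exact (imp_e (AndE1 H) (AndE1 E)).
- exact (imp_e (AndE1 H') (AndE2 E)).
- exact (imp_e (AndE2 H) (AndE1 E)).
- exact (imp_e (AndE2 H') (AndE2 E)).
Qed.
#[export] Instance Or_proper L G : Proper (fle G ==> fle G ==> fle G) (@Or L).
Proof.
intros p p' H q q' H'; apply AndI; apply imp_i; intros G' HG E;
  apply (or_e E); intros G2 HG2 K; pose proof (incl_tran HG HG2) as HG3;
  apply (prv_weak HG3) in H, H'.
- exact (OrI1 _ (imp_e (AndE1 H) K)).
- exact (OrI2 _ (imp_e (AndE1 H') K)).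
- exact (OrI1 _ (imp_e (AndE2 H) K)).
- exact (OrI2 _ (imp_e (AndE2 H') K)).
Qed.
#[export] Instance Imp_proper L G : Proper (fle G ==> fle G ==> fle G) (@Imp L).
Proof.
intros p p' H q q' H'; apply AndI; apply imp_i; intros G' HG E;
  apply imp_i; intros G2 HG2 K; pose proof (incl_tran HG HG2) as HG3;
  apply (prv_weak HG3) in H, H'; apply (prv_weak HG2) in E.
- exact (imp_e (AndE1 H') (imp_e E (imp_e (AndE2 H) K))).
- exact (imp_e (AndE2 H') (imp_e E (imp_e (AndE1 H) K))).
Qed.
#[export] Instance Neg_proper L G : Proper (fle G ==> fle G) (@Neg L).
Proof. intros p p' H; unfold Neg; now rewrite H. Qed.
#[export] Instance Iff_proper L G : Proper (fle G ==> fle G ==> fle G) (@Iff L).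
Proof. intros p p' H q q' H'; unfold Iff; now rewrite H, H'. Qed.

(** * Primitive recursive functions *)

Definition fn1 L (f : pr 1) (t : term L) := App (Fpr L f) (vcons t vnil).
Definition fn2 L (f : pr 2) (t u : term L) := App (Fpr L f) (vcons t (vcons u vnil)).
Arguments fn1 : simpl never.
Arguments fn2 : simpl never.

Ltac ev :=
  lazymatch goal with
  | |- teq ?G (App (Fpr _ (PComp ?f ?gs)) ?ts) _ =>
      etransitivity; [apply ax_ha, HA_comp|]; cbn [Vector.map];
      etransitivity; [apply App_cong; ev_args|]; ev
  | |- teq ?G (App (Fpr _ (PProj ?i)) ?ts) _ =>
      etransitivity; [apply ax_ha, HA_proj|]; cbn; ev
  | |- _ => try reflexivity
  end
with ev_args :=
  lazymatch goal with
  | |- veq _ vnil _ => apply veq_nil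
  | |- veq _ _ _ => apply veq_cons; [ev|ev_args]
  end.

Ltac ev_rec := unfold fn1, fn2;
  etransitivity; [apply ax_ha; first [apply HA_rec0|apply HA_recS]|]; ev.

#[export] Instance fn1_proper L G f : Proper (teq G ==> teq G) (@fn1 L f).
Proof. intros s t H; apply App_cong; repeat first [apply veq_nil|apply veq_cons]; auto using eq_refl_. Qed.
#[export] Instance fn2_proper L G f : Proper (teq G ==> teq G ==> teq G) (@fn2 L f).
Proof. intros s t H s' t' H'; apply App_cong; repeat first [apply veq_nil|apply veq_cons]; auto using eq_refl_. Qed.
#[export] Instance succ_proper L G : Proper (teq G ==> teq G) (@succ L).
Proof. intros s t H; apply App_cong; repeat first [apply veq_nil|apply veq_cons]; auto using eq_refl_. Qed.
#[export] Instance sub_proper L G : Proper (teq G ==> teq G ==> teq G) (@sub L).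
Proof. intros s t H s' t' H'; apply App_cong; repeat first [apply veq_nil|apply veq_cons]; auto using eq_refl_. Qed.
#[export] Instance color_proper L G c : Proper (teq G ==> teq G ==> teq G ==> teq G) (@color L c).
Proof. intros s t H s' t' H' s'' t'' H''; apply App_cong; repeat first [apply veq_nil|apply veq_cons]; auto using eq_refl_. Qed.
#[export] Instance lt_proper L G : Proper (teq G ==> teq G ==> fle G) (@lt L).
Proof. intros s t H s' t' H'; unfold lt; now rewrite H, H'. Qed.

Definition pr_isz : pr 1 := PRec (PComp PSucc (vcons PZero vnil)) (PComp PZero vnil).
Definition pr_par : pr 1 := PRec PZero (PComp pr_isz (vcons (PProj (Fin.FS Fin.F1)) vnil)).
Definition pr_add : pr 2 :=
  PRec (PProj Fin.F1) (PComp PSucc (vcons (PProj (Fin.FS Fin.F1)) vnil)).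
(** The recursion is half(x+1) = (x mod 2) + half(x). *)
Definition pr_half : pr 1 :=
  PRec PZero (PComp pr_add (vcons (PComp pr_par (vcons (PProj Fin.F1) vnil))
                             (vcons (PProj (Fin.FS Fin.F1)) vnil))).
Definition pr_dbl : pr 1 :=
  PRec PZero (PComp PSucc (vcons (PComp PSucc (vcons (PProj (Fin.FS Fin.F1)) vnil)) vnil)).
(* [pr_shift [m; b]] is b with its m lowest binary digits removed. *)
Definition pr_shift : pr 2 :=
  PRec (PProj Fin.F1) (PComp pr_half (vcons (PProj (Fin.FS Fin.F1)) vnil)).
(* [pr_pow [n; m]] is (m + 1) 2^n. *)
Definition pr_pow : pr 2 :=
  PRec PSucc (PComp pr_dbl (vcons (PProj (Fin.FS Fin.F1)) vnil)).

Section PR.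
Variable L : signature.
Implicit Types (s t u : term L) (G : list (form L)).
Notation isz := (@fn1 L pr_isz).
Notation par := (@fn1 L pr_par).
Notation half := (@fn1 L pr_half).
Notation dbl := (@fn1 L pr_dbl).
Notation add := (@fn2 L pr_add).
Notation shift := (@fn2 L pr_shift).
Notation pow := (@fn2 L pr_pow).
Notation pred := (@fn1 L pr_pred).

Lemma isz_0 G : teq G (isz zero) (succ zero). Proof. ev_rec. Qed.
Lemma isz_S G t : teq G (isz (succ t)) zero. Proof. ev_rec. Qed.
Lemma par_0 G : teq G (par zero) zero. Proof. ev_rec. Qed.
Lemma par_S G t : teq G (par (succ t)) (isz (par t)). Proof. ev_rec. Qed.
Lemma add_0 G u : teq G (add zero u) u. Proof. ev_rec. Qed.
Lemma add_S G t u : teq G (add (succ t) u) (succ (add t u)). Proof. ev_rec. Qed.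
Lemma half_0 G : teq G (half zero) zero. Proof. ev_rec. Qed.
Lemma half_S G t : teq G (half (succ t)) (add (par t) (half t)). Proof. ev_rec. Qed.
Lemma dbl_0 G : teq G (dbl zero) zero. Proof. ev_rec. Qed.
Lemma dbl_S G t : teq G (dbl (succ t)) (succ (succ (dbl t))). Proof. ev_rec. Qed.
Lemma shift_0 G u : teq G (shift zero u) u. Proof. ev_rec. Qed.
Lemma shift_S G t u : teq G (shift (succ t) u) (half (shift t u)). Proof. ev_rec. Qed.
Lemma pow_0 G u : teq G (pow zero u) (succ u). Proof. ev_rec. Qed.
Lemma pow_S G t u : teq G (pow (succ t) u) (dbl (pow t u)). Proof. ev_rec. Qed.
Lemma pred_0 G : teq G (pred zero) zero. Proof. ev_rec. Qed.
Lemma pred_S G t : teq G (pred (succ t)) t. Proof. ev_rec. Qed.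
Lemma sub_0 G u : teq G (sub u zero) u. Proof. unfold sub; ev_rec. Qed.
Lemma sub_S G u t : teq G (sub u (succ t)) (pred (sub u t)). Proof. unfold sub; ev_rec. Qed.
Lemma tsubst_fn1 (f : pr 1) g t : tsubst g (fn1 f t) = fn1 f (tsubst g t).
Proof. reflexivity. Qed.
Lemma tsubst_fn2 (f : pr 2) g t u : tsubst g (fn2 f t u) = fn2 f (tsubst g t) (tsubst g u).
Proof. reflexivity. Qed.
Lemma tsubst_sub g t u : tsubst g (sub t u) = sub (tsubst g t) (tsubst g u).
Proof. reflexivity. Qed.
End PR.
#[export] Hint Rewrite tsubst_fn1 tsubst_fn2 tsubst_sub : ha.

Notation "x <= y" := (lt x (succ y)) : ha_scope.

(** * Congruence for formulas, and induction *)

Section Congruence.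
Variable L : signature.
Implicit Types (s t u : term L) (p q r : form L) (G : list (form L)).

Lemma all_e G p t : (G ⊩ All p) -> G ⊩ inst p t.
Proof. apply AllE. Qed.

Lemma subst_cong G p (f g : nat -> term L) :
  (forall i, teq G (f i) (g i)) -> (G ⊩ subst f p) -> G ⊩ subst g p.
Proof.
intros H.
pose (h := fun j i => if Nat.ltb i j then g i else f i).
assert (step : forall j, (G ⊩ subst (h j) p) -> G ⊩ subst (h (S j)) p).
{ intros j Hj; pose (k := fun u i => if Nat.eqb i j then u else h j i).
  replace (subst (h (S j)) p) with (subst (k (g j)) p).
  2:{ apply subst_ext; intros i; unfold k, h.
    destruct (Nat.eqb_spec i j) as [->|].
    - destruct (Nat.ltb_spec j (S j)); auto; lia.
    - destruct (Nat.ltb_spec i j), (Nat.ltb_spec i (S j)); auto; lia. }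
  apply (@leibniz L (fun u => subst (k u) p)
     (subst (fun i => if Nat.eqb i j then Var 0 else up 1 (h j i)) p) G (f j)).
  - intros u; unfold inst; rewrite subst_comp; apply subst_ext; intros i; unfold k.
    destruct (Nat.eqb i j); simp_step; reflexivity.
  - apply H.
  - replace (subst (k (f j)) p) with (subst (h j) p); auto.
    apply subst_ext; intros i; unfold k, h.
    destruct (Nat.eqb_spec i j) as [->|]; auto; now rewrite Nat.ltb_irrefl. }
intros H0.
assert (chain : forall j, G ⊩ subst (h j) p).
{ induction j; auto. }
destruct (form_support p) as [N HN].
replace (subst g p) with (subst (h N) p); auto.
apply HN; intros i Hi; unfold h; destruct (Nat.ltb_spec i N); auto; lia.
Qed.

Definition natural2 (P : term L -> term L -> form L) :=
  forall f s t, subst f (P s t) = P (tsubst f s) (tsubst f t).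
Definition natural3 (P : term L -> term L -> term L -> form L) :=
  forall f s t u, subst f (P s t u) = P (tsubst f s) (tsubst f t) (tsubst f u).
Definition natural4 (P : term L -> term L -> term L -> term L -> form L) :=
  forall f s t u v, subst f (P s t u v) =
    P (tsubst f s) (tsubst f t) (tsubst f u) (tsubst f v).
Definition natural5 (P : term L -> term L -> term L -> term L -> term L -> form L) :=
  forall f s t u v w, subst f (P s t u v w) =
    P (tsubst f s) (tsubst f t) (tsubst f u) (tsubst f v) (tsubst f w).
Definition natural6 (P : term L -> term L -> term L -> term L -> term L -> term L -> form L) :=
  forall f s t u v w x, subst f (P s t u v w x) =
    P (tsubst f s) (tsubst f t) (tsubst f u) (tsubst f v) (tsubst f w) (tsubst f x).

(** A predicate that commutes with substitution is a substitution instance of its own value at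
    variables, so [subst_cong] applies. The smaller arities are obtained by adding dummy
    arguments. *)
Lemma natural6_proper P G : natural6 P ->
  Proper (teq G ==> teq G ==> teq G ==> teq G ==> teq G ==> teq G ==> fle G) P.
Proof.
intros N a a' Ha b b' Hb c c' Hc d d' Hd e e' He g g' Hg.
assert (K : forall a b c d e g, P a b c d e g =
  subst (scons a (scons b (scons c (scons d (scons e (scons g Var))))))
    (P (Var 0) (Var 1) (Var 2) (Var 3) (Var 4) (Var 5))) by now intros; rewrite N.
apply AndI; apply imp_i; intros G' HG;
  apply (prv_weak HG) in Ha, Hb, Hc, Hd, He, Hg;
  rewrite (K a), (K a'); apply subst_cong;
  intros [|[|[|[|[|[|i]]]]]]; simpl; auto; try reflexivity; now apply eq_sym_.
Qed.
Lemma natural5_proper P G : natural5 P ->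
  Proper (teq G ==> teq G ==> teq G ==> teq G ==> teq G ==> fle G) P.
Proof.
intros N; exact (@natural6_proper (fun _ => P) G (fun f _ => N f) zero zero (eq_refl_ G zero)).
Qed.
Lemma natural4_proper P G : natural4 P ->
  Proper (teq G ==> teq G ==> teq G ==> teq G ==> fle G) P.
Proof.
intros N; exact (@natural5_proper (fun _ => P) G (fun f _ => N f) zero zero (eq_refl_ G zero)).
Qed.
Lemma natural3_proper P G : natural3 P ->
  Proper (teq G ==> teq G ==> teq G ==> fle G) P.
Proof.
intros N; exact (@natural4_proper (fun _ => P) G (fun f _ => N f) zero zero (eq_refl_ G zero)).
Qed.
Lemma natural2_proper P G : natural2 P -> Proper (teq G ==> teq G ==> fle G) P.
Proof.
intros N; exact (@natural3_proper (fun _ => P) G (fun f _ => N f) zero zero (eq_refl_ G zero)).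
Qed.

(* [F g t] is a predicate of [t] whose parameters are moved by [g]: [F (fun a => a)] is
   the predicate itself, and [F (up 1) (Var 0)] its body below a binder. *)
Definition schema (F : (term L -> term L) -> term L -> form L) :=
  forall u, inst (F (up 1) (Var 0)) u = F (fun a => a) u.

Lemma induction F G : schema F -> (G ⊩ F (fun a => a) zero) ->
  (forall G', incl G G' -> forall t, (G' ⊩ F (fun a => a) t) -> G' ⊩ F (fun a => a) (succ t)) ->
  forall t, G ⊩ F (fun a => a) t.
Proof.
intros E H0 HS t; rewrite <- E; apply all_e.
eapply imp_e; [eapply imp_e; [apply ax_ha, HA_induction|now rewrite E]|].
apply all_i; intros u; unfold inst; rewrite subst_Imp, subst_comp.
replace (subst _ _) with (F (fun a => a) u) by (symmetry; apply E).
replace (subst _ _) with (F (fun a => a) (succ u)).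
- apply imp_i; auto.
- rewrite <- E; apply subst_ext; now intros [|i].
Qed.
End Congruence.

(* Moves the hypotheses to the larger context of [HG], including those which are
   quantified over all larger contexts. *)
Ltac wk HG :=
  lazymatch type of HG with incl ?G ?G' =>
    repeat match goal with
    | H : prv _ G _ |- _ => apply (prv_weak HG) in H
    | H : teq G ?s ?t |- _ => apply (prv_weak HG) in H; change (teq G' s t) in H
    | H : forall G2, incl G G2 -> _ |- _ =>
        let H' := fresh "Hx" in
        pose proof (fun G2 (K : incl G' G2) => H G2 (incl_tran HG K)) as H';
        clear H; rename H' into H
    end; clear HG; try (clear G; rename G' into G)
  end.

Ltac iA x := apply all_i; intros x; simp.
Ltac iI H := apply imp_i; let G := fresh "G" in let HG := fresh "HGx" in
  intros G HG H; wk HG.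
Ltac intro1 x :=
  simp_unfold;
  lazymatch goal with
  | |- prv _ _ (All _) => iA x
  | |- prv _ _ (Imp _ _) => iI x
  | |- prv _ _ (Neg _) => unfold Neg at 1; iI x
  end.
Tactic Notation "ii" ident(a) := intro1 a.
Tactic Notation "ii" ident(a) ident(b) := intro1 a; intro1 b.
Tactic Notation "ii" ident(a) ident(b) ident(c) := intro1 a; intro1 b; intro1 c.
Tactic Notation "ii" ident(a) ident(b) ident(c) ident(d) :=
  intro1 a; intro1 b; intro1 c; intro1 d.
Tactic Notation "ii" ident(a) ident(b) ident(c) ident(d) ident(e) :=
  intro1 a; intro1 b; intro1 c; intro1 d; intro1 e.
Ltac dor H := let H' := fresh "Hx" in rename H into H';
  apply (or_e H'); [clear H'|clear H']; let G := fresh "G" in let HG := fresh "HGx" in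
  intros G HG H; wk HG.
Ltac dex H x := let H' := fresh "Hx" in rename H into H'; simp in H';
  apply (ex_e H'); clear H'; let G := fresh "G" in let HG := fresh "HGx" in
  intros G x HG H; wk HG; simp in H.
Ltac dand H K := let H' := fresh "Hx" in rename H into H';
  pose proof (AndE1 H') as H; pose proof (AndE2 H') as K; clear H'.
Ltac iex t := simp_unfold; apply ExI with t; simp.
Ltac il := apply OrI1.
Ltac ir := apply OrI2.
Ltac isplit := apply AndI.
Ltac ispec H t := simp in H; apply (all_e t) in H; simp in H.
Ltac imp H K := apply (fun a => imp_e a K) in H.
Ltac impg H := match type of H with prv _ ?G (Imp ?p ?q) =>
  let K := fresh "Kx" in assert (K : prv (@HA_EM2 _) G p); [|imp H K; clear K] end.

Ltac itauto_step :=
  match goal with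
  | H : prv _ ?G ?p |- prv _ ?G ?p => exact H
  | H : prv _ ?G Bot |- prv _ ?G _ => exact (BotE _ H)
  | |- prv _ _ (And _ _) => isplit
  | |- prv _ _ (Imp _ _) => let H := fresh "Hx" in iI H
  | |- prv _ _ (Neg _) => let H := fresh "Hx" in unfold Neg at 1; iI H
  | H : prv _ _ (And _ _) |- _ => let K := fresh "Kx" in dand H K
  | H : prv _ ?G (Imp ?p ?q), K : prv _ ?G ?p |- _ => imp H K
  | H : prv _ ?G (Neg ?p), K : prv _ ?G ?p |- _ => exact (BotE _ (imp_e H K))
  | H : prv _ _ (Or _ _) |- _ => dor H
  end.
Ltac itauto := simp_unfold; repeat itauto_step; try (first [il; solve [itauto]|ir; solve [itauto]]).

Ltac schema_tac := intros ?u; cbv beta; simp; try reflexivity.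
Tactic Notation "iinduction" uconstr(F) constr(x) :=
  simple refine (@induction _ F _ _ _ _ x); [schema_tac|cbv beta|cbv beta;
   let G := fresh "G" in let HG := fresh "HGx" in let IH := fresh "IH" in
   intros G HG ?n IH; wk HG].

Ltac rw H := let E := fresh "Ex" in pose proof H as E;
  match type of E with prv _ ?G (Eq ?s ?t) => change (teq G s t) in E; rewrite E; clear E end.
Ltac rwl H := let E := fresh "Ex" in pose proof H as E;
  match type of E with prv _ ?G (Eq ?s ?t) => change (teq G s t) in E; rewrite <- E; clear E end.
Ltac rwin H K := let E := fresh "Ex" in pose proof H as E;
  match type of E with prv _ ?G (Eq ?s ?t) => change (teq G s t) in E; rewrite E in K; clear E end.
Ltac rwlin H K := let E := fresh "Ex" in pose proof H as E;
  match type of E with prv _ ?G (Eq ?s ?t) => change (teq G s t) in E; rewrite <- E in K; clear E end.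

(** * Order *)

Section Arith.
Variable L : signature.
Implicit Types (s t u x y z : term L) (p q r : form L) (G : list (form L)).
Notation pred := (@fn1 L pr_pred).

Lemma succ_ne G t : (G ⊩ succ t == zero) -> G ⊩ Bot.
Proof. intros H; eapply imp_e; [apply ax_ha, HA_succ_ne|exact H]. Qed.

Lemma case_nat G t : G ⊩ t == zero ∨ ex1 (fun n => up 1 t == succ n).
Proof.
iinduction (fun _ x => x == zero ∨ ex1 (fun n => up 1 x == succ n)) t.
- il; apply eq_refl_.
- ir; iex n; apply eq_refl_.
Qed.

Lemma sub_0_l G y : teq G (sub zero y) zero.
Proof.
unfold teq; iinduction (fun _ y => sub zero y == zero) y.
- apply sub_0.
- rewrite sub_S; rw IH; apply pred_0.
Qed.

Lemma sub_succ G x y : teq G (sub (succ x) (succ y)) (sub x y).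
Proof.
unfold teq; iinduction (fun g y => sub (succ (g x)) (succ y) == sub (g x) y) y.
- rewrite sub_S, !sub_0; apply pred_S.
- rewrite sub_S; rw IH; apply eq_sym_, sub_S.
Qed.

Lemma lt_0_S G y : G ⊩ zero < succ y.
Proof. unfold lt; rewrite sub_succ; apply sub_0_l. Qed.
Lemma nlt_0 G p x : (G ⊩ x < zero) -> G ⊩ p.
Proof. unfold lt; rewrite sub_0; intros H; apply BotE, (succ_ne H). Qed.
Lemma lt_S_S G x y : (G ⊩ x < y) -> G ⊩ succ x < succ y.
Proof. unfold lt; now rewrite sub_succ. Qed.
Lemma lt_S_inv G x y : (G ⊩ succ x < succ y) -> G ⊩ x < y.
Proof. unfold lt; now rewrite sub_succ. Qed.

Lemma lt_Sn G x : G ⊩ x < succ x.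
Proof.
iinduction (fun _ x => x < succ x) x; [apply lt_0_S|now apply lt_S_S].
Qed.

Lemma lt_succ_cases G x y : (G ⊩ x < succ y) -> G ⊩ x < y ∨ x == y.
Proof.
enough (H : G ⊩ all1 (fun x => x < succ (up 1 y) ⇒ x < up 1 y ∨ x == up 1 y)).
{ ispec H x; apply imp_e, H. }
iinduction (fun _ y => all1 (fun x => x < succ (up 1 y) ⇒ x < up 1 y ∨ x == up 1 y)) y.
- ii u H; pose proof (case_nat G u) as K; dor K; [ir; exact K|].
  dex K v; rwin K H; apply lt_S_inv in H; exact (nlt_0 _ H).
- ii u H; pose proof (case_nat G u) as K; dor K.
  + il; rw K; apply lt_0_S.
  + dex K v; rwin K H; apply lt_S_inv in H; ispec IH v; imp IH H; dor IH.
    * il; rw K; now apply lt_S_S.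
    * ir; rw K; rw IH; apply eq_refl_.
Qed.

Lemma lt_S G x y : (G ⊩ x < y) -> G ⊩ x < succ y.
Proof.
enough (H : G ⊩ all1 (fun x => x < up 1 y ⇒ x < succ (up 1 y))).
{ ispec H x; apply imp_e, H. }
iinduction (fun _ y => all1 (fun x => x < up 1 y ⇒ x < succ (up 1 y))) y.
- ii u H; exact (nlt_0 _ H).
- ii u H; pose proof (case_nat G u) as K; dor K.
  + rw K; apply lt_0_S.
  + dex K v; rwin K H; apply lt_S_inv in H; ispec IH v; imp IH H.
    rw K; now apply lt_S_S.
Qed.

Lemma lt_trans G x y z : (G ⊩ x < y) -> (G ⊩ y < z) -> G ⊩ x < z.
Proof.
intros H; apply imp_e.
iinduction (fun g z => g y < z ⇒ g x < z) z.
- ii K; exact (nlt_0 _ K).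
- ii K; apply lt_succ_cases in K; dor K; apply lt_S.
  + now imp IH K.
  + now rwin K H.
Qed.

Lemma lt_irrefl G p x : (G ⊩ x < x) -> G ⊩ p.
Proof.
intros H; apply BotE; revert H; apply imp_e.
iinduction (fun _ x => x < x ⇒ Bot) x.
- ii K; exact (nlt_0 _ K).
- ii K; apply lt_S_inv in K; now imp IH K.
Qed.

Lemma le_refl G x : G ⊩ x <= x.
Proof. apply lt_Sn. Qed.
Lemma lt_le G x y : (G ⊩ x < y) -> G ⊩ x <= y.
Proof. apply lt_S. Qed.
Lemma eq_le G x y : (G ⊩ x == y) -> G ⊩ x <= y.
Proof. intros H; rw H; apply le_refl. Qed.
Lemma lt_le_trans G x y z : (G ⊩ x < y) -> (G ⊩ y <= z) -> G ⊩ x < z.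
Proof.
intros H K; apply lt_succ_cases in K; dor K; [now apply lt_trans with y|now rwin K H].
Qed.
Lemma le_lt_trans G x y z : (G ⊩ x <= y) -> (G ⊩ y < z) -> G ⊩ x < z.
Proof.
intros H K; apply lt_succ_cases in H; dor H; [now apply lt_trans with y|now rw H].
Qed.
Lemma le_trans G x y z : (G ⊩ x <= y) -> (G ⊩ y <= z) -> G ⊩ x <= z.
Proof. intros H K; apply le_lt_trans with y; auto. Qed.
Lemma lt_succ_le G x y : (G ⊩ x < y) -> G ⊩ succ x <= y.
Proof. apply lt_S_S. Qed.
Lemma le_0 G x : G ⊩ zero <= x.
Proof. apply lt_0_S. Qed.
Lemma le_S G x : G ⊩ x <= succ x.
Proof. apply lt_le, lt_Sn. Qed.

Lemma lt_or_le G x y : G ⊩ x < y ∨ y <= x.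
Proof.
iinduction (fun g y => g x < y ∨ y <= g x) y.
- ir; apply le_0.
- dor IH; [il; now apply lt_S|].
  apply lt_succ_cases in IH; dor IH; [ir; now apply lt_S_S|].
  il; rw IH; apply lt_Sn.
Qed.

Lemma lt_trich G x y : G ⊩ x < y ∨ x == y ∨ y < x.
Proof.
pose proof (lt_or_le G x y) as H; dor H; [now il|ir].
apply lt_succ_cases in H; dor H; [now ir|il; now apply eq_sym_].
Qed.

Lemma le_antisym G x y : (G ⊩ x <= y) -> (G ⊩ y <= x) -> G ⊩ x == y.
Proof.
intros H K; apply lt_succ_cases in H; dor H; auto.
apply lt_irrefl with x; now apply lt_le_trans with y.
Qed.

Lemma lt_not_le G p x y : (G ⊩ x < y) -> (G ⊩ y <= x) -> G ⊩ p.
Proof. intros H K; apply lt_irrefl with x; now apply lt_le_trans with y. Qed.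

Lemma lt_ne G p x y : (G ⊩ x < y) -> (G ⊩ x == y) -> G ⊩ p.
Proof. intros H K; rwin K H; now apply lt_irrefl with y. Qed.

Lemma eq_dec G x y : G ⊩ x == y ∨ ¬ x == y.
Proof.
pose proof (lt_trich G x y) as H; dor H; [ir; ii K; now apply (@lt_ne _ _ x y)|].
dor H; [now il|ir; ii K; apply eq_sym_ in K; now apply (@lt_ne _ _ y x)].
Qed.

Lemma ub2 G x y : G ⊩ ex1 (fun z => up 1 x <= z ∧ up 1 y <= z).
Proof.
pose proof (lt_or_le G x y) as H; dor H.
- iex y; isplit; [now apply lt_le|apply le_refl].
- iex x; isplit; [apply le_refl|auto].
Qed.

(* [skip g p] is [p] below its first variable, the other variables being moved by [g]. *)
Definition skip (g : term L -> term L) p : form L :=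
  subst (scons (Var 0) (fun i => up 1 (g (Var i)))) p.

Lemma skip_id p : skip (fun a => a) p = p.
Proof. unfold skip; rewrite <- subst_Var; apply subst_ext; now intros [|i]. Qed.
Lemma skip_inst p u : subst (lift (scons u Var)) (skip (up 1) p) = p.
Proof.
rewrite <- (skip_id p) at 2; unfold skip; rewrite subst_comp; apply subst_ext; now intros [|i].
Qed.

#[local] Hint Rewrite skip_inst skip_id : ha.

Lemma strong_induction F G : schema F ->
  (forall G', incl G G' -> forall t,
    (forall G2, incl G' G2 -> forall u, (G2 ⊩ u < t) -> G2 ⊩ F (fun a => a) u) ->
    G' ⊩ F (fun a => a) t) ->
  forall t, G ⊩ F (fun a => a) t.
Proof.
intros E H t; set (p := F (up 1) (Var 0)).
assert (E' : forall u, subst (scons u Var) p = F (fun a => a) u) by exact E.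
assert (A : G ⊩ All (Var 0 < up 1 (succ t) ⇒ skip (fun a => a) p)).
{ iinduction (fun g n => All (Var 0 < up 1 n ⇒ skip g p)) (succ t).
  - rewrite skip_id; ii x K; exact (nlt_0 _ K).
  - rewrite skip_id in *; ii x K; apply lt_succ_cases in K; rewrite E'.
    apply (H G (incl_refl _)); intros G2 HG u Hu; wk HG.
    ispec IH u; rewrite E' in IH; eapply imp_e; [exact IH|].
    dor K; [now apply lt_trans with x|now rwin K Hu]. }
rewrite skip_id in A; ispec A t; rewrite E' in A.
eapply imp_e; [exact A|]; apply lt_Sn.
Qed.

Lemma schema_leibniz F G s t : schema F -> (G ⊩ s == t) ->
  (G ⊩ F (fun a => a) s) -> G ⊩ F (fun a => a) t.
Proof.
intros E; rewrite <- !E; now apply (@leibniz L (inst (F (up 1) (Var 0))) (F (up 1) (Var 0))).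
Qed.

Lemma skip_inst2 p u :
  subst (lift (lift (scons u Var))) (skip (fun a => up 1 (up 1 a)) p) = skip (up 1) p.
Proof. unfold skip; rewrite subst_comp; apply subst_ext; now intros [|i]. Qed.
#[local] Hint Rewrite skip_inst2 : ha.

Lemma greatest F G n q : schema F ->
  (forall G', incl G G' -> forall x, (G' ⊩ x < n) ->
     G' ⊩ F (fun a => a) x ∨ ¬ F (fun a => a) x) ->
  (forall G', incl G G' -> forall x, (G' ⊩ x < n) -> (G' ⊩ F (fun a => a) x) ->
     (forall G2, incl G' G2 -> forall y, (G2 ⊩ x < y) -> (G2 ⊩ y < n) ->
      (G2 ⊩ F (fun a => a) y) -> G2 ⊩ Bot) -> G' ⊩ q) ->
  (forall G', incl G G' -> (forall G2, incl G' G2 -> forall x, (G2 ⊩ x < n) ->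
     (G2 ⊩ F (fun a => a) x) -> G2 ⊩ Bot) -> G' ⊩ q) ->
  G ⊩ q.
Proof.
intros E D H1 H2; set (p := F (up 1) (Var 0)).
assert (E' : forall u, subst (scons u Var) p = F (fun a => a) u) by exact E.
assert (A : G ⊩ n <= n ⇒
   Ex (Var 0 < up 1 n ∧ skip (fun a => a) p ∧ All (Var 0 < up 2 n ⇒ Var 1 < Var 0 ⇒ ¬ skip (up 1) p))
   ∨ All (Var 0 < up 1 n ⇒ ¬ skip (fun a => a) p)).
{ iinduction (fun g m => m <= g n ⇒
   Ex (Var 0 < up 1 m ∧ skip g p ∧
      All (Var 0 < up 2 m ⇒ Var 1 < Var 0 ⇒ ¬ skip (fun a => up 1 (g a)) p))
   ∨ All (Var 0 < up 1 m ⇒ ¬ skip g p)) n.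
  - ii K; ir; ii x K2; exact (nlt_0 _ K2).
  - rewrite skip_id in *; ii K.
    impg IH. { now apply lt_S_inv, lt_S in K. }
    apply lt_S_inv in K.
    pose proof (D G (incl_refl _) n0 K) as C; dor C.
    + clear IH; il; iex n0; rewrite E'; isplit; [apply lt_Sn|isplit; [auto|]].
      ii y K1 K2; exact (lt_not_le _ K2 K1).
    + dor IH.
      * il; dex IH x; dand IH IH2; dand IH2 IH3.
        iex x; isplit; [now apply lt_S|isplit; [auto|]].
        ii y K1 K2; apply lt_succ_cases in K1; dor K1.
        -- ispec IH3 y; imp IH3 K1; now imp IH3 K2.
        -- rewrite E' in *; ii K3; eapply imp_e; [exact C|].
           now apply (schema_leibniz (s:=y)).
      * ir; ii x K2; apply lt_succ_cases in K2; dor K2.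
        -- ispec IH x; now imp IH K2.
        -- ii K3; rewrite E' in K3; eapply imp_e; [exact C|].
           now apply (schema_leibniz (s:=x)). }
rewrite skip_id in A; impg A; [apply le_refl|]; dor A.
- dex A x; dand A A2; dand A2 A3; rewrite E' in A2.
  apply (H1 G (incl_refl _) x); auto; intros G2 HG y K1 K2 K3; wk HG.
  ispec A3 y; imp A3 K2; imp A3 K1; rewrite E' in A3; now apply (imp_e A3).
- apply (H2 G (incl_refl _)); intros G2 HG x K1 K2; wk HG.
  ispec A x; imp A K1; rewrite E' in A; now apply (imp_e A).
Qed.

Lemma bounded_em F G n q : schema F ->
  (forall G', incl G G' -> forall x, (G' ⊩ x < n) ->
     G' ⊩ F (fun a => a) x ∨ ¬ F (fun a => a) x) ->
  (forall G', incl G G' -> forall x, (G' ⊩ x < n) -> (G' ⊩ F (fun a => a) x) -> G' ⊩ q) ->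
  (forall G', incl G G' -> (forall G2, incl G' G2 -> forall x, (G2 ⊩ x < n) ->
     (G2 ⊩ F (fun a => a) x) -> G2 ⊩ Bot) -> G' ⊩ q) ->
  G ⊩ q.
Proof.
intros E D H1 H2; apply (greatest (n:=n) E); auto.
intros G' HG x K1 K2 _; exact (H1 G' HG x K1 K2).
Qed.

(** The greatest [x] below [n] with [F] is such a place: its successor is either still below [n], or
    equal to [n]. *)
Lemma step_change F G n q : schema F ->
  (forall G', incl G G' -> forall x, G' ⊩ F (fun a => a) x ∨ ¬ F (fun a => a) x) ->
  (G ⊩ F (fun a => a) zero) -> (G ⊩ ¬ F (fun a => a) n) ->
  (forall G', incl G G' -> forall x, (G' ⊩ x < n) -> (G' ⊩ F (fun a => a) x) ->
    (G' ⊩ ¬ F (fun a => a) (succ x)) -> G' ⊩ q) -> G ⊩ q.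
Proof.
intros E D H0 Hn H; pose proof (lt_or_le G zero n) as Z; dor Z.
2:{ apply BotE, (imp_e Hn); apply (schema_leibniz (s:=zero)); auto.
    apply le_antisym; auto; apply le_0. }
apply (greatest (n:=n) E); auto.
- intros G' HG x K1 K2 K3; wk HG; apply (H G (incl_refl _) x); auto.
  ii K4; pose proof (lt_or_le G (succ x) n) as C; dor C.
  + apply (K3 _ (incl_refl _) (succ x)); auto; apply lt_Sn.
  + eapply imp_e; [exact Hn|]; apply (schema_leibniz (s:=succ x)); auto.
    apply le_antisym; auto; now apply lt_succ_le.
- intros G' HG K; wk HG; apply BotE, (K _ (incl_refl _) zero); auto.
Qed.

Lemma least F G q t : schema F ->
  (forall G', incl G G' -> forall x, G' ⊩ F (fun a => a) x ∨ ¬ F (fun a => a) x) ->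
  (G ⊩ F (fun a => a) t) ->
  (forall G', incl G G' -> forall x, (G' ⊩ x <= t) -> (G' ⊩ F (fun a => a) x) ->
     (forall G2, incl G' G2 -> forall y, (G2 ⊩ y < x) ->
     (G2 ⊩ F (fun a => a) y) -> G2 ⊩ Bot) -> G' ⊩ q) ->
  G ⊩ q.
Proof.
intros E D Ht H; set (p := F (up 1) (Var 0)).
assert (E' : forall u, subst (scons u Var) p = F (fun a => a) u) by exact E.
assert (A : G ⊩ F (fun a => a) t ⇒ Ex (Var 0 <= up 1 t ∧ skip (fun a => a) p ∧
      All (Var 0 < Var 1 ⇒ ¬ skip (up 1) p))).
{ simple refine (@strong_induction (fun g t => F g t ⇒
    Ex (Var 0 <= up 1 t ∧ skip g p ∧
      All (Var 0 < Var 1 ⇒ ¬ skip (fun a => up 1 (g a)) p))) G _ _ t).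
  - intros u; unfold inst; rewrite subst_Imp, <- E; fold p; now simp.
  - cbv beta; intros G1 HG u IH; wk HG; rewrite skip_id in *; ii K.
    apply (@bounded_em F G u _ E); auto.
    + intros G2 HG x K1 K2; wk HG; pose proof (IH _ (incl_refl _) x K1) as I.
      imp I K2; dex I y; dand I I2; dand I2 I3.
      iex y; isplit; [|now isplit].
      apply lt_le, (le_lt_trans I K1).
    + intros G2 HG N; wk HG; iex u; isplit; [apply le_refl|rewrite E'; isplit; auto].
      ii y K1; rewrite E'; ii K2; now apply (N _ (incl_refl _) y). }
imp A Ht; rewrite skip_id in A; dex A x; dand A A2; dand A2 A3; rewrite E' in A2.
apply (H G (incl_refl _) x); auto; intros G2 HG y K1 K2; wk HG.
ispec A3 y; imp A3 K1; rewrite E' in A3; now apply (imp_e A3).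
Qed.
End Arith.

Tactic Notation "sinduction" uconstr(F) constr(x) :=
  simple refine (@strong_induction _ F _ _ _ x); [schema_tac|cbv beta;
   let G := fresh "G" in let HG := fresh "HGx" in let IH := fresh "IH" in
   intros G HG ?n IH; wk HG].

Section Lists.
Variable L : signature.
Implicit Types (l : list (term L)) (t u : term L).

Lemma map_up_scons u f n l :
  map (tsubst (scons u f)) (map (up (S n)) l) = map (tsubst f) (map (up n) l).
Proof. rewrite !map_map; apply map_ext; intros; apply up_scons. Qed.
Lemma map_up_lift f n l :
  map (tsubst (lift f)) (map (up (S n)) l) = map (up 1) (map (tsubst f) (map (up n) l)).
Proof. rewrite !map_map; apply map_ext; intros; apply up_lift. Qed.
Lemma map_up_0 l : map (up 0) l = l.
Proof. rewrite <- map_id; apply map_ext, up_0. Qed.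
Lemma map_up_up n m l : map (up n) (map (up m) l) = map (up (n + m)) l.
Proof. rewrite !map_map; apply map_ext; intros; apply up_up. Qed.
Lemma map_tsubst_Var l : map (tsubst Var) l = l.
Proof. rewrite <- map_id; apply map_ext, tsubst_Var. Qed.
Lemma tsubst_nth f i l : tsubst f (nth i l zero) = nth i (map (tsubst f) l) zero.
Proof. symmetry; exact (map_nth (tsubst f) l zero i). Qed.
Lemma map_id_ l : map (fun x => x) l = l.
Proof. apply map_id. Qed.
End Lists.
#[export] Hint Rewrite map_up_scons map_up_lift map_up_0 map_up_up map_tsubst_Var
  tsubst_nth map_id_ : ha.

(** * Excluded middle *)

Section EM.
Variable L : signature.
Implicit Types (p q : form L) (G : list (form L)).

Lemma em_S2 G p : Delta0 p -> G ⊩ Ex (All p) ∨ ¬ Ex (All p).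
Proof. intros H; apply ByAx; right; constructor; now exists p. Qed.

(** A vacuous universal quantifier makes the formula Sigma2. The same device gives the Pi1 case and
    the Delta0 case, the latter without an induction on formulas. *)
Lemma em_S1 G p : Delta0 p -> G ⊩ Ex p ∨ ¬ Ex p.
Proof.
intros H; pose proof (em_S2 G (Delta0_subst H (fun i => Var (S i)))) as K.
fold (fup p) in K.
assert (E : forall u v, subst (scons u Var) (subst (lift (scons v Var)) (fup p)) = inst p v).
{ intros; unfold inst; rewrite subst_fup; exact (inst_fup _ _). }
dor K.
- il; apply (ex_e K); intros G' t HG Kt; wk HG; unfold inst in Kt.
  rewrite subst_All in Kt; apply (all_e zero) in Kt; unfold inst in Kt.
  rewrite E in Kt; now apply ExI with t.
- ir; ii H1; eapply imp_e; [exact K|].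
  apply (ex_e H1); intros G' t HG Kt; wk HG.
  apply ExI with t; unfold inst; rewrite subst_All; apply all_i; intros u.
  unfold inst; now rewrite E.
Qed.

Lemma em_P1 G p : Delta0 p -> G ⊩ All p ∨ ¬ All p.
Proof.
intros H; pose proof (em_S2 G (Delta0_subst H (lift (fun i => Var (S i))))) as K.
change (All (subst (lift (fun i => Var (S i))) p)) with (fup (All p)) in K.
dor K.
- il; apply (ex_e K); intros G' t HG Kt; wk HG; now rewrite inst_fup in Kt.
- ir; ii H1; eapply imp_e; [exact K|]; apply ExI with zero; now rewrite inst_fup.
Qed.

Lemma em_D0 G p : Delta0 p -> G ⊩ p ∨ ¬ p.
Proof.
intros H; pose proof (em_S1 G (Delta0_subst H (fun i => Var (S i)))) as K.
change (subst (fun i => Var (S i)) p) with (fup p) in K.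
dor K.
- il; apply (ex_e K); intros G' t HG Kt; wk HG; now rewrite inst_fup in Kt.
- ir; ii H1; eapply imp_e; [exact K|]; apply ExI with zero; now rewrite inst_fup.
Qed.

Lemma D0_neg p : Delta0 p -> Delta0 (¬ p).
Proof. intros; apply D0_imp; auto; apply D0_bot. Qed.

(** The existence of a counterexample is itself decidable; if there were none, deciding each
    instance of [p] would prove [All p]. *)
Lemma em_not_P1 G p : Delta0 p -> (G ⊩ ¬ All p) -> G ⊩ Ex (¬ p).
Proof.
intros H K; pose proof (em_S1 G (D0_neg H)) as C; dor C; auto.
apply BotE, (imp_e K), all_i; intros t.
pose proof (em_D0 G (Delta0_subst H (scons t Var))) as D; dor D; auto.
apply BotE, (imp_e C); apply ExI with t; exact D.
Qed.

Lemma dec_and G p q : (G ⊩ p ∨ ¬ p) -> (G ⊩ q ∨ ¬ q) -> G ⊩ (p ∧ q) ∨ ¬ (p ∧ q).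
Proof. intros H K; dor H; dor K; [il; itauto|ir; itauto..]. Qed.
Lemma dec_or G p q : (G ⊩ p ∨ ¬ p) -> (G ⊩ q ∨ ¬ q) -> G ⊩ (p ∨ q) ∨ ¬ (p ∨ q).
Proof. intros H K; dor H; dor K; [il; itauto..|ir; itauto]. Qed.
Lemma dec_neg G p : (G ⊩ p ∨ ¬ p) -> G ⊩ ¬ p ∨ ¬ ¬ p.
Proof. intros H; dor H; [ir|il]; itauto. Qed.
End EM.

(** * Finite sets coded by binary digits *)

Definition mem L (b m : term L) : form L := fn1 pr_par (fn2 pr_shift m b) == succ zero.

Section Sets.
Variable L : signature.
Implicit Types (s t u b m n : term L) (p q : form L) (G : list (form L)).
Notation isz := (@fn1 L pr_isz).
Notation par := (@fn1 L pr_par).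
Notation half := (@fn1 L pr_half).
Notation dbl := (@fn1 L pr_dbl).
Notation add := (@fn2 L pr_add).
Notation shift := (@fn2 L pr_shift).
Notation pow := (@fn2 L pr_pow).

Lemma subst_mem f b m : subst f (mem b m) = mem (tsubst f b) (tsubst f m).
Proof. reflexivity. Qed.
Lemma D0_mem b m : Delta0 (mem b m). Proof. constructor. Qed.
#[export] Instance mem_proper G : Proper (teq G ==> teq G ==> fle G) (@mem L).
Proof. apply natural2_proper; intro; apply subst_mem. Qed.

Lemma par_half_dbl G n : G ⊩ par (dbl n) == zero ∧ half (dbl n) == n.
Proof.
iinduction (fun _ n => par (dbl n) == zero ∧ half (dbl n) == n) n.
- isplit; rewrite dbl_0; [apply par_0|apply half_0].
- dand IH IH2; isplit; rewrite dbl_S.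
  + rewrite !par_S; rw IH; rewrite isz_0; apply isz_S.
  + rewrite !half_S, par_S; rw IH; rw IH2.
    now rewrite isz_0, !add_S, !add_0; apply eq_refl_.
Qed.
Lemma par_dbl G n : teq G (par (dbl n)) zero.
Proof. exact (AndE1 (par_half_dbl G n)). Qed.
Lemma half_dbl G n : teq G (half (dbl n)) n.
Proof. exact (AndE2 (par_half_dbl G n)). Qed.
Lemma par_Sdbl G n : teq G (par (succ (dbl n))) (succ zero).
Proof. rewrite par_S, par_dbl; apply isz_0. Qed.
Lemma half_Sdbl G n : teq G (half (succ (dbl n))) n.
Proof. rewrite half_S, par_dbl, half_dbl; apply add_0. Qed.

Lemma shift_half G m b : teq G (shift (succ m) b) (shift m (half b)).
Proof.
unfold teq; iinduction (fun g m => shift (succ m) (g b) == shift m (half (g b))) m.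
- now rewrite shift_S, !shift_0; apply eq_refl_.
- rewrite shift_S; rw IH; apply eq_sym_, shift_S.
Qed.

Lemma add_succ G m n : teq G (add m (succ n)) (succ (add m n)).
Proof.
unfold teq; iinduction (fun g m => add m (succ (g n)) == succ (add m (g n))) m.
- now rewrite !add_0; apply eq_refl_.
- rewrite !add_S; rw IH; apply eq_refl_.
Qed.
Lemma add_zero G m : teq G (add m zero) m.
Proof.
unfold teq; iinduction (fun _ m => add m zero == m) m.
- apply add_0.
- rewrite add_S; rw IH; apply eq_refl_.
Qed.

Lemma le_dbl G n : G ⊩ n <= dbl n.
Proof.
iinduction (fun _ n => n <= dbl n) n.
- apply le_0.
- rewrite dbl_S; apply lt_S_S, lt_S, IH.
Qed.
Lemma dbl_lt G m n : (G ⊩ m < n) -> G ⊩ succ (dbl m) < dbl n.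
Proof.
apply imp_e; iinduction (fun g n => g m < n ⇒ succ (dbl (g m)) < dbl n) n.
- ii K; exact (nlt_0 _ K).
- ii K; rewrite dbl_S; apply lt_succ_cases in K; dor K.
  + imp IH K; now apply lt_S, lt_S.
  + rw K; apply lt_Sn.
Qed.

Lemma mem_0 G b : fle G (mem b zero) (par b == succ zero).
Proof. unfold mem; now rewrite shift_0. Qed.
Lemma mem_S G b m : fle G (mem b (succ m)) (mem (half b) m).
Proof. unfold mem; now rewrite shift_half. Qed.

Variable P : list (term L) -> term L -> form L.
Hypothesis NP : forall f l t, subst f (P l t) = P (map (tsubst f) l) (tsubst f t).
#[local] Hint Rewrite NP subst_mem : ha.
#[local] Instance P_proper G l : Proper (teq G ==> fle G) (P l).
Proof.
intros s t H; apply AndI; apply imp_i; intros G' HG; apply (prv_weak HG) in H;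
  apply (@leibniz L (P l) (P (map (up 1) l) (Var 0))); auto;
  try (intros u; now simp); now apply eq_sym_.
Qed.

(** The code is [n * 2^s] plus the wanted digits. The part [n] makes it as large as desired, so that
    witnesses can be sought below the code; with [n = 0] the code is below [2^s]. *)
Lemma comprehension G l s n q :
  (forall G', incl G G' -> forall m, G' ⊩ P l m ∨ ¬ P l m) ->
  (forall G', incl G G' -> forall b, (G' ⊩ n <= b) -> (G' ⊩ b < pow s n) ->
    (forall G2, incl G' G2 -> forall m, (G2 ⊩ m < s) -> (G2 ⊩ mem b m) -> G2 ⊩ P l m) ->
    (forall G2, incl G' G2 -> forall m, (G2 ⊩ m < s) -> (G2 ⊩ P l m) -> G2 ⊩ mem b m) ->
    G' ⊩ q) -> G ⊩ q.
Proof.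
intros D H.
(* Doubling a code moves its digits up by one and frees the lowest one, so the induction on the
   number of digits is made for [P] shifted by an arbitrary [j]. *)
assert (A : G ⊩ all1 (fun j => ex1 (fun b => up 2 n <= b ∧ b < pow (up 2 s) (up 2 n) ∧
  all1 (fun m => m < up 3 s ⇒
    (mem (up 1 b) m ⇔ P (map (up 3) (map (fun a => a) l)) (add m (up 2 j))))))).
{ iinduction (fun g s => all1 (fun j => ex1 (fun b => up 2 (g n) <= b ∧
    b < pow (up 2 s) (up 2 (g n)) ∧
  all1 (fun m => m < up 3 s ⇒
    (mem (up 1 b) m ⇔ P (map (up 3) (map g l)) (add m (up 2 j))))))) s.
  - ii j; iex n; isplit; [apply le_refl|isplit].
    + rewrite pow_0; apply lt_Sn.
    + ii m K; exact (nlt_0 _ K).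
  - ii j; ispec IH (succ j); dex IH b; dand IH IH2; dand IH2 IH3.
    assert (S : forall G1, incl G G1 -> forall b', (G1 ⊩ half b' == b) ->
      G1 ⊩ all1 (fun m => m < up 1 n0 ⇒
        (mem (up 1 b') (succ m) ⇔ P (map (up 1) l) (add (succ m) (up 1 j))))).
    { intros G1 HG b' E; wk HG; ii m K; ispec IH3 m; imp IH3 K.
      assert (E2 : teq G (add m (succ j)) (add (succ m) j)).
      { rewrite add_S; apply add_succ. }
      rewrite E2 in IH3; dand IH3 IH4.
      isplit; ii K2.
      - apply (imp_e IH3); revert K2; rewrite mem_S; now rw E.
      - rewrite mem_S; rw E; now imp IH4 K2. }
    assert (Z : teq G (add zero j) j) by apply add_0.
    assert (main : forall G1, incl G G1 -> forall b', (G1 ⊩ b <= b') ->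
      (G1 ⊩ b' < dbl (pow n0 n)) ->
      (G1 ⊩ half b' == b) -> (G1 ⊩ mem b' zero ⇔ P l j) ->
      G1 ⊩ ex1 (fun b => up 1 n <= b ∧ b < pow (up 1 (succ n0)) (up 1 n) ∧
       all1 (fun m => m < up 2 (succ n0) ⇒
        (mem (up 1 b) m ⇔ P (map (up 2) l) (add m (up 2 j)))))).
    { intros G1 HG b' B1 B2 B3 B4; wk HG; iex b'; isplit; [now apply le_trans with b|isplit].
      - now rewrite pow_S.
      - ii m K; pose proof (case_nat G m) as C; dor C.
        + unfold Iff in B4; dand B4 B5; isplit; ii K2.
          * rw C; rewrite Z; apply (imp_e B4); revert K2; now rw C.
          * rw C; apply (imp_e B5); revert K2; rw C; now rewrite Z.
        + dex C m'; rwin C K; apply lt_S_inv in K.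
          pose proof (S G (incl_refl _) b' B3) as S'; ispec S' m'; imp S' K.
          dand S' S2; isplit; ii K2.
          * rw C; apply (imp_e S'); revert K2; now rw C.
          * rw C; apply (imp_e S2); revert K2; now rw C. }
    simp in main.
    pose proof (D G (incl_refl _) j) as C; dor C.
    + apply (main G (incl_refl _) (succ (dbl b))).
      * apply lt_S, le_dbl.
      * now apply dbl_lt.
      * apply half_Sdbl.
      * isplit; ii K; auto; rewrite mem_0; apply par_Sdbl.
    + apply (main G (incl_refl _) (dbl b)).
      * apply le_dbl.
      * now apply lt_trans with (succ (dbl b)); [apply lt_Sn|apply dbl_lt].
      * apply half_dbl.
      * isplit; ii K; [|now apply BotE, (imp_e C)].
        revert K; rewrite mem_0, par_dbl; intros K; apply BotE.
        apply eq_sym_ in K; exact (succ_ne K). }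
ispec A (@zero L); dex A b; dand A A2; dand A2 A3.
apply (H G (incl_refl _) b); auto; intros G2 HG m K1 K2; wk HG;
  ispec A3 m; imp A3 K1; dand A3 A4; rewrite add_zero in *.
- now imp A3 K2.
- now imp A4 K2.
Qed.
End Sets.

#[export] Hint Rewrite subst_mem : ha.

Ltac d0 := unfold ball, bex, Neg, Iff, lt, mem;
  repeat (first [apply D0_bot|apply D0_eq|apply D0_and|apply D0_or|apply D0_all|apply D0_ex|apply D0_imp]).
Ltac substtac := intros; simp; reflexivity.

(** * Paths and approximations of the tree *)

Section Paths.
Variable L : signature.
Variable c : fsym L 3.
Implicit Types (s t u a b A j x y z w : term L) (p q r : form L) (G : list (form L)).
Notation col := (color c).

(* [A] codes, up to [j], the nodes of the set coded by [b] that [x] passes through. *)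
Definition path a b A j x : form L :=
  ball j (fun z => mem (up 1 A) z ⇔ (mem (up 1 b) z ∧
    ball z (fun w => mem (up 2 A) w ⇒ col (up 2 a) w (up 1 z) == col (up 2 a) w (up 2 x)))).

(** The path of [y] passes through the node [x]. This relation is recursive in [x], and [thr_col]
    and [thr_i] recover the recursion; the code [A] of the path of [x], bounded by [2^x], replaces
    it by a Delta0 formula. *)
Definition thr a b x y : form L :=
  x < y ∧ mem b x ∧ bex (fn2 pr_pow x zero) (fun A =>
    path (up 1 a) (up 1 b) A (up 1 x) (up 1 x) ∧
    ball (up 1 x) (fun w => mem (up 1 A) w ⇒ col (up 2 a) w (up 2 x) == col (up 2 a) w (up 2 y))).

Lemma subst_path f a b A j x : subst f (path a b A j x) =
  path (tsubst f a) (tsubst f b) (tsubst f A) (tsubst f j) (tsubst f x).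
Proof. unfold path; substtac. Qed.
Hint Rewrite subst_path : ha.
Lemma subst_thr f a b x y : subst f (thr a b x y) =
  thr (tsubst f a) (tsubst f b) (tsubst f x) (tsubst f y).
Proof. unfold thr; substtac. Qed.
Hint Rewrite subst_thr : ha.
#[export] Instance thr_proper G : Proper (teq G ==> teq G ==> teq G ==> teq G ==> fle G) thr.
Proof. apply natural4_proper; intro; apply subst_thr. Qed.

Lemma D0_thr a b x y : Delta0 (thr a b x y).
Proof. unfold thr, path; d0. Qed.
Lemma dec_thr G a b x y : G ⊩ thr a b x y ∨ ¬ thr a b x y.
Proof. apply em_D0, D0_thr. Qed.
Lemma dec_mem G b x : G ⊩ mem b x ∨ ¬ mem b x.
Proof. apply em_D0, D0_mem. Qed.

Lemma path_mem G a b A j x z : (G ⊩ path a b A j x) -> (G ⊩ z < j) -> (G ⊩ mem A z) ->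
  G ⊩ mem b z.
Proof.
intros H K1 K2; ispec H z; imp H K1; dand H H2; imp H K2; exact (AndE1 H).
Qed.
Lemma path_col G a b A j x z w : (G ⊩ path a b A j x) -> (G ⊩ z < j) -> (G ⊩ mem A z) ->
  (G ⊩ w < z) -> (G ⊩ mem A w) -> G ⊩ col a w z == col a w x.
Proof.
intros H K1 K2 K3 K4; ispec H z; imp H K1; dand H H2; imp H K2; dand H H3.
ispec H3 w; imp H3 K3; now imp H3 K4.
Qed.
Lemma path_in G a b A j x z : (G ⊩ path a b A j x) -> (G ⊩ z < j) -> (G ⊩ mem b z) ->
  (forall G', incl G G' -> forall w, (G' ⊩ w < z) -> (G' ⊩ mem A w) ->
    G' ⊩ col a w z == col a w x) -> G ⊩ mem A z.
Proof.
intros H K1 K2 K3; ispec H z; imp H K1; dand H H2; apply (imp_e H2).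
isplit; auto; ii w K4 K5; now apply (K3 _ (incl_refl _)).
Qed.
Lemma path_i G a b A j x :
  (forall G', incl G G' -> forall z, (G' ⊩ z < j) -> (G' ⊩ mem A z) -> G' ⊩ mem b z) ->
  (forall G', incl G G' -> forall z w, (G' ⊩ z < j) -> (G' ⊩ mem A z) -> (G' ⊩ w < z) ->
     (G' ⊩ mem A w) -> G' ⊩ col a w z == col a w x) ->
  (forall G', incl G G' -> forall z, (G' ⊩ z < j) -> (G' ⊩ mem b z) ->
    (forall G2, incl G' G2 -> forall w, (G2 ⊩ w < z) -> (G2 ⊩ mem A w) ->
      G2 ⊩ col a w z == col a w x) -> G' ⊩ mem A z) ->
  G ⊩ path a b A j x.
Proof.
intros H1 H2 H3; unfold path; ii z K; isplit.
- ii K2; isplit; [now apply (H1 _ (incl_refl _))|].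
  ii w K3 K4; now apply (H2 _ (incl_refl _)).
- ii K2; dand K2 K3; apply (H3 _ (incl_refl _)); auto.
  intros G2 HG w K4 K5; wk HG; ispec K3 w; imp K3 K4; now imp K3 K5.
Qed.

(** By strong induction, since membership of [z] in a path depends only on the part of the path
    below [z]. *)
Lemma path_agree G a b A B j x z : (G ⊩ path a b A j x) -> (G ⊩ path a b B j x) ->
  (G ⊩ z < j) -> (G ⊩ mem A z) -> G ⊩ mem B z.
Proof.
intros HA HB Hz.
enough (H : G ⊩ z < j ⇒ (mem A z ⇔ mem B z)).
{ imp H Hz; apply (imp_e (AndE1 H)). }
sinduction (fun g z => z < g j ⇒ (mem (g A) z ⇔ mem (g B) z)) z.
rename n into u; ii K; isplit; ii K2.
- apply (path_in HB); auto; [now apply (path_mem HA)|].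
  intros G2 HG w K3 K4; wk HG; apply (path_col HA (z:=u)); auto.
  pose proof (IH _ (incl_refl _) w K3) as I; impg I; [now apply lt_trans with u|].
  exact (imp_e (AndE2 I) K4).
- apply (path_in HA); auto; [now apply (path_mem HB)|].
  intros G2 HG w K3 K4; wk HG; apply (path_col HB (z:=u)); auto.
  pose proof (IH _ (incl_refl _) w K3) as I; impg I; [now apply lt_trans with u|].
  exact (imp_e (AndE1 I) K4).
Qed.

Lemma path_le G a b A j i x : (G ⊩ path a b A j x) -> (G ⊩ i <= j) -> G ⊩ path a b A i x.
Proof.
intros H K; apply path_i; intros G' HG z; wk HG.
- intros K1; apply (path_mem H); now apply lt_le_trans with i.
- intros w K1 K2 K3; apply (path_col H); auto; now apply lt_le_trans with i.
- intros K1 K2 K3; apply (path_in H); auto; now apply lt_le_trans with i.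
Qed.

Lemma path_change G a b A j x y : (G ⊩ path a b A j x) ->
  (forall G', incl G G' -> forall w, (G' ⊩ w < j) -> (G' ⊩ mem A w) ->
     G' ⊩ col a w x == col a w y) -> G ⊩ path a b A j y.
Proof.
intros H K; apply path_i; intros G' HG z; wk HG.
- intros K1; now apply (path_mem H).
- intros w K1 K2 K3 K4; apply eq_trans_ with (col a w x); [now apply (path_col H)|].
  apply (K _ (incl_refl _)); auto; now apply lt_trans with z.
- intros K1 K2 K3; apply (path_in H); auto; intros G2 HG w K4 K5; wk HG.
  apply eq_trans_ with (col a w y); [now apply (K3 _ (incl_refl _))|].
  apply eq_sym_, (K _ (incl_refl _)); auto; now apply lt_trans with z.
Qed.

Lemma path_node G a b A j x z : (G ⊩ path a b A j x) -> (G ⊩ z < j) -> (G ⊩ mem A z) ->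
  G ⊩ path a b A z z.
Proof.
intros H K1 K2; apply path_change with x.
- apply (path_le H); now apply lt_le.
- intros G' HG w K3 K4; wk HG; now apply eq_sym_, (path_col H).
Qed.

Lemma path_ex G a b j x q :
  (forall G', incl G G' -> forall A, (G' ⊩ A < fn2 pr_pow j zero) -> (G' ⊩ path a b A j x)
    -> G' ⊩ q) -> G ⊩ q.
Proof.
intros H.
assert (E : G ⊩ ex1 (fun A => A < fn2 pr_pow (up 1 j) zero ∧
  path (up 1 a) (up 1 b) A (up 1 j) (up 1 x))).
{ iinduction (fun g j => ex1 (fun A => A < fn2 pr_pow (up 1 j) zero ∧
    path (up 1 (g a)) (up 1 (g b)) A (up 1 j) (up 1 (g x)))) j.
  - iex (@zero L); isplit; [rewrite pow_0; apply lt_Sn|].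
    apply path_i; intros G' HG z; [intros K|intros w K|intros K]; intros;
      exact (nlt_0 _ K).
  - dex IH A; dand IH IH2.
    (* The old path below [n], extended by [n] itself if [n] is in [b] and has the same colors as
       [x] along the old path. *)
    pose (P := fun l m => m < nth 0 l zero ∧ mem (nth 1 l zero) m ∨
      (m == nth 0 l zero ∧ mem (nth 2 l zero) m ∧
       ball m (fun w => mem (up 1 (nth 1 l zero)) w ⇒
        col (up 1 (nth 3 l zero)) w (up 1 m) == col (up 1 (nth 3 l zero)) w (up 1 (nth 4 l zero))))).
    apply (@comprehension L P) with (l := [n; A; b; a; x]) (s := succ n) (n := zero).
    + intros f l t; unfold P; simp; reflexivity.
    + intros G' HG m; wk HG; apply em_D0; unfold P; d0.
    + intros G' HG B K1 K2 K3 K4; wk HG; cbn [P nth] in *.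
      iex B; isplit; [exact K2|].
      assert (old : forall G', incl G G' -> forall z, (G' ⊩ z < n) -> (G' ⊩ mem B z) ->
        G' ⊩ mem A z).
      { intros G' HG z Hz HB; wk HG.
        pose proof (K3 _ (incl_refl _) z (lt_S Hz) HB) as I.
        dor I; dand I I2; auto; exact (lt_ne _ Hz I). }
      assert (new : forall G', incl G G' -> forall z, (G' ⊩ z < n) -> (G' ⊩ mem A z) ->
        G' ⊩ mem B z).
      { intros G' HG z Hz HB; wk HG.
        apply (K4 _ (incl_refl _) z (lt_S Hz)); il; now isplit. }
      apply path_i; intros G' HG z; wk HG.
      * intros K5 K6; apply lt_succ_cases in K5; dor K5.
        -- apply (path_mem IH2 K5); now apply (old _ (incl_refl _)).
        -- pose proof (K3 _ (incl_refl _) z (eq_le K5) K6) as I.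
           dor I; dand I I2; [apply (lt_ne _ I K5)|exact (AndE1 I2)].
      * intros w K5 K6 K7 K8; apply lt_succ_cases in K5; dor K5.
        -- apply (path_col IH2 K5); auto; apply (old _ (incl_refl _)); auto.
           now apply lt_trans with z.
        -- pose proof (K3 _ (incl_refl _) z (eq_le K5) K6) as I.
           dor I; dand I I2; [apply (lt_ne _ I K5)|]; dand I2 I3.
           ispec I3 w; imp I3 K7; apply (imp_e I3); apply (old _ (incl_refl _)); auto.
           now rwin K5 K7.
      * intros K5 K6 K7; pose proof K5 as K8; apply lt_succ_cases in K8; dor K8.
        -- apply (new _ (incl_refl _)); auto; apply (path_in IH2); auto.
           intros G2 HG w K9 K10; wk HG; apply (K7 _ (incl_refl _)); auto.
           apply (new _ (incl_refl _)); auto; now apply lt_trans with z.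
        -- apply (K4 _ (incl_refl _)); auto; ir; isplit; auto; isplit; auto.
           ii w K9 K10; apply (K7 _ (incl_refl _)); auto; apply (new _ (incl_refl _)); auto.
           now rwin K8 K9. }
dex E A; dand E E2; now apply (H _ (incl_refl _) A).
Qed.

Lemma path_thr G a b A j x z : (G ⊩ path a b A j x) -> (G ⊩ j <= x) -> (G ⊩ z < j) ->
  (G ⊩ mem A z) -> G ⊩ thr a b z x.
Proof.
intros H K K1 K2; apply path_ex with (a:=a) (b:=b) (j:=z) (x:=z); intros G' HG B K3 K4; wk HG.
isplit; [now apply lt_le_trans with j|isplit; [now apply (path_mem H)|]].
iex B; isplit; auto; isplit; auto; ii w K5 K6.
apply (path_col H K1); auto.
exact (path_agree K4 (path_node H K1 K2) K5 K6).
Qed.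

Lemma thr_path G a b A j x z : (G ⊩ path a b A j x) -> (G ⊩ z < j) ->
  (G ⊩ thr a b z x) -> G ⊩ mem A z.
Proof.
intros H K1 K2; dand K2 K3; dand K3 K4; dex K4 B; dand K4 K5; dand K5 K6.
assert (K7 : G ⊩ path a b B z x).
{ apply (path_change K5); intros G' HG w K7 K8; wk HG; ispec K6 w; imp K6 K7; now imp K6 K8. }
apply (path_in H K1 K3); intros G' HG w K8 K9; wk HG.
ispec K6 w; imp K6 K8; apply (imp_e K6).
exact (path_agree (path_le H (lt_le K1)) K7 K8 K9).
Qed.

Lemma thr_lt G a b x y : (G ⊩ thr a b x y) -> G ⊩ x < y.
Proof. apply AndE1. Qed.
Lemma thr_mem G a b x y : (G ⊩ thr a b x y) -> G ⊩ mem b x.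
Proof. intros H; exact (AndE1 (AndE2 H)). Qed.
Lemma thr_col G a b x y w : (G ⊩ thr a b x y) -> (G ⊩ thr a b w x) ->
  G ⊩ col a w x == col a w y.
Proof.
intros H K; dand H H2; dand H2 H3; dex H3 B; dand H3 H4; dand H4 H5.
ispec H5 w; impg H5; [exact (thr_lt K)|]; apply (imp_e H5).
exact (thr_path H4 (thr_lt K) K).
Qed.
Lemma thr_i G a b x y : (G ⊩ x < y) -> (G ⊩ mem b x) ->
  (forall G', incl G G' -> forall w, (G' ⊩ thr a b w x) -> G' ⊩ col a w x == col a w y) ->
  G ⊩ thr a b x y.
Proof.
intros H1 H2 H3; apply path_ex with (a:=a) (b:=b) (j:=x) (x:=x); intros G' HG A K1 K2; wk HG.
isplit; auto; isplit; auto; iex A; isplit; auto; isplit; auto; ii w K3 K4.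
apply (H3 _ (incl_refl _)); apply (path_thr K2 (le_refl _ _) K3 K4).
Qed.
End Paths.

#[export] Hint Rewrite subst_thr : ha.

(** * Finite stages of the tree *)

Section Stages.
Variable L : signature.
Variable c : fsym L 3.
Implicit Types (s t u a b A j x y z w v m n q e : term L) (p r : form L) (G : list (form L)).
Notation col := (color c).
Notation thr := (thr c).

(* The threshold of [y] at [v] is at least [q]. *)
Definition good a b s v q y : form L :=
  q == zero ∨ ball s (fun z => up 1 v <= z ⇒ thr (up 1 a) (up 1 b) z (up 1 y) ⇒
    bex (up 1 v) (fun x => up 2 q <= x ∧ thr (up 2 a) (up 2 b) x (up 2 y) ∧
      col (up 2 a) x (up 2 y) == col (up 2 a) (up 1 z) (up 2 y))).

(** A single [q] separates the two thresholds: that of [y] is at least [q], that of [t] at most [q],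
    and if [t] reaches [q] the color decides. So no threshold has to be computed. As [y] and [t]
    both pass through [v], their thresholds lie below [v], and the bound on [q] loses nothing. *)
Definition better a b s y t : form L :=
  bex s (fun v => thr (up 1 a) (up 1 b) v (up 1 y) ∧ thr (up 1 a) (up 1 b) v (up 1 t) ∧
    ¬ col (up 1 a) v (up 1 y) == col (up 1 a) v (up 1 t) ∧
    bex (up 1 (succ s)) (fun q =>
      good (up 2 a) (up 2 b) (up 2 s) (up 1 v) q (up 2 y) ∧
      ¬ good (up 2 a) (up 2 b) (up 2 s) (up 1 v) (succ q) (up 2 t) ∧
      (good (up 2 a) (up 2 b) (up 2 s) (up 1 v) q (up 2 t) ⇒
        col (up 2 a) (up 1 v) (up 2 y) < col (up 2 a) (up 1 v) (up 2 t)))).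

(* The digits of [b] below [s] are those of the tree, and the witnesses for the
   missing nodes are below [b]. *)
Definition correct_at a b s y : form L :=
  ball s (fun m => (mem (up 1 b) m ⇒ m < up 1 y ⇒ ¬ better (up 1 a) (up 1 b) m (up 1 y) m) ∧
    (¬ mem (up 1 b) m ⇒ bex (up 1 b) (fun y =>
        up 1 m < y ∧ better (up 2 a) (up 2 b) (up 1 m) y (up 1 m)))).
Definition correct a b s : form L := all1 (fun y => correct_at (up 1 a) (up 1 b) (up 1 s) y).

Lemma subst_good f a b s v q y : subst f (good a b s v q y) =
  good (tsubst f a) (tsubst f b) (tsubst f s) (tsubst f v) (tsubst f q) (tsubst f y).
Proof. unfold good; substtac. Qed.
Hint Rewrite subst_good : ha.
Lemma subst_better f a b s y t : subst f (better a b s y t) =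
  better (tsubst f a) (tsubst f b) (tsubst f s) (tsubst f y) (tsubst f t).
Proof. unfold better; substtac. Qed.
Hint Rewrite subst_better : ha.
Lemma subst_correct_at f a b s y : subst f (correct_at a b s y) =
  correct_at (tsubst f a) (tsubst f b) (tsubst f s) (tsubst f y).
Proof. unfold correct_at; substtac. Qed.
Hint Rewrite subst_correct_at : ha.
Lemma subst_correct f a b s : subst f (correct a b s) =
  correct (tsubst f a) (tsubst f b) (tsubst f s).
Proof. unfold correct; substtac. Qed.
Hint Rewrite subst_correct : ha.

#[export] Instance better_proper G :
  Proper (teq G ==> teq G ==> teq G ==> teq G ==> teq G ==> fle G) better.
Proof. apply natural5_proper; intro; apply subst_better. Qed.

Ltac d0_thr := unfold ball, bex, Neg, Iff, lt, mem;
  repeat (first [apply D0_bot|apply D0_eq|apply D0_thr|apply D0_and|apply D0_or|apply D0_all|apply D0_ex|apply D0_imp]).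
Lemma D0_good a b s v q y : Delta0 (good a b s v q y).
Proof. unfold good; d0_thr. Qed.
Lemma D0_better a b s y t : Delta0 (better a b s y t).
Proof. unfold better, good; d0_thr. Qed.
Lemma D0_correct_at a b s y : Delta0 (correct_at a b s y).
Proof. unfold correct_at, better, good; d0_thr. Qed.
Lemma dec_good G a b s v q y : G ⊩ good a b s v q y ∨ ¬ good a b s v q y.
Proof. apply em_D0, D0_good. Qed.

Definition agree b b' s : form L := ball s (fun z => mem (up 1 b) z ⇔ mem (up 1 b') z).
Lemma agree_1 G b b' s z : (G ⊩ agree b b' s) -> (G ⊩ z < s) -> (G ⊩ mem b z) -> G ⊩ mem b' z.
Proof. intros H K; ispec H z; imp H K; apply (imp_e (AndE1 H)). Qed.
Lemma agree_sym G b b' s : (G ⊩ agree b b' s) -> G ⊩ agree b' b s.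
Proof. intros H; unfold agree; ii z K; ispec H z; imp H K; itauto. Qed.
Lemma agree_le G b b' s s' : (G ⊩ agree b b' s) -> (G ⊩ s' <= s) -> G ⊩ agree b b' s'.
Proof.
intros H H2; unfold agree; ii z K; ispec H z; apply (imp_e H); now apply lt_le_trans with s'.
Qed.

Lemma thr_agree G a b b' s x y : (G ⊩ agree b b' s) -> (G ⊩ x < s) -> (G ⊩ thr a b x y) ->
  G ⊩ thr a b' x y.
Proof.
intros H K.
enough (E : G ⊩ x < s ⇒ all1 (fun y => thr (up 1 a) (up 1 b) (up 1 x) y ⇔
   thr (up 1 a) (up 1 b') (up 1 x) y)).
{ imp E K; ispec E y; apply (imp_e (AndE1 E)). }
sinduction (fun g x => x < g s ⇒ all1 (fun y => thr (up 1 (g a)) (up 1 (g b)) (up 1 x) y ⇔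
   thr (up 1 (g a)) (up 1 (g b')) (up 1 x) y)) x.
ii K1 u; isplit; ii K2; apply thr_i;
  try exact (thr_lt K2); try (apply (agree_1 H K1), (thr_mem K2));
  try (apply (agree_1 (agree_sym H) K1), (thr_mem K2));
  intros G2 HG w K3; wk HG; apply (thr_col K2);
  pose proof (IH _ (incl_refl _) w (thr_lt K3)) as I;
  (impg I; [exact (lt_trans (thr_lt K3) K1)|]); ispec I n.
- exact (imp_e (AndE2 I) K3).
- exact (imp_e (AndE1 I) K3).
Qed.

Lemma good_agree G a b b' s v q y : (G ⊩ agree b b' s) -> (G ⊩ v <= s) ->
  (G ⊩ good a b s v q y) -> G ⊩ good a b' s v q y.
Proof.
intros H Hv K; dor K; [now il|ir; ii z K1 K2 K3].
ispec K z; imp K K1; imp K K2; impg K; [now apply (thr_agree (agree_sym H))|].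
dex K x; dand K K4; dand K4 K5; dand K5 K6.
iex x; isplit; auto; isplit; auto; isplit; auto; apply (thr_agree H); auto.
now apply lt_le_trans with v.
Qed.

Lemma better_agree G a b b' s y t : (G ⊩ agree b b' s) -> (G ⊩ better a b s y t) ->
  G ⊩ better a b' s y t.
Proof.
intros H K; dex K v; dand K K1; dand K1 K2; dand K2 K3; dand K3 K4; dex K4 q.
dand K4 K5; dand K5 K6; dand K6 K7.
iex v; isplit; auto; isplit; [now apply (thr_agree H)|isplit; [now apply (thr_agree H)|]].
isplit; auto; iex q; isplit; auto; isplit; [apply (good_agree H); auto; now apply lt_le|].
isplit.
- ii E; apply (imp_e K6); apply (good_agree (agree_sym H)); auto; now apply lt_le.
- ii E; apply (imp_e K7); apply (good_agree (agree_sym H)); auto; now apply lt_le.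
Qed.

Lemma correct_e G a b s y : (G ⊩ correct a b s) -> G ⊩ correct_at a b s y.
Proof. intros H; unfold correct in H; ispec H y; exact H. Qed.
Lemma correct_all G a b s :
  (forall G', incl G G' -> forall y, G' ⊩ correct_at a b s y) -> G ⊩ correct a b s.
Proof. intros H; unfold correct; ii y; now apply (H _ (incl_refl _)). Qed.
Lemma correct_pos G a b s m y : (G ⊩ correct a b s) -> (G ⊩ m < s) -> (G ⊩ mem b m) ->
  (G ⊩ m < y) -> (G ⊩ better a b m y m) -> G ⊩ Bot.
Proof.
intros H K1 K2 K3; apply imp_e; unfold correct in H; ispec H y; ispec H m; imp H K1.
dand H H2; imp H K2; now imp H K3.
Qed.
Lemma correct_neg G a b s m : (G ⊩ correct a b s) -> (G ⊩ m < s) -> (G ⊩ ¬ mem b m) ->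
  G ⊩ bex b (fun y => up 1 m < y ∧ better (up 1 a) (up 1 b) (up 1 m) y (up 1 m)).
Proof.
intros H K1 K2; unfold correct in H; ispec H (@zero L); ispec H m; imp H K1.
dand H H2; imp H2 K2; simp; exact H2.
Qed.
Lemma correct_i G a b s :
  (forall G', incl G G' -> forall m y, (G' ⊩ m < s) -> (G' ⊩ mem b m) -> (G' ⊩ m < y) ->
    (G' ⊩ better a b m y m) -> G' ⊩ Bot) ->
  (forall G', incl G G' -> forall m, (G' ⊩ m < s) -> (G' ⊩ ¬ mem b m) ->
    G' ⊩ bex b (fun y => up 1 m < y ∧ better (up 1 a) (up 1 b) (up 1 m) y (up 1 m))) ->
  G ⊩ correct a b s.
Proof.
intros H1 H2; unfold correct; ii y; unfold correct_at; ii m K; isplit.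
- ii K1 K2 K3; now apply (H1 _ (incl_refl _) m y).
- ii K1; pose proof (H2 _ (incl_refl _) m K K1) as H; simp in H; exact H.
Qed.

Lemma correct_le G a b s s' : (G ⊩ correct a b s) -> (G ⊩ s' <= s) -> G ⊩ correct a b s'.
Proof.
intros H K; apply correct_i; intros G' HG m; wk HG.
- intros y K1 K2 K3 K4; apply (correct_pos H (m:=m) (y:=y)); auto; now apply lt_le_trans with s'.
- intros K1 K2; apply (correct_neg H); auto; now apply lt_le_trans with s'.
Qed.

(** By strong induction, since [better] at stage [m] reads only the digits below [m]. The codes
    themselves may differ from [s] on. *)
Lemma correct_agree G a b b' s : (G ⊩ correct a b s) -> (G ⊩ correct a b' s) ->
  G ⊩ agree b b' s.
Proof.
intros H H'; unfold agree; ii z Hz.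
enough (E : G ⊩ z < s ⇒ (mem b z ⇔ mem b' z)) by exact (imp_e E Hz).
clear Hz; sinduction (fun g z => z < g s ⇒ (mem (g b) z ⇔ mem (g b') z)) z.
ii K.
assert (A : G ⊩ agree b b' n).
{ unfold agree; ii w K1; pose proof (IH _ (incl_refl _) w K1) as I; apply (imp_e I).
  now apply lt_trans with n. }
clear IH; isplit; ii K2.
- pose proof (dec_mem G b' n) as D; dor D; auto; apply BotE.
  pose proof (correct_neg H' K D) as E; dex E y; dand E E2; dand E2 E3.
  apply (correct_pos H K K2 E2); now apply (better_agree (agree_sym A)).
- pose proof (dec_mem G b n) as D; dor D; auto; apply BotE.
  pose proof (correct_neg H K D) as E; dex E y; dand E E2; dand E2 E3.
  apply (correct_pos H' K K2 E2); now apply (better_agree A).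
Qed.

(** Each further digit is settled by one Pi1 decision, whether nothing beats [n], and the new code
    is built by [comprehension]. *)
Lemma correct_ex G a s r :
  (forall G', incl G G' -> forall b, (G' ⊩ correct a b s) -> G' ⊩ r) -> G ⊩ r.
Proof.
intros H.
enough (E : G ⊩ ex1 (fun b => correct (up 1 a) b (up 1 s))).
{ dex E b; exact (H _ (incl_refl _) b E). }
iinduction (fun g s => ex1 (fun b => correct (up 1 (g a)) b (up 1 s))) s.
- iex (@zero L); apply correct_i; intros G' HG m; [intros y|]; intros; eapply nlt_0; eauto.
- dex IH b.

  assert (D0 : Delta0 (up 1 n < Var 0 ⇒
    ¬ better (up 1 a) (up 1 b) (up 1 n) (Var 0) (up 1 n))).
  { apply D0_imp; [d0|apply D0_neg, D0_better]. }
  pose (P := fun l m => m < nth 0 l zero ∧ mem (nth 1 l zero) m ∨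
    (m == nth 0 l zero ∧ nth 2 l zero == zero)).
  assert (PN : forall f l t, subst f (P l t) = P (map (tsubst f) l) (tsubst f t)).
  { intros f l t; unfold P; simp; reflexivity. }
  (* [d] is 0 when [n] is to be a node, and [y] bounds the witness otherwise *)
  assert (main : forall G', incl G G' -> forall d y,
    (forall G2, incl G' G2 -> forall z, (G2 ⊩ d == zero) -> (G2 ⊩ n < z) ->
       (G2 ⊩ better a b n z n) -> G2 ⊩ Bot) ->
    (forall G2, incl G' G2 -> (G2 ⊩ ¬ d == zero) -> (G2 ⊩ n < y ∧ better a b n y n)) ->
    G' ⊩ ex1 (fun b => correct (up 1 a) b (up 1 (succ n)))).
  { intros G' HG d y H1 H2; wk HG.
    (* The new code is at least [N], so the old witnesses and the new one stay below it. *)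
    pose proof (ub2 G b (succ y)) as U; dex U N; dand U U2.
    apply (@comprehension L P PN) with (l := [n; b; d]) (s := succ n) (n := N).
    - intros G' HG m; wk HG; apply em_D0; unfold P; d0.
    - intros G' HG B K1 _ K3 K4; wk HG; cbn [P nth] in *; iex B.
      assert (A : G ⊩ agree b B n).
      { unfold agree; ii z K; isplit; ii K2.
        - apply (K4 _ (incl_refl _) z (lt_S K)); il; now isplit.
        - pose proof (K3 _ (incl_refl _) z (lt_S K) K2) as I; dor I; dand I I2; auto.
          exact (lt_ne _ K I). }
      apply correct_i; intros G' HG m; wk HG.
      + intros z K5 K6 K7 K8; apply lt_succ_cases in K5; dor K5.
        * apply (correct_pos IH K5 (y:=z)); auto.
          -- apply (agree_1 (agree_sym A)); auto.
          -- apply (better_agree (agree_sym (agree_le A (lt_le K5)))); auto.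
        * pose proof (K3 _ (incl_refl _) m (eq_le K5) K6) as I; dor I; dand I I2;
            [exact (lt_ne _ I K5)|].
          rwin K5 K8; rwin K5 K7; apply (H1 _ (incl_refl _) z I2 K7).
          now apply (better_agree (agree_sym A)).
      + intros K5 K6; pose proof K5 as K7; apply lt_succ_cases in K7; dor K7.
        * assert (K8 : G ⊩ ¬ mem b m).
          { ii K8; apply (imp_e K6); now apply (agree_1 A). }
          pose proof (correct_neg IH K7 K8) as I; dex I z; dand I I2; dand I2 I3.
          iex z; isplit; [|isplit; auto].
          -- apply lt_le_trans with b; auto; now apply le_trans with N.
          -- apply (better_agree (agree_le A (lt_le K7))); auto.
        * assert (K8 : G ⊩ ¬ d == zero).
          { ii K8; apply (imp_e K6); apply (K4 _ (incl_refl _) m K5); ir; now isplit. }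
          pose proof (H2 _ (incl_refl _) K8) as I; dand I I2.
          iex y; isplit; [|isplit].
          -- now apply lt_le_trans with N; [apply lt_S_inv|].
          -- now rw K7.
          -- rw K7; now apply (better_agree A). }
  pose proof (em_P1 G D0) as D; dor D.
  + apply (main _ (incl_refl _) zero zero).
    * intros G2 HG z _ K1 K2; wk HG; ispec D z; imp D K1; exact (imp_e D K2).
    * intros G2 HG K; apply BotE, (imp_e K), eq_refl_.
  + pose proof (em_not_P1 D0 D) as K; dex K y.
    apply (main _ (incl_refl _) (succ zero) y).
    * intros G2 HG z K1 _ _; exact (succ_ne K1).
    * intros G2 HG _; wk HG.
      (* [K] merely refutes an implication; deciding its two parts recovers that [y] is larger than
         [n] and better. *)
      pose proof (em_D0 G (D0_better a b n y n)) as D1; dor D1.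
      -- isplit; auto; pose proof (lt_or_le G n y) as C; dor C; auto.
         apply BotE, (imp_e K); ii K1; exact (lt_not_le _ K1 C).
      -- apply BotE, (imp_e K); ii K1; exact D1.
Qed.
End Stages.

#[export] Hint Rewrite subst_good subst_better subst_correct_at subst_correct : ha.

(** * The tree *)

Section Tree.
Variable L : signature.
Variable c : fsym L 3.
Implicit Types (s t u a b A j x y z w v m n q e : term L) (p r : form L) (G : list (form L)).
Notation col := (color c).
Notation thr := (thr c).
Notation good := (good c).
Notation correct := (correct c).

(** Membership stands inside the universal quantifier so that the formula has literally the shape
    required by [Sigma2]. *)
Definition isnode a x : form L :=
  ex1 (fun b => all1 (fun y => mem (up 1 b) (up 2 x) ∧
    correct_at c (up 2 a) (up 1 b) (succ (up 2 x)) y)).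
Definition Thr a x y : form L :=
  ex1 (fun b => correct (up 1 a) b (succ (up 1 x)) ∧ thr (up 1 a) b (up 1 x) (up 1 y)).
Definition Good a s v q y : form L :=
  q == zero ∨ ball s (fun z => up 1 v <= z ⇒ Thr (up 1 a) z (up 1 y) ⇒
    bex (up 1 v) (fun x => up 2 q <= x ∧ Thr (up 2 a) x (up 2 y) ∧
      col (up 2 a) x (up 2 y) == col (up 2 a) (up 1 z) (up 2 y))).

Lemma subst_isnode f a x : subst f (isnode a x) = isnode (tsubst f a) (tsubst f x).
Proof. unfold isnode; substtac. Qed.
Hint Rewrite subst_isnode : ha.
Lemma subst_Thr f a x y : subst f (Thr a x y) = Thr (tsubst f a) (tsubst f x) (tsubst f y).
Proof. unfold Thr; substtac. Qed.
Hint Rewrite subst_Thr : ha.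
Lemma subst_Good f a s v q y : subst f (Good a s v q y) =
  Good (tsubst f a) (tsubst f s) (tsubst f v) (tsubst f q) (tsubst f y).
Proof. unfold Good; substtac. Qed.
Hint Rewrite subst_Good : ha.
#[export] Instance isnode_proper G : Proper (teq G ==> teq G ==> fle G) isnode.
Proof. apply natural2_proper; intro; apply subst_isnode. Qed.
#[export] Instance Thr_proper G : Proper (teq G ==> teq G ==> teq G ==> fle G) Thr.
Proof. apply natural3_proper; intro; apply subst_Thr. Qed.
#[export] Instance Good_proper G :
  Proper (teq G ==> teq G ==> teq G ==> teq G ==> teq G ==> fle G) Good.
Proof. apply natural5_proper; intro; apply subst_Good. Qed.

Lemma isnode_e G a x b s : (G ⊩ isnode a x) -> (G ⊩ correct a b s) -> (G ⊩ x < s) ->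
  G ⊩ mem b x.
Proof.
intros H K1 K2; unfold isnode in H; dex H b'.
assert (K3 : G ⊩ correct a b' (succ x)).
{ apply correct_all; intros G' HG y; wk HG; ispec H y; exact (AndE2 H). }
ispec H (@zero L); dand H H2.
apply (agree_1 (correct_agree K3 (correct_le K1 (lt_succ_le K2))) (lt_Sn _ _) H).
Qed.
Lemma isnode_i G a x b s : (G ⊩ correct a b s) -> (G ⊩ x < s) -> (G ⊩ mem b x) ->
  G ⊩ isnode a x.
Proof.
intros K1 K2 K3; unfold isnode; iex b; ii y; isplit; auto.
exact (correct_e y (correct_le K1 (lt_succ_le K2))).
Qed.
Lemma Thr_e G a x y b s : (G ⊩ Thr a x y) -> (G ⊩ correct a b s) -> (G ⊩ x < s) ->
  G ⊩ thr a b x y.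
Proof.
intros H K1 K2; unfold Thr in H; dex H b'; dand H H2.
apply (thr_agree (correct_agree H (correct_le K1 (lt_succ_le K2))) (lt_Sn _ _) H2).
Qed.
Lemma Thr_i G a x y b s : (G ⊩ correct a b s) -> (G ⊩ x < s) -> (G ⊩ thr a b x y) ->
  G ⊩ Thr a x y.
Proof.
intros K1 K2 K3; unfold Thr; iex b; isplit; auto; exact (correct_le K1 (lt_succ_le K2)).
Qed.

(** Fixes a correct code [b] up to [s], on which questions about the tree below [s] become decidable
    questions about digits. *)
Ltac stage a s b := apply (@correct_ex L c _ a s);
  let G := fresh "G" in let HG := fresh "HGx" in let K := fresh "Cb" in
  intros G HG b K; wk HG.

Lemma dec_node G a x : G ⊩ isnode a x ∨ ¬ isnode a x.
Proof.
stage a (succ x) b; pose proof (dec_mem G b x) as D; dor D.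
- il; apply (isnode_i Cb); auto; apply lt_Sn.
- ir; ii H; apply (imp_e D); apply (isnode_e H Cb), lt_Sn.
Qed.
Lemma dec_Thr G a x y : G ⊩ Thr a x y ∨ ¬ Thr a x y.
Proof.
stage a (succ x) b; pose proof (dec_thr c G a b x y) as D; dor D.
- il; apply (Thr_i Cb); auto; apply lt_Sn.
- ir; ii H; apply (imp_e D); apply (Thr_e H Cb), lt_Sn.
Qed.
Lemma Thr_lt G a x y : (G ⊩ Thr a x y) -> G ⊩ x < y.
Proof. intros H; dex H b; dand H H2; exact (thr_lt H2). Qed.
Lemma Thr_node G a x y : (G ⊩ Thr a x y) -> G ⊩ isnode a x.
Proof.
intros H; dex H b; dand H H2; apply (isnode_i H (lt_Sn _ _) (thr_mem H2)).
Qed.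
Lemma Thr_col G a x y w : (G ⊩ Thr a x y) -> (G ⊩ Thr a w x) -> G ⊩ col a w x == col a w y.
Proof.
intros H K; stage a (succ x) b; apply (thr_col (Thr_e H Cb (lt_Sn _ _))).
apply (Thr_e K Cb), lt_S, (Thr_lt K).
Qed.
Lemma Thr_intro G a x y : (G ⊩ x < y) -> (G ⊩ isnode a x) ->
  (forall G', incl G G' -> forall w, (G' ⊩ Thr a w x) -> G' ⊩ col a w x == col a w y) ->
  G ⊩ Thr a x y.
Proof.
intros H1 H2 H3; stage a (succ x) b; apply (Thr_i Cb (lt_Sn _ _)), thr_i; auto.
- apply (isnode_e H2 Cb (lt_Sn _ _)).
- intros G2 HG w K; wk HG; apply (H3 _ (incl_refl _)), (Thr_i Cb); auto.
  apply lt_S, (thr_lt K).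
Qed.

Lemma Thr_trans G a x y z : (G ⊩ Thr a x y) -> (G ⊩ Thr a y z) -> G ⊩ Thr a x z.
Proof.
intros H; apply imp_e; revert H; apply imp_e.
enough (E : G ⊩ all2 (fun y z => Thr (up 2 a) (up 2 x) y ⇒ Thr (up 2 a) y z ⇒
   Thr (up 2 a) (up 2 x) z)) by (ispec E y; ispec E z; exact E).
sinduction (fun g x => all2 (fun y z => Thr (up 2 (g a)) (up 2 x) y ⇒
   Thr (up 2 (g a)) y z ⇒ Thr (up 2 (g a)) (up 2 x) z)) x.
ii u v K1 K2; apply Thr_intro.
- apply lt_trans with u; now apply (Thr_lt (a:=a)).
- exact (Thr_node K1).
- intros G' HG w K; wk HG; apply eq_trans_ with (col a w u); [exact (Thr_col K1 K)|].
  apply (Thr_col K2); pose proof (IH _ (incl_refl _) w (Thr_lt K)) as I.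
  ispec I n; ispec I u; imp I K; now imp I K1.
Qed.

(** By induction, a node above [x] is also above [y], and there [x], [y] and [z] have the same
    color. So each path is linearly ordered. *)
Lemma Thr_chain G a x y z : (G ⊩ Thr a x z) -> (G ⊩ Thr a y z) -> (G ⊩ x < y) -> G ⊩ Thr a x y.
Proof.
intros H H2; apply imp_e; revert H; apply imp_e.
sinduction (fun g x => Thr (g a) x (g z) ⇒ x < g y ⇒ Thr (g a) x (g y)) x.
ii K1 K2; apply Thr_intro; auto; [exact (Thr_node K1)|].
intros G' HG w K; wk HG; apply eq_trans_ with (col a w z); [exact (Thr_col K1 K)|].
apply eq_sym_, (Thr_col H2); pose proof (IH _ (incl_refl _) w (Thr_lt K)) as I.
impg I; [exact (Thr_trans K K1)|]; impg I; auto; exact (lt_trans (Thr_lt K) K2).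
Qed.

Lemma Good_i G a s v q y :
  (forall G', incl G G' -> forall z, (G' ⊩ z < s) -> (G' ⊩ v <= z) -> (G' ⊩ Thr a z y) ->
    G' ⊩ bex v (fun x => up 1 q <= x ∧ Thr (up 1 a) x (up 1 y) ∧
      col (up 1 a) x (up 1 y) == col (up 1 a) (up 1 z) (up 1 y))) ->
  G ⊩ Good a s v q y.
Proof.
intros H; ir; ii z K1 K2 K3.
pose proof (H _ (incl_refl _) z K1 K2 K3) as K; simp in K; exact K.
Qed.
Lemma Good_0 G a s v y : G ⊩ Good a s v zero y.
Proof. il; apply eq_refl_. Qed.
Lemma Good_e G a s v q y z : (G ⊩ Good a s v q y) -> (G ⊩ z < s) -> (G ⊩ v <= z) ->
  (G ⊩ Thr a z y) -> G ⊩ q == zero ∨ bex v (fun x => up 1 q <= x ∧ Thr (up 1 a) x (up 1 y) ∧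
      col (up 1 a) x (up 1 y) == col (up 1 a) (up 1 z) (up 1 y)).
Proof.
intros H K1 K2 K3; dor H; [now il|ir]; ispec H z; imp H K1; imp H K2; imp H K3.
simp; exact H.
Qed.

Lemma good_Good G a b s v q y : (G ⊩ correct a b s) -> (G ⊩ v <= s) ->
  (G ⊩ good a b s v q y) -> G ⊩ Good a s v q y.
Proof.
intros C Hv H; dor H; [now il|]; apply Good_i; intros G' HG z K1 K2 K3; wk HG.
ispec H z; imp H K1; imp H K2; impg H; [exact (Thr_e K3 C K1)|].
dex H x; dand H H2; dand H2 H3; dand H3 H4; iex x; isplit; auto; isplit; auto; isplit; auto.
apply (Thr_i C); auto; exact (lt_le_trans H Hv).
Qed.
Lemma Good_good G a b s v q y : (G ⊩ correct a b s) -> (G ⊩ v <= s) ->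
  (G ⊩ Good a s v q y) -> G ⊩ good a b s v q y.
Proof.
intros C Hv H; dor H; [now il|ir]; ii z K1 K2 K3.
ispec H z; imp H K1; imp H K2; impg H; [exact (Thr_i C K1 K3)|].
dex H x; dand H H2; dand H2 H3; dand H3 H4; iex x; isplit; auto; isplit; auto; isplit; auto.
apply (Thr_e H3 C); exact (lt_le_trans H Hv).
Qed.
Lemma dec_Good G a s v q y : (G ⊩ v <= s) -> G ⊩ Good a s v q y ∨ ¬ Good a s v q y.
Proof.
intros H; stage a s b; pose proof (dec_good c G a b s v q y) as D; dor D.
- il; exact (good_Good Cb H D).
- ir; ii K; apply (imp_e D); exact (Good_good Cb H K).
Qed.

Lemma Good_le G a s s' v q y : (G ⊩ Good a s v q y) -> (G ⊩ s' <= s) -> G ⊩ Good a s' v q y.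
Proof.
intros H K; dor H; [now il|ir]; ii z K1; ispec H z; apply (imp_e H).
exact (lt_le_trans K1 K).
Qed.
Lemma Good_anti G a s v q q' y : (G ⊩ Good a s v q y) -> (G ⊩ q' <= q) -> G ⊩ Good a s v q' y.
Proof.
intros H K; dor H.
- il; rwin H K; apply lt_succ_cases in K; dor K; auto; exact (nlt_0 _ K).
- ir; ii z K1 K2 K3; ispec H z; imp H K1; imp H K2; imp H K3.
  dex H x; dand H H2; dand H2 H3; iex x; isplit; auto; isplit; auto; exact (le_trans K H2).
Qed.

Lemma isnode_intro G a x :
  (forall G', incl G G' -> forall y v q, (G' ⊩ x < y) -> (G' ⊩ v < x) -> (G' ⊩ Thr a v y) ->
    (G' ⊩ Thr a v x) -> (G' ⊩ ¬ col a v y == col a v x) -> (G' ⊩ Good a x v q y) ->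
    (G' ⊩ ¬ Good a x v (succ q) x) -> (G' ⊩ Good a x v q x ⇒ col a v y < col a v x) ->
    G' ⊩ Bot) -> G ⊩ isnode a x.
Proof.
intros H; stage a (succ x) b; pose proof (dec_mem G b x) as D; dor D.
{ apply (isnode_i Cb); auto; apply lt_Sn. }
pose proof (correct_neg Cb (lt_Sn _ _) D) as E; dex E y; dand E E1; dand E1 E2.
dex E2 v; dand E2 E3; dand E3 E4; dand E4 E5; dand E5 E6; dex E6 q.
dand E6 E7; dand E7 E8; dand E8 E9.
assert (Cx : G ⊩ correct a b x) by exact (correct_le Cb (le_S _ _)).
pose proof (lt_le E2) as E2'.
apply BotE, (H _ (incl_refl _) y v q); auto.
- exact (Thr_i Cx E2 E3).
- exact (Thr_i Cx E2 E4).
- exact (good_Good Cx E2' E7).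
- ii K; apply (imp_e E8); exact (Good_good Cx E2' K).
- ii K; apply (imp_e E9); exact (Good_good Cx E2' K).
Qed.

(** The converse of [isnode_intro]. The premise [q <= x] reflects the bounded search for [q] in
    [better]. *)
Lemma node_best G a x y v q : (G ⊩ isnode a x) -> (G ⊩ x < y) -> (G ⊩ Thr a v y) ->
  (G ⊩ Thr a v x) -> (G ⊩ ¬ col a v y == col a v x) -> (G ⊩ q <= x) -> (G ⊩ Good a x v q y) ->
  (G ⊩ ¬ Good a x v (succ q) x) -> (G ⊩ Good a x v q x ⇒ col a v y < col a v x) -> G ⊩ Bot.
Proof.
intros K0 K1 K2 K3 K4 Kq K5 K6 K7; stage a (succ x) b.
pose proof (Thr_lt K3) as Kv.
assert (Cx : G ⊩ correct a b x) by exact (correct_le Cb (le_S _ _)).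
apply (correct_pos Cb (lt_Sn _ _) (isnode_e K0 Cb (lt_Sn _ _)) K1).
iex v; isplit; auto; isplit; [exact (Thr_e K2 Cx Kv)|isplit; [exact (Thr_e K3 Cx Kv)|]].
isplit; auto; iex q; isplit; auto; pose proof (lt_le Kv) as Kv'.
isplit; [exact (Good_good Cx Kv' K5)|isplit].
- ii K; apply (imp_e K6); exact (good_Good Cx Kv' K).
- ii K; apply (imp_e K7); exact (good_Good Cx Kv' K).
Qed.

Lemma node_0 G a : G ⊩ isnode a zero.
Proof. apply isnode_intro; intros G' HG y v q _ K; intros; exact (nlt_0 _ K). Qed.
End Tree.

#[export] Hint Rewrite subst_isnode subst_Thr subst_Good : ha.

(** * Candidates that remain at all stages *)

Section Alive.
Variable L : signature.
Variable c : fsym L 3.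
Implicit Types (s t u a b A j x y z w v m n q e : term L) (p r : form L) (G : list (form L)).
Notation col := (color c).
Notation thr := (thr c).
Notation good := (good c).
Notation correct := (correct c).
Notation Thr := (Thr c).
Notation Good := (Good c).
Notation isnode := (isnode c).

(** The threshold is measured at [w], while the candidates pass through [x] and leave it with a
    color below [e]. With [x = w] this selects the best color at [w]; with [w] above [x] it says
    that a choice made at [w] is still supported at [x]. *)
Definition Alive a x w q e : form L :=
  all1 (fun s => ex1 (fun y => up 1 s <= y ∧ Thr (up 2 a) (up 2 x) y ∧
    col (up 2 a) (up 2 x) y < up 2 e ∧ Good (up 2 a) (up 1 s) (up 2 w) (up 2 q) y)).
Definition Dead a x w q e : form L :=
  ex1 (fun s => up 1 w <= s ∧ all1 (fun y => up 1 s <= y ⇒ Thr (up 2 a) (up 2 x) y ⇒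
    col (up 2 a) (up 2 x) y < up 2 e ⇒ ¬ Good (up 2 a) (up 1 s) (up 2 w) (up 2 q) y)).

Lemma subst_Alive f a x w q e : subst f (Alive a x w q e) =
  Alive (tsubst f a) (tsubst f x) (tsubst f w) (tsubst f q) (tsubst f e).
Proof. unfold Alive; substtac. Qed.
Hint Rewrite subst_Alive : ha.
#[export] Instance Alive_proper G :
  Proper (teq G ==> teq G ==> teq G ==> teq G ==> teq G ==> fle G) Alive.
Proof. apply natural5_proper; intro; apply subst_Alive. Qed.

Lemma subst_Dead f a x w q e : subst f (Dead a x w q e) =
  Dead (tsubst f a) (tsubst f x) (tsubst f w) (tsubst f q) (tsubst f e).
Proof. unfold Dead; substtac. Qed.
Hint Rewrite subst_Dead : ha.
#[export] Instance Dead_proper G :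
  Proper (teq G ==> teq G ==> teq G ==> teq G ==> teq G ==> fle G) Dead.
Proof. apply natural5_proper; intro; apply subst_Dead. Qed.

(** Checks the correctness of [b] and the absence of the candidate [y] at the same [y], so that one
    universal quantifier covers both. *)
Definition dead_at a x w q e s b y : form L :=
  x < s ∧ correct_at c a b s y ∧
  (s <= y ⇒ thr a b x y ⇒ col a x y < e ⇒ ¬ good a b s w q y).
Lemma subst_dead_at f a x w q e s b y : subst f (dead_at a x w q e s b y) =
  dead_at (tsubst f a) (tsubst f x) (tsubst f w) (tsubst f q) (tsubst f e)
    (tsubst f s) (tsubst f b) (tsubst f y).
Proof. unfold dead_at; substtac. Qed.
Hint Rewrite subst_dead_at : ha.
Lemma D0_dead_at a x w q e s b y : Delta0 (dead_at a x w q e s b y).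
Proof.
unfold dead_at, Neg, lt; repeat first [apply D0_eq|apply D0_bot|apply D0_thr|apply D0_good
  |apply D0_correct_at|apply D0_and|apply D0_imp].
Qed.

Definition dead_code a x w q e : form L :=
  ex2 (fun s b => all1 (fun y =>
    dead_at (up 3 a) (up 3 x) (up 3 w) (up 3 q) (up 3 e) (up 1 s) (up 1 b) y)).

(* EM2 allows one existential quantifier only. So the witnesses are bounded by a
   single [n], and their bounded quantifiers are pulled inside the universal one: if no
   pair below [n] works, the counterexamples are bounded. *)
Lemma dead_code_em G a x w q e : G ⊩ dead_code a x w q e ∨ ¬ dead_code a x w q e.
Proof.
(* Below the quantifiers over [n] and then [N]: some [s] and [b] below [n] have no counterexample
   [y] below [N]. *)
assert (D : Delta0 (bex (Var 1) (fun s => bex (Var 2) (fun b => ball (Var 2) (fun y =>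
    dead_at (up 5 a) (up 5 x) (up 5 w) (up 5 q) (up 5 e) (Var 2) (Var 1) y))))).
{ unfold bex, ball; apply D0_ex, D0_ex, D0_all, D0_dead_at. }
pose proof (em_S2 G D) as H; dor H.
- il; dex H n.
  assert (S : schema (fun g s => bex (g n) (fun b => all1 (fun y => dead_at (up 2 (g a))
     (up 2 (g x)) (up 2 (g w)) (up 2 (g q)) (up 2 (g e)) (up 2 s) (up 1 b) y)))) by schema_tac.
  assert (S2 : forall s, schema (fun g b => all1 (fun y => dead_at (up 1 (g a))
     (up 1 (g x)) (up 1 (g w)) (up 1 (g q)) (up 1 (g e)) (up 1 (g s)) (up 1 b) y)))
    by (intros; schema_tac).
  apply (bounded_em (n:=n) S); cbv beta.
  + intros G' HG s Hs; wk HG; apply (bounded_em (n:=n) (S2 s)); cbv beta.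
    * intros G' HG b Hb; wk HG; apply em_P1; simp; apply D0_dead_at.
    * intros G' HG b Hb K; wk HG; il; iex b; isplit; auto; simp in K; exact K.
    * intros G' HG K; wk HG; ir; ii K1; dex K1 b; dand K1 K2.
      apply (K _ (incl_refl _) b); auto; simp; exact K2.
  + intros G' HG s Hs K; wk HG; dex K b; dand K K2; unfold dead_code; iex s; iex b; exact K2.
  + intros G' HG K; wk HG; apply BotE.
    (* Collection in two rounds: first, for each [s], a bound [N] for the counterexamples of all [b]
       below [n]; then, in [C2], one bound for all [s]. *)
    assert (C1 : G ⊩ all1 (fun s => s < up 1 n ⇒ ex1 (fun N => ball (up 2 n) (fun b =>
      bex (up 1 N) (fun y => ¬ dead_at (up 4 a) (up 4 x) (up 4 w) (up 4 q) (up 4 e)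
        (up 2 (Var 1)) (up 1 b) y))))).
    { ii s Hs.
      assert (C : G ⊩ n <= n ⇒ ex1 (fun N => ball (up 1 n) (fun b =>
      bex (up 1 N) (fun y => ¬ dead_at (up 3 a) (up 3 x) (up 3 w) (up 3 q) (up 3 e)
        (up 3 s) (up 1 b) y)))).
      { iinduction (fun g m => m <= g n ⇒ ex1 (fun N => ball (up 1 m) (fun b =>
         bex (up 1 N) (fun y => ¬ dead_at (up 3 (g a)) (up 3 (g x)) (up 3 (g w)) (up 3 (g q))
          (up 3 (g e)) (up 3 (g s)) (up 1 b) y)))) n.
        - ii _K; iex (@zero L); ii b Hb; exact (nlt_0 _ Hb).
        - ii H1; impg IH; [now apply lt_S_inv, lt_S in H1|]; dex IH N.
          assert (Q : G ⊩ ex1 (fun y => ¬ dead_at (up 1 a) (up 1 x) (up 1 w) (up 1 q) (up 1 e)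
             (up 1 s) (up 1 n0) y)).
          { apply em_not_P1; [apply D0_dead_at|]; ii H2.
            apply (K _ (incl_refl _) s Hs); iex n0; isplit; [now apply lt_S_inv|exact H2]. }
          dex Q y; pose proof (ub2 G N (succ y)) as U; dex U N'; dand U U2.
          iex N'; ii b Hb; apply lt_succ_cases in Hb; dor Hb.
          + ispec IH b; imp IH Hb; dex IH y'; dand IH IH2.
            iex y'; isplit; auto; exact (lt_le_trans IH U).
          + iex y; isplit; [now apply lt_S_inv|].
            ii H2; apply (imp_e Q); apply (schema_leibniz (F := fun g b =>
              dead_at (g a) (g x) (g w) (g q) (g e) (g s) b (g y)) (s:=b)); auto; schema_tac. }
      impg C; [apply le_refl|]; simp in C; exact C. }
    assert (C2 : G ⊩ n <= n ⇒ ex1 (fun N => ball (up 1 n) (fun s => ball (up 2 n) (fun b =>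
      bex (up 2 N) (fun y => ¬ dead_at (up 4 a) (up 4 x) (up 4 w) (up 4 q) (up 4 e)
        (up 2 s) (up 1 b) y))))).
    { iinduction (fun g m => m <= g n ⇒ ex1 (fun N => ball (up 1 m) (fun s =>
        ball (up 2 (g n)) (fun b =>
         bex (up 2 N) (fun y => ¬ dead_at (up 4 (g a)) (up 4 (g x)) (up 4 (g w)) (up 4 (g q))
          (up 4 (g e)) (up 2 s) (up 1 b) y))))) n.
      - ii _K; iex (@zero L); ii s Hs; exact (nlt_0 _ Hs).
      - ii H1; impg IH; [now apply lt_S_inv, lt_S in H1|]; dex IH N.
        apply lt_S_inv in H1; ispec C1 n0; imp C1 H1; dex C1 N2.
        pose proof (ub2 G N N2) as U; dex U N'; dand U U2.
        iex N'; ii s Hs; ii b Hb; apply lt_succ_cases in Hs; dor Hs.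
        + ispec IH s; imp IH Hs; ispec IH b; imp IH Hb; dex IH y; dand IH IH2.
          iex y; isplit; auto; exact (lt_le_trans IH U).
        + ispec C1 b; imp C1 Hb; dex C1 y; dand C1 C3.
          iex y; isplit; [exact (lt_le_trans C1 U2)|].
          ii H2; apply (imp_e C3); apply (schema_leibniz (F := fun g s =>
              dead_at (g a) (g x) (g w) (g q) (g e) s (g b) (g y)) (s:=s)); auto; schema_tac. }
    impg C2; [apply le_refl|]; simp in C2; dex C2 N.
    (* At this common bound, the pair supplied by the Sigma2 hypothesis has a counterexample after
       all. *)
    ispec H N; dex H s; dand H H2; dex H2 b; dand H2 H3.
    ispec C2 s; imp C2 H; ispec C2 b; imp C2 H2; dex C2 y; dand C2 C3.
    ispec H3 y; imp H3 C2; exact (imp_e C3 H3).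
- ir; unfold dead_code; ii K; apply (imp_e H); dex K s; dex K b.
  pose proof (ub2 G s b) as U; dex U n; dand U U2.
  iex (succ n); ii N; iex s; isplit; auto; iex b; isplit; auto; ii y Hy.
  ispec K y; exact K.
Qed.

Lemma Alive_em G a x w q e : (G ⊩ w <= x) -> G ⊩ Alive a x w q e ∨ Dead a x w q e.
Proof.
intros Hw; pose proof (dead_code_em G a x w q e) as H; unfold dead_code in H; dor H.
- ir; dex H s; dex H b.
  assert (Cb : G ⊩ correct a b s).
  { apply correct_all; intros G' HG y; wk HG; ispec H y; exact (AndE1 (AndE2 H)). }
  pose proof H as H0; ispec H0 (@zero L); apply AndE1 in H0.
  assert (Hs : G ⊩ w <= s) by exact (le_trans Hw (lt_le H0)).
  unfold Dead; iex s; isplit; auto; ii y K1 K2 K3 K4.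
  ispec H y; apply AndE2, AndE2 in H; imp H K1; impg H; [exact (Thr_e K2 Cb H0)|].
  imp H K3; apply (imp_e H); exact (Good_good Cb Hs K4).
(* The stage is moved beyond [x], as [dead_at] demands; a candidate that is good at the later stage
   is good at [s0]. *)
- il; unfold Alive; ii s0; pose proof (ub2 G s0 (succ x)) as U; dex U s; dand U U2.
  apply lt_S_inv in U2.
  apply (@correct_ex L c _ a s); intros G' HG b Cb; wk HG.
  assert (N : G ⊩ Ex (¬ dead_at (up 1 a) (up 1 x) (up 1 w) (up 1 q) (up 1 e) (up 1 s) (up 1 b)
      (Var 0))).
  { apply em_not_P1; [apply D0_dead_at|]; ii K; apply (imp_e H); iex s; iex b; exact K. }
  dex N y; pose proof (correct_e y Cb) as Cy.
  assert (Hs : G ⊩ w <= s) by exact (le_trans Hw (lt_le U2)).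
  (* For a correct code, [dead_at] can only fail because all premises hold and [good] holds too;
     decidability extracts them one by one. *)
  assert (E : forall p, Delta0 p ->
    (forall G', incl G G' -> (G' ⊩ ¬ p) -> G' ⊩ dead_at a x w q e s b y) -> G ⊩ p).
  { intros p Dp Hp; pose proof (em_D0 G Dp) as D; dor D; auto.
    apply BotE, (imp_e N); apply (Hp _ (incl_refl _) D). }
  assert (E1 : G ⊩ s <= y).
  { apply E; [apply D0_eq|]; intros G' HG K; wk HG; isplit; auto; isplit; auto.
    ii K1; apply BotE, (imp_e K K1). }
  assert (E2 : G ⊩ thr a b x y).
  { apply E; [apply D0_thr|]; intros G' HG K; wk HG; isplit; auto; isplit; auto.
    ii K1 K2; apply BotE, (imp_e K K2). }
  assert (E3 : G ⊩ col a x y < e).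
  { apply E; [apply D0_eq|]; intros G' HG K; wk HG; isplit; auto; isplit; auto.
    ii K1 K2 K3; apply BotE, (imp_e K K3). }
  assert (E4 : G ⊩ good a b s w q y).
  { apply E; [apply D0_good|]; intros G' HG K; wk HG; isplit; auto; isplit; auto.
    ii K1 K2 K3; exact K. }
  iex y; isplit; [exact (le_trans U E1)|isplit; [exact (Thr_i Cb U2 E2)|isplit; auto]].
  exact (Good_le (good_Good Cb Hs E4) U).
Qed.

Lemma Alive_e G a x w q e s r : (G ⊩ Alive a x w q e) ->
  (forall G', incl G G' -> forall y, (G' ⊩ s <= y) -> (G' ⊩ Thr a x y) -> (G' ⊩ col a x y < e) ->
    (G' ⊩ Good a s w q y) -> G' ⊩ r) -> G ⊩ r.
Proof.
intros H K; unfold Alive in H; ispec H s; dex H y; dand H H2; dand H2 H3; dand H3 H4.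
now apply (K _ (incl_refl _) y).
Qed.
Lemma Alive_i G a x w q e : (forall G', incl G G' -> forall s,
    G' ⊩ ex1 (fun y => up 1 s <= y ∧ Thr (up 1 a) (up 1 x) y ∧
    col (up 1 a) (up 1 x) y < up 1 e ∧ Good (up 1 a) (up 1 s) (up 1 w) (up 1 q) y)) ->
  G ⊩ Alive a x w q e.
Proof.
intros H; unfold Alive; ii s; pose proof (H _ (incl_refl _) s) as K; simp in K; exact K.
Qed.
Lemma Dead_e G a x w q e r : (G ⊩ Dead a x w q e) ->
  (forall G', incl G G' -> forall s, (G' ⊩ w <= s) ->
    (forall G2, incl G' G2 -> forall t y, (G2 ⊩ s <= y) -> (G2 ⊩ s <= t) -> (G2 ⊩ Thr a x y) ->
      (G2 ⊩ col a x y < e) -> (G2 ⊩ Good a t w q y) -> G2 ⊩ Bot) -> G' ⊩ r) -> G ⊩ r.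
Proof.
intros H K; unfold Dead in H; dex H s; dand H H2.
apply (K _ (incl_refl _) s); auto; intros G' HG t y K1 K2 K3 K4 K5; wk HG.
ispec H2 y; imp H2 K1; imp H2 K3; imp H2 K4; apply (imp_e H2); exact (Good_le K5 K2).
Qed.
Lemma Alive_not_Dead G a x w q e : (G ⊩ Alive a x w q e) -> (G ⊩ Dead a x w q e) -> G ⊩ Bot.
Proof.
intros H K; apply (Dead_e K); intros G' HG s K1 K2; wk HG.
apply (Alive_e (s:=s) H); intros G' HG y E1 E2 E3 E4; wk HG.
apply (K2 _ (incl_refl _) s y); auto; apply le_refl.
Qed.
End Alive.

#[export] Hint Rewrite subst_Alive subst_Dead : ha.

(** * The infinite branch *)

Section Branch.
Variable L : signature.
Variable c : fsym L 3.
Variable k : nat.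
Implicit Types (s t u a b A j x y z w v m n q e : term L) (p r : form L) (G : list (form L)).
Notation col := (color c).
Notation Thr := (Thr c).
Notation Good := (Good c).
Notation isnode := (isnode c).
Notation Alive := (Alive c).
Notation Dead := (Dead c).
Notation K := (@num L k).

(* [q] is the largest threshold that candidates through [w] meet at all stages,
   and [e] the least color with which they do. *)
Definition Best a w q e : form L :=
  q <= w ∧ e < K ∧ Alive a w w q (succ e) ∧ Dead a w w q e ∧ Dead a w w (succ q) K.
Lemma subst_Best f a w q e : subst f (Best a w q e) =
  Best (tsubst f a) (tsubst f w) (tsubst f q) (tsubst f e).
Proof. unfold Best; substtac. Qed.
Hint Rewrite subst_Best : ha.
#[export] Instance Best_proper G :
  Proper (teq G ==> teq G ==> teq G ==> teq G ==> fle G) Best.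
Proof. apply natural4_proper; intro; apply subst_Best. Qed.

(** A local description, which codes no sequence of choices. Besides the best color at each earlier
    [w], it records that the best threshold at [w] is still met by candidates through [x]; this is
    what lets [onbr_step] continue. *)
Definition onbr a x : form L :=
  isnode a x ∧ Alive a x x zero K ∧
  ball x (fun w => Thr (up 1 a) w (up 1 x) ⇒ ex1 (fun q =>
    Best (up 2 a) (up 1 w) q (col (up 2 a) (up 1 w) (up 2 x)) ∧
    Alive (up 2 a) (up 2 x) (up 1 w) q K)).
Lemma subst_onbr f a x : subst f (onbr a x) = onbr (tsubst f a) (tsubst f x).
Proof. unfold onbr; substtac. Qed.
Hint Rewrite subst_onbr : ha.
#[export] Instance onbr_proper G : Proper (teq G ==> teq G ==> fle G) onbr.
Proof. apply natural2_proper; intro; apply subst_onbr. Qed.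

Lemma col_lt G a x y : (G ⊩ is_coloring c k a) -> (G ⊩ x < y) -> G ⊩ col a x y < K.
Proof. intros H; unfold is_coloring in H; ispec H x; ispec H y; apply imp_e, H. Qed.

Lemma Alive_mono G a x w q q' e e' : (G ⊩ Alive a x w q e) -> (G ⊩ q' <= q) -> (G ⊩ e <= e') ->
  G ⊩ Alive a x w q' e'.
Proof.
intros H K1 K2; apply Alive_i; intros G' HG s; wk HG.
apply (Alive_e (s:=s) H); intros G' HG y E1 E2 E3 E4; wk HG.
iex y; isplit; auto; isplit; auto; isplit; [exact (lt_le_trans E3 K2)|].
exact (Good_anti E4 K1).
Qed.

Lemma Good_col G a s w q y z : (G ⊩ Good a s w q y) -> (G ⊩ ¬ q == zero) -> (G ⊩ z < s) ->
  (G ⊩ w <= z) -> (G ⊩ Thr a z y) ->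
  G ⊩ bex w (fun x => up 1 q <= x ∧ Thr (up 1 a) x (up 1 y) ∧
      col (up 1 a) x (up 1 y) == col (up 1 a) (up 1 z) (up 1 y)).
Proof.
intros H Hq K1 K2 K3; pose proof (Good_e H K1 K2 K3) as E; dor E; auto.
apply BotE, (imp_e Hq E).
Qed.

(** Two searches for a change. The threshold 0 is alive and [succ w] is not, because thresholds at
    [w] lie below [w]; for the [q] found, no color is below 0 and all are below [K]. *)
Lemma Best_ex G a w r : (G ⊩ Alive a w w zero K) ->
  (forall G', incl G G' -> forall q e, (G' ⊩ Best a w q e) -> G' ⊩ r) -> G ⊩ r.
Proof.
intros H HR.
assert (E : forall G1, incl G G1 -> forall q e, G1 ⊩ Alive a w w q e ∨ ¬ Alive a w w q e).
{ intros G1 HG q e; pose proof (Alive_em c a q e (le_refl G1 w)) as D; dor D; [now il|ir].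
  ii E; exact (Alive_not_Dead E D). }
assert (S : schema (fun g q => Alive (g a) (g w) (g w) q K)) by schema_tac.
apply (step_change (n:=succ w) S); cbv beta.
- intros G' HG q; exact (E _ HG q K).
- exact H.
- ii A; apply (Alive_e (s:=succ w) A); intros G' HG y E1 E2 E3 E4; wk HG.
  pose proof (Good_e E4 (lt_Sn _ _) (le_refl _ _) E2) as D; dor D; [exact (succ_ne D)|].
  dex D x; dand D D2; exact (lt_not_le _ D (lt_le (lt_S_inv (AndE1 D2)))).
- intros G' HG q K1 K2 K3; wk HG.
  assert (S2 : schema (fun g e => ¬ Alive (g a) (g w) (g w) (g q) e)) by schema_tac.
  apply (step_change (n:=K) S2); cbv beta.
  + intros G' HG e; exact (dec_neg (E _ HG q e)).
  + ii A; apply (Alive_e (s:=zero) A); intros G' HG y E1 E2 E3 E4; exact (nlt_0 _ E3).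
  + ii A; exact (imp_e A K2).
  + intros G' HG e K4 K5 K6; wk HG; apply (HR _ (incl_refl _) q e).
    isplit; auto; isplit; auto; isplit; [|isplit].
    * pose proof (E _ (incl_refl _) q (succ e)) as D; dor D; auto; apply BotE, (imp_e K6 D).
    * pose proof (Alive_em c a q e (le_refl G w)) as D; dor D; auto; apply BotE, (imp_e K5 D).
    * pose proof (Alive_em c a (succ q) K (le_refl G w)) as D; dor D; auto.
      apply BotE, (imp_e K3 D).
Qed.

Lemma Best_lt G a w q e : (G ⊩ Best a w q e) -> G ⊩ e < K.
Proof. intros H; exact (AndE1 (AndE2 H)). Qed.
Lemma Best_alive G a w q e : (G ⊩ Best a w q e) -> G ⊩ Alive a w w q (succ e).
Proof. intros H; exact (AndE1 (AndE2 (AndE2 H))). Qed.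
Lemma Best_dead1 G a w q e : (G ⊩ Best a w q e) -> G ⊩ Dead a w w q e.
Proof. intros H; exact (AndE1 (AndE2 (AndE2 (AndE2 H)))). Qed.
Lemma Best_dead2 G a w q e : (G ⊩ Best a w q e) -> G ⊩ Dead a w w (succ q) K.
Proof. intros H; exact (AndE2 (AndE2 (AndE2 (AndE2 H)))). Qed.

Lemma Best_max G a w q e q' : (G ⊩ Best a w q e) -> (G ⊩ Alive a w w q' K) -> G ⊩ q' <= q.
Proof.
intros H A; pose proof (lt_or_le G q q') as D; dor D; auto.
apply BotE, (Alive_not_Dead (Alive_mono A (lt_succ_le D) (le_refl _ _)) (Best_dead2 H)).
Qed.
Lemma Best_fun_q G a w q e q' e' : (G ⊩ Best a w q e) -> (G ⊩ Best a w q' e') -> G ⊩ q == q'.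
Proof.
intros H H'; apply le_antisym.
- apply (Best_max H'), (Alive_mono (Best_alive H) (le_refl _ _)), lt_succ_le, (Best_lt H).
- apply (Best_max H), (Alive_mono (Best_alive H') (le_refl _ _)), lt_succ_le, (Best_lt H').
Qed.
Lemma Best_fun_le G a w q e e' : (G ⊩ Best a w q e) -> (G ⊩ Best a w q e') -> G ⊩ e' <= e.
Proof.
intros H H'; pose proof (lt_or_le G e e') as D; dor D; auto.
apply BotE, (Alive_not_Dead (Alive_mono (Best_alive H) (le_refl _ _) (lt_succ_le D))
  (Best_dead1 H')).
Qed.
Lemma Best_fun_e G a w q e q' e' : (G ⊩ Best a w q e) -> (G ⊩ Best a w q' e') -> G ⊩ e == e'.
Proof.
intros H H'; pose proof (Best_fun_q H H') as E; rwlin E H'.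
apply le_antisym; [exact (Best_fun_le H' H)|exact (Best_fun_le H H')].
Qed.

(** From some stage on the colors below [e] are dead, so a candidate with color below [succ e] has
    color [e]. *)
Lemma Best_wit G a w q e t r : (G ⊩ Best a w q e) ->
  (forall G', incl G G' -> forall y, (G' ⊩ t <= y) -> (G' ⊩ Thr a w y) -> (G' ⊩ col a w y == e) ->
    (G' ⊩ Good a t w q y) -> G' ⊩ r) -> G ⊩ r.
Proof.
intros H HR; apply (Dead_e (Best_dead1 H)); intros G' HG s Hw Hs; wk HG.
pose proof (ub2 G s t) as U; dex U n; dand U U2.
apply (Alive_e (s:=n) (Best_alive H)); intros G' HG y E1 E2 E3 E4; wk HG.
apply (HR _ (incl_refl _) y); auto; [exact (le_trans U2 E1)| |exact (Good_le E4 U2)].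
apply lt_succ_cases in E3; dor E3; auto; apply BotE.
apply (Hs _ (incl_refl _) n y); auto; exact (le_trans U E1).
Qed.

(** A late node [t] of another color is beaten by a witness [y > t] of color [e]: the threshold of
    [y] at [w] is at least [q], that of [t] is at most [q], and [t] can reach [q] only with a color
    above [e]. *)
Lemma Best_kill G a w q e r : (G ⊩ is_coloring c k a) -> (G ⊩ Best a w q e) ->
  (forall G', incl G G' -> forall s, (forall G2, incl G' G2 -> forall t, (G2 ⊩ s <= t) ->
    (G2 ⊩ isnode a t) -> (G2 ⊩ Thr a w t) -> G2 ⊩ col a w t == e) -> G' ⊩ r) -> G ⊩ r.
Proof.
intros HC H HR; apply (Dead_e (Best_dead1 H)); intros G' HG s1 _ H1; wk HG.
apply (Dead_e (Best_dead2 H)); intros G' HG s2 _ H2; wk HG.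
pose proof (ub2 G s1 s2) as U; dex U s; dand U U2.
apply (HR _ (incl_refl _) s); intros G' HG t K1 K2 K3; wk HG.
pose proof (eq_dec G (col a w t) e) as D; dor D; auto; apply BotE.
apply (Best_wit (t:=succ t) H); intros G' HG y E1 E2 E3 E4; wk HG.
apply (@node_best L c G a t y w q); auto.
- exact (lt_S_inv E1).
- ii E; apply (imp_e D); exact (eq_trans_ (eq_sym_ E) E3).
- exact (le_trans (AndE1 H) (lt_le (Thr_lt K3))).
- exact (Good_le E4 (le_S _ _)).
- ii E; apply (H2 _ (incl_refl _) t t); auto; try exact (le_trans U2 K1).
  exact (col_lt HC (Thr_lt K3)).
- ii E; rw E3; pose proof (lt_trich G (col a w t) e) as T; dor T; [|dor T; auto].
  + apply BotE, (H1 _ (incl_refl _) t t); auto; exact (le_trans U K1).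
  + apply BotE, (imp_e D T).
Qed.

(** With a threshold below [q], the node [t] would be beaten by a later witness of the best
    color. *)
Lemma Best_Good G a w q e t : (G ⊩ Best a w q e) -> (G ⊩ isnode a t) -> (G ⊩ Thr a w t) ->
  (G ⊩ ¬ col a w t == e) -> G ⊩ Good a t w q t.
Proof.
intros H K2 K3 D; pose proof (dec_Good c a q t (lt_le (Thr_lt K3))) as C; dor C; auto.
apply BotE, (Best_wit (t:=succ t) H); intros G' HG y E1 E2 E3 E4; wk HG.
apply (@node_best L c G a t y w q); auto.
- exact (lt_S_inv E1).
- ii E; apply (imp_e D); exact (eq_trans_ (eq_sym_ E) E3).
- exact (le_trans (AndE1 H) (lt_le (Thr_lt K3))).
- exact (Good_le E4 (le_S _ _)).
- ii E; apply (imp_e C); exact (Good_anti E (le_S _ _)).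
- ii E; apply BotE, (imp_e C E).
Qed.

(** Here [m'] is the parent of [u]. A number beyond [u] that leaves [m'] with the same color has the
    same colors as [u] along the whole path of [u]; so a node has at most one child of each
    color. *)
Lemma slot G a m' u y : (G ⊩ isnode a u) -> (G ⊩ Thr a m' u) -> (G ⊩ Thr a m' y) ->
  (forall G', incl G G' -> forall z, (G' ⊩ Thr a z u) -> G' ⊩ z <= m') ->
  (G ⊩ u < y) -> (G ⊩ col a m' y == col a m' u) -> G ⊩ Thr a u y.
Proof.
intros K1 K2 K3 K4 K5 K6; apply Thr_intro; auto; intros G' HG w K7; wk HG.
pose proof (K4 _ (incl_refl _) w K7) as K8; apply lt_succ_cases in K8; dor K8.
- pose proof (Thr_chain K7 K2 K8) as K9.
  exact (eq_trans_ (eq_sym_ (Thr_col K2 K9)) (Thr_col K3 K9)).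
- rw K8; now apply eq_sym_.
Qed.

Lemma Thr_0 G a y : (G ⊩ zero < y) -> G ⊩ Thr a zero y.
Proof.
intros H; apply Thr_intro; auto; [apply node_0|].
intros G' HG w K1; exact (nlt_0 _ (Thr_lt K1)).
Qed.

Lemma next_node G a x y r : (G ⊩ Thr a x y) ->
  (forall G', incl G G' -> forall z, (G' ⊩ z == y ∨ Thr a z y) -> (G' ⊩ Thr a x z) ->
    (forall G2, incl G' G2 -> forall u, (G2 ⊩ Thr a u z) -> G2 ⊩ u <= x) -> G' ⊩ r) -> G ⊩ r.
Proof.
intros H HR.
assert (S : schema (fun g z => g x < z ∧ (z == g y ∨ Thr (g a) z (g y)))) by schema_tac.
apply (least (t:=y) S); cbv beta.
- intros G' HG z; apply dec_and; [apply em_D0, D0_eq|].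
  apply dec_or; [apply eq_dec|apply dec_Thr].
- isplit; [exact (Thr_lt H)|il; apply eq_refl_].
- intros G' HG z _ K1 K2; wk HG; dand K1 K3; apply (HR _ (incl_refl _) z); auto.
  + dor K3; [now rw K3|exact (Thr_chain H K3 K1)].
  + intros G' HG u E; wk HG; pose proof (lt_or_le G x u) as D; dor D; auto.
    apply BotE, (K2 _ (incl_refl _) u (Thr_lt E)); isplit; auto; ir.
    dor K3; [now rwin K3 E|exact (Thr_trans E K3)].
Qed.

Lemma parent G a v r : (G ⊩ zero < v) ->
  (forall G', incl G G' -> forall m', (G' ⊩ Thr a m' v) ->
    (forall G2, incl G' G2 -> forall u, (G2 ⊩ Thr a u v) -> G2 ⊩ u <= m') -> G' ⊩ r) -> G ⊩ r.
Proof.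
intros H HR.
assert (S : schema (fun g z => Thr (g a) z (g v))) by schema_tac.
apply (greatest (n:=v) S); cbv beta.
- intros; apply dec_Thr.
- intros G' HG m' K1 K2 K3; wk HG; apply (HR _ (incl_refl _) m'); auto.
  intros G' HG u E; wk HG; pose proof (lt_or_le G m' u) as D; dor D; auto.
  apply BotE, (K3 _ (incl_refl _) u); auto; exact (Thr_lt E).
- intros G' HG K1; wk HG; apply BotE, (K1 _ (incl_refl _) zero); auto; now apply Thr_0.
Qed.

Lemma Thr_same G a m' z y y' : (G ⊩ Thr a m' y) -> (G ⊩ Thr a m' y') -> (G ⊩ z < m') ->
  (G ⊩ Thr a z y) -> G ⊩ Thr a z y' ∧ col a z y == col a z y'.
Proof.
intros K1 K2 K3 K4; pose proof (Thr_chain K4 K1 K3) as K5; isplit; [exact (Thr_trans K5 K2)|].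
exact (eq_trans_ (eq_sym_ (Thr_col K1 K5)) (Thr_col K2 K5)).
Qed.

(** Moving the point of comparison further along the path removes obligations and admits more
    occurrences, so thresholds do not decrease. *)
Lemma Good_sub G a s w m' q y : (G ⊩ Good a s w q y) -> (G ⊩ w <= m') -> G ⊩ Good a s m' q y.
Proof.
intros H K1; dor H; [now il|apply Good_i]; intros G' HG z K2 K3 K4; wk HG.
ispec H z; imp H K2; impg H; [exact (le_trans K1 K3)|]; imp H K4.
dex H x; dand H H2; iex x; isplit; auto; exact (lt_le_trans H K1).
Qed.

(** The paths of [y] and [y'] coincide up to [m']. A color used by [y] from [m'] on has an
    occurrence above [m']; if that one is not above [w], the threshold of [y'] provides another one
    which is. *)
Lemma Good_compose G a s w m' q y y' : (G ⊩ Thr a m' y) -> (G ⊩ Thr a m' y') -> (G ⊩ w <= m') ->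
  (G ⊩ Good a m' w q y') -> (G ⊩ Good a s m' q y) -> G ⊩ Good a s w q y.
Proof.
intros K1 K2 K3 H1 H2; pose proof (eq_dec G q zero) as Q; dor Q; [now il|].
assert (P : forall G1, incl G G1 -> forall z, (G1 ⊩ z < m') -> (G1 ⊩ w <= z) -> (G1 ⊩ Thr a z y) ->
  G1 ⊩ bex w (fun x => up 1 q <= x ∧ Thr (up 1 a) x (up 1 y) ∧
      col (up 1 a) x (up 1 y) == col (up 1 a) (up 1 z) (up 1 y))).
{ intros G1 HG z E1 E2 E3; wk HG; pose proof (Thr_same K1 K2 E1 E3) as E4; dand E4 E5.
  pose proof (Good_col H1 Q E1 E2 E4) as E; dex E x; dand E E6; dand E6 E7; dand E7 E8.
  pose proof (Thr_same K2 K1 (lt_le_trans E K3) E7) as E9; dand E9 E10.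
  iex x; isplit; auto; isplit; auto; isplit; auto.
  exact (eq_trans_ (eq_sym_ E10) (eq_trans_ E8 (eq_sym_ E5))). }
apply Good_i; intros G' HG z E1 E2 E3; wk HG.
pose proof (lt_or_le G z m') as D; dor D; [now apply (P _ (incl_refl _))|].
pose proof (Good_col H2 Q E1 D E3) as E; dex E x; dand E E6; dand E6 E7; dand E7 E8.
pose proof (lt_or_le G x w) as D2; dor D2.
- iex x; isplit; auto; isplit; auto; isplit; auto.
- pose proof (P _ (incl_refl _) x E D2 E7) as F; dex F x'; dand F F2; dand F2 F3; dand F3 F4.
  iex x'; isplit; auto; isplit; auto; isplit; auto; exact (eq_trans_ F4 E8).
Qed.

Lemma onbr_node G a x : (G ⊩ onbr a x) -> G ⊩ isnode a x.
Proof. apply AndE1. Qed.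
Lemma onbr_alive G a x : (G ⊩ onbr a x) -> G ⊩ Alive a x x zero K.
Proof. intros H; exact (AndE1 (AndE2 H)). Qed.
Lemma onbr_best G a x w r : (G ⊩ onbr a x) -> (G ⊩ Thr a w x) ->
  (forall G', incl G G' -> forall q, (G' ⊩ Best a w q (col a w x)) -> (G' ⊩ Alive a x w q K) ->
     G' ⊩ r) -> G ⊩ r.
Proof.
intros H K1 HR; apply AndE2, AndE2 in H; ispec H w; impg H; [exact (Thr_lt K1)|].
imp H K1; dex H q; dand H H2; now apply (HR _ (incl_refl _) q).
Qed.

Lemma Alive_below G a x w m' q e : (G ⊩ is_coloring c k a) ->
  (G ⊩ Alive a x w q e) -> (G ⊩ Thr a m' x) -> G ⊩ Alive a m' w q K.
Proof.
intros HC H K1; apply Alive_i; intros G' HG s; wk HG.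
apply (Alive_e (s:=s) H); intros G' HG y E1 E2 E3 E4; wk HG.
pose proof (Thr_trans K1 E2) as K2.
iex y; isplit; auto; isplit; auto; isplit; auto; exact (col_lt HC (Thr_lt K2)).
Qed.

Lemma onbr_0 G a : (G ⊩ is_coloring c k a) -> G ⊩ onbr a zero.
Proof.
intros HC; isplit; [apply node_0|isplit].
- apply Alive_i; intros G' HG s; wk HG; iex (succ s); isplit; [apply le_S|].
  pose proof (Thr_0 a (lt_0_S G s)) as K1.
  isplit; auto; isplit; [exact (col_lt HC (Thr_lt K1))|apply Good_0].
- ii w K1; exact (nlt_0 _ K1).
Qed.

Lemma onbr_down G a x w : (G ⊩ is_coloring c k a) -> (G ⊩ onbr a x) -> (G ⊩ Thr a w x) ->
  G ⊩ onbr a w.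
Proof.
intros HC H K1; isplit; [exact (Thr_node K1)|isplit].
- pose proof (Alive_below HC (onbr_alive H) K1) as A.
  apply Alive_i; intros G' HG s; wk HG.
  apply (Alive_e (s:=s) A); intros G' HG y E1 E2 E3 E4; wk HG.
  iex y; isplit; auto; isplit; auto; isplit; auto; apply Good_0.
- ii w' K2 K3; apply (onbr_best H (Thr_trans K3 K1)); intros G' HG q E1 E2; wk HG.
  iex q; isplit.
  + now rw (Thr_col K1 K3).
  + exact (Alive_below HC E2 K1).
Qed.

(** Surviving thresholds do not decrease along the branch: by [Good_sub], candidates through [m']
    that meet [q'] at [w] also meet it at [m']. *)
Lemma onbr_q G a m' w q e q' e' : (G ⊩ onbr a m') -> (G ⊩ Thr a w m') -> (G ⊩ Best a w q' e') ->
  (G ⊩ Best a m' q e) -> G ⊩ Alive a m' w q' K ∧ q' <= q.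
Proof.
intros H K1 K2 K3; apply (onbr_best H K1); intros G' HG q2 E1 E2; wk HG.
pose proof (Best_fun_q K2 E1) as E; rwlin E E2.
isplit; auto; apply (Best_max K3), Alive_i; intros G' HG s; wk HG.
apply (Alive_e (s:=s) E2); intros G' HG y F1 F2 F3 F4; wk HG.
iex y; isplit; auto; isplit; auto; isplit; auto; exact (Good_sub F4 (lt_le (Thr_lt K1))).
Qed.

Lemma onbr_step G a m' q e u : (G ⊩ is_coloring c k a) -> (G ⊩ onbr a m') -> (G ⊩ Best a m' q e) ->
  (G ⊩ isnode a u) -> (G ⊩ Thr a m' u) -> (G ⊩ col a m' u == e) ->
  (forall G', incl G G' -> forall z, (G' ⊩ Thr a z u) -> G' ⊩ z <= m') -> G ⊩ onbr a u.
Proof.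
intros HC H HB Hu K1 K2 K3.
(* By [slot], the late witnesses for the best color at [m'] all pass through [u]. *)
assert (W : forall G1, incl G G1 -> forall s r, (forall G', incl G1 G' -> forall y,
   (G' ⊩ s <= y) -> (G' ⊩ Thr a u y) -> (G' ⊩ Good a s m' q y) -> G' ⊩ r) -> G1 ⊩ r).
{ intros G1 HG s r HR; wk HG; pose proof (ub2 G s (succ u)) as U; dex U n; dand U U2.
  apply (Best_wit (t:=n) HB); intros G' HG y E1 E2 E3 E4; wk HG.
  apply (HR _ (incl_refl _) y).
  - exact (le_trans U E1).
  - apply (slot Hu K1 E2); auto; [exact (lt_le_trans (lt_S_inv U2) E1)|].
    exact (eq_trans_ E3 (eq_sym_ K2)).
  - exact (Good_le E4 U). }
isplit; auto; isplit.
- apply Alive_i; intros G' HG s; wk HG; apply (W _ (incl_refl _) s).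
  intros G' HG y E1 E2 E3; wk HG; iex y; isplit; auto; isplit; auto.
  isplit; [exact (col_lt HC (Thr_lt E2))|apply Good_0].
- ii w K4 K5; pose proof (K3 _ (incl_refl _) w K5) as K6; apply lt_succ_cases in K6; dor K6.
  + pose proof (Thr_chain K5 K1 K6) as K7.
    apply (onbr_best H K7); intros G' HG q' E1 E2; wk HG.
    pose proof (AndE2 (onbr_q H K7 E1 HB)) as Q.
    iex q'; isplit; [now rwl (Thr_col K1 K7)|].
    apply Alive_i; intros G' HG s; wk HG; apply (W _ (incl_refl _) s).
    intros G' HG y F1 F2 F3; wk HG; iex y; isplit; auto; isplit; auto.
    isplit; [exact (col_lt HC (Thr_lt F2))|].
    (* [y'] vouches for the common path up to [m'], and [y] for the rest. *)
    apply (Alive_e (s:=m') E2); intros G' HG y' D1 D2 D3 D4; wk HG.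
    exact (Good_compose (Thr_trans K1 F2) D2 (lt_le K6) D4 (Good_anti F3 Q)).
  + iex q; isplit.
    * rw K6; now rw K2.
    * rw K6; apply Alive_i; intros G' HG s; wk HG; apply (W _ (incl_refl _) s).
      intros G' HG y E1 E2 E3; wk HG; iex y; isplit; auto; isplit; auto.
      isplit; auto; exact (col_lt HC (Thr_lt E2)).
Qed.
End Branch.

#[export] Hint Rewrite subst_Best subst_onbr : ha.

(** * Existence, uniqueness and thresholds of the branch *)

Section Limit.
Variable L : signature.
Variable c : fsym L 3.
Variable k : nat.
Implicit Types (s t u a b A j x y z w v m n q e : term L) (p r : form L) (G : list (form L)).
Notation col := (color c).
Notation Thr := (Thr c).
Notation Good := (Good c).
Notation isnode := (isnode c).
Notation Alive := (Alive c).
Notation Dead := (Dead c).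
Notation Best := (Best c k).
Notation onbr := (onbr c k).
Notation K := (@num L k).

(* From stage [s] on, no candidate beats those that leave [w] with color [e]. *)
Definition wins a w s e : form L :=
  ex1 (fun q => Best (up 1 a) (up 1 w) q (up 1 e) ∧ all1 (fun y => up 2 s <= y ⇒
    Thr (up 2 a) (up 2 w) y ⇒ ¬ Good (up 2 a) (up 2 s) (up 2 w) (succ (up 1 q)) y ∧
     (col (up 2 a) (up 2 w) y < up 2 e ⇒ ¬ Good (up 2 a) (up 2 s) (up 2 w) (up 1 q) y))).
Lemma subst_wins f a w s e : subst f (wins a w s e) =
  wins (tsubst f a) (tsubst f w) (tsubst f s) (tsubst f e).
Proof. unfold wins; substtac. Qed.
Hint Rewrite subst_wins : ha.
#[local] Instance wins_proper G :
  Proper (teq G ==> teq G ==> teq G ==> teq G ==> fle G) wins.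
Proof. apply natural4_proper; intro; apply subst_wins. Qed.

Lemma wins_mono G a w s s' e : (G ⊩ wins a w s e) -> (G ⊩ s <= s') -> G ⊩ wins a w s' e.
Proof.
intros H H2; dex H q; dand H H3; iex q; isplit; auto; ii y K1 K2.
ispec H3 y; impg H3; [exact (le_trans H2 K1)|]; imp H3 K2; dand H3 H4; isplit.
- ii E; apply (imp_e H3); exact (Good_le E H2).
- ii E1 E; imp H4 E1; apply (imp_e H4); exact (Good_le E H2).
Qed.

Lemma wins_ex G a w q e r : (G ⊩ is_coloring c k a) -> (G ⊩ Best a w q e) ->
  (forall G', incl G G' -> forall s, (G' ⊩ wins a w s e) -> G' ⊩ r) -> G ⊩ r.
Proof.
intros HC H HR; apply (Dead_e (Best_dead1 H)); intros G' HG s1 _ H1; wk HG.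
apply (Dead_e (Best_dead2 H)); intros G' HG s2 _ H2; wk HG.
pose proof (ub2 G s1 s2) as U; dex U s; dand U U2.
apply (HR _ (incl_refl _) s); iex q; isplit; auto; ii y K1 K2; isplit.
- ii E; apply (H2 _ (incl_refl _) s y); auto; [exact (le_trans U2 K1)|].
  exact (col_lt HC (Thr_lt K2)).
- ii E1 E; apply (H1 _ (incl_refl _) s y); auto; exact (le_trans U K1).
Qed.

(** Since [wins] is monotone in the stage, an induction collects the stages of the finitely many
    nodes above [v] into one. *)
Lemma wins_all G a v r : (G ⊩ is_coloring c k a) -> (G ⊩ onbr a v) ->
  (forall G', incl G G' -> forall s, (forall G2, incl G' G2 -> forall w, (G2 ⊩ Thr a w v) ->
    G2 ⊩ wins a w s (col a w v)) -> G' ⊩ r) -> G ⊩ r.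
Proof.
intros HC H HR.
assert (E : G ⊩ v <= v ⇒ ex1 (fun s => ball (up 1 v) (fun w => Thr (up 2 a) w (up 2 v) ⇒
   wins (up 2 a) w (up 1 s) (col (up 2 a) w (up 2 v))))).
{ iinduction (fun g m => m <= g v ⇒ ex1 (fun s => ball (up 1 m) (fun w =>
    Thr (up 2 (g a)) w (up 2 (g v)) ⇒
     wins (up 2 (g a)) w (up 1 s) (col (up 2 (g a)) w (up 2 (g v)))))) v.
  - ii K1; iex (@zero L); ii w K2; exact (nlt_0 _ K2).
  - ii K1; impg IH; [now apply lt_S_inv, lt_S in K1|]; dex IH s.
    assert (N : forall G1, incl G G1 -> forall s', (G1 ⊩ s <= s') ->
      (G1 ⊩ Thr a n v ⇒ wins a n s' (col a n v)) ->
      G1 ⊩ ex1 (fun s => ball (up 1 (succ n)) (fun w => Thr (up 2 a) w (up 2 v) ⇒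
        wins (up 2 a) w (up 1 s) (col (up 2 a) w (up 2 v))))).
    { intros G1 HG s' S1 S3; wk HG.
      iex s'; ii w K2 K3; apply lt_succ_cases in K2; dor K2.
      - ispec IH w; imp IH K2; imp IH K3; exact (wins_mono IH S1).
      - rwin K2 K3; imp S3 K3; now rw K2. }
    simp in N; simp; pose proof (dec_Thr c G a n v) as D; dor D.
    + apply (onbr_best H D); intros G' HG q E1 E2; wk HG.
      apply (wins_ex HC E1); intros G' HG s1 W; wk HG.
      pose proof (ub2 G s s1) as U; dex U s'; dand U U2.
      apply (N _ (incl_refl _) s'); auto; ii _K; exact (wins_mono W U2).
    + apply (N _ (incl_refl _) s); [apply le_refl|].
      ii K2; apply BotE, (imp_e D K2). }
impg E; [apply le_refl|]; dex E s; apply (HR _ (incl_refl _) s).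
intros G' HG w K1; wk HG; ispec E w; impg E; [exact (Thr_lt K1)|]; exact (imp_e E K1).
Qed.

Lemma Good_late G a s s' w q y : (G ⊩ Good a s w q y) ->
  (forall G', incl G G' -> forall z, (G' ⊩ Thr a z y) -> G' ⊩ z < s) -> G ⊩ Good a s' w q y.
Proof.
intros H HZ; dor H; [now il|ir]; ii z K1 K2 K3; ispec H z.
impg H; [now apply (HZ _ (incl_refl _))|]; imp H K2; exact (imp_e H K3).
Qed.

(** The last three premises say that [y'] beats [y] at [w]. If [q < q'], or if [q = q'] and the
    color decides, then [y'] is excluded from stage [s] on; if [q' < q], then [y] exceeds [q']. *)
Lemma wins_no_better G a w s q e q' y y' : (G ⊩ Best a w q e) -> (G ⊩ wins a w s e) ->
  (G ⊩ s <= y) -> (G ⊩ y < y') -> (G ⊩ Thr a w y') -> (G ⊩ col a w y == e) ->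
  (G ⊩ Good a y w q y) -> (G ⊩ Good a y w q' y') -> (G ⊩ ¬ Good a y w (succ q') y) ->
  (G ⊩ Good a y w q' y ⇒ col a w y' < col a w y) -> G ⊩ Bot.
Proof.
intros HB HW K1 K2 K3 K4 K5 K6 K7 K8; dex HW q2; dand HW HW2.
pose proof (Best_fun_q HW HB) as E; ispec HW2 y'; rwin E HW2; impg HW2; [exact (le_trans K1 (lt_le K2))|]; imp HW2 K3; dand HW2 HW3.
pose proof (lt_trich G q q') as D; dor D; [|dor D].
- apply (imp_e HW2); exact (Good_le (Good_anti K6 (lt_succ_le D)) K1).
- rwlin D K6; rwlin D K8; imp K8 K5; impg HW3; [now rwin K4 K8|].
  apply (imp_e HW3); exact (Good_le K6 K1).
- apply (imp_e K7); exact (Good_anti K5 (lt_succ_le D)).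
Qed.

(** Let [y] be a candidate with the best color at [v], beyond the stages at which the best colors
    win at [v] and at all nodes above it. If some node below [y] leaves [v] with that color, the
    least one continues the branch. Otherwise the path of [y] ends at [v], and [y] itself becomes a
    node because nothing beats it. *)
Lemma onbr_next G a v r : (G ⊩ is_coloring c k a) -> (G ⊩ onbr a v) ->
  (forall G', incl G G' -> forall u, (G' ⊩ onbr a u) -> (G' ⊩ Thr a v u) -> G' ⊩ r) -> G ⊩ r.
Proof.
intros HC H HR; apply (Best_ex (onbr_alive H)); intros G' HG q e HB; wk HG.
apply (wins_ex HC HB); intros G' HG s1 W1; wk HG.
apply (wins_all HC H); intros G' HG s2 W2; wk HG.
pose proof (ub2 G s1 s2) as U; dex U s0; dand U U2.
pose proof (ub2 G s0 (succ v)) as U3; dex U3 s; dand U3 U4.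
pose proof (wins_mono W1 (le_trans U U3)) as W1'; clear W1.
apply (Best_wit (t:=s) HB); intros G' HG y E1 E2 E3 E4; wk HG.
assert (S : schema (fun g u => isnode (g a) u ∧ Thr (g a) (g v) u ∧ col (g a) (g v) u == g e))
  by schema_tac.
assert (SD : forall G1, incl G G1 -> forall u, G1 ⊩ (isnode a u ∧ Thr a v u ∧ col a v u == e) ∨
   ¬ (isnode a u ∧ Thr a v u ∧ col a v u == e)).
{ intros G1 HG u; wk HG; apply dec_and; [apply dec_node|].
  apply dec_and; [apply dec_Thr|apply em_D0, D0_eq]. }
apply (bounded_em (n:=y) S); cbv beta; [now auto| |].
- intros G' HG u0 _ F; wk HG.
  apply (least (t:=u0) S); cbv beta; [now auto|now auto|].
  intros G' HG u _ F1 F2; wk HG; dand F1 F3; dand F3 F4.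
  apply (HR _ (incl_refl _) u); auto; apply (onbr_step HC H HB F1 F3 F4).
  intros G' HG z K1; wk HG; pose proof (lt_or_le G v z) as D; dor D; auto.
  apply BotE, (F2 _ (incl_refl _) z (Thr_lt K1)); isplit; [exact (Thr_node K1)|].
  pose proof (Thr_chain F3 K1 D) as K2; isplit; auto.
  exact (eq_trans_ (Thr_col K1 K2) F4).
- intros G' HG N; wk HG.
  assert (Z : forall G1, incl G G1 -> forall z, (G1 ⊩ Thr a z y) -> G1 ⊩ z <= v).
  { intros G1 HG z K1; wk HG; pose proof (lt_or_le G v z) as D; dor D; auto.
    apply BotE, (N _ (incl_refl _) z (Thr_lt K1)); isplit; [exact (Thr_node K1)|].
    pose proof (Thr_chain E2 K1 D) as K2; isplit; auto.
    exact (eq_trans_ (Thr_col K1 K2) E3). }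
  assert (Z2 : forall G1, incl G G1 -> forall z, (G1 ⊩ Thr a z y) -> G1 ⊩ z < s).
  { intros G1 HG z K1; wk HG; apply (le_lt_trans (Z _ (incl_refl _) z K1)).
    exact (lt_S_inv U4). }
  assert (Hy : G ⊩ isnode a y).
  (* A better [y'] parts from [y] at some [w <= v], where the choice of [s] excludes it. *)
  { apply isnode_intro; intros G' HG y' w q' K1 K2 K3 K4 K5 K6 K7 K8; wk HG.
    pose proof (Z _ (incl_refl _) w K4) as D; apply lt_succ_cases in D; dor D.
    - pose proof (Thr_chain K4 E2 D) as K9.
      apply (onbr_best H K9); intros G' HG q2 B1 B2; wk HG.
      pose proof (onbr_q H K9 B1 HB) as Q; apply AndE2 in Q.
      pose proof (W2 _ (incl_refl _) w K9) as W3.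
      apply (wins_no_better (s:=s) (y:=y) (y':=y') (q':=q') B1); auto.
      + exact (wins_mono W3 (le_trans U2 U3)).
      + exact (eq_sym_ (Thr_col E2 K9)).
      + apply (Good_late (s:=s)); auto.
        apply (Alive_e (s:=v) B2); intros G' HG y2 D1 D2 D3 D4; wk HG.
        exact (Good_compose E2 D2 (lt_le D) D4 (Good_anti E4 Q)).
    - rwin D K3; rwin D K6; rwin D K7; rwin D K8.
      apply (wins_no_better (s:=s) (y:=y) (y':=y') (q':=q') HB); auto.
      apply (Good_late (s:=s)); auto. }
  apply (HR _ (incl_refl _) y); auto; exact (onbr_step HC H HB Hy E2 E3 Z).
Qed.

Lemma onbr_unbounded G a n r : (G ⊩ is_coloring c k a) ->
  (forall G', incl G G' -> forall x, (G' ⊩ onbr a x) -> (G' ⊩ n < x) -> G' ⊩ r) -> G ⊩ r.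
Proof.
intros HC HR.
enough (E : G ⊩ ex1 (fun x => onbr (up 1 a) x ∧ up 1 n < x)).
{ dex E x; dand E E2; now apply (HR _ (incl_refl _) x). }
iinduction (fun g n => ex1 (fun x => onbr (up 1 (g a)) x ∧ up 1 n < x)) n.
- apply (onbr_next HC (onbr_0 HC)); intros G' HG u K1 K2; wk HG.
  iex u; isplit; auto; exact (Thr_lt K2).
- dex IH x; dand IH IH2; apply (onbr_next HC IH); intros G' HG u K1 K2; wk HG.
  iex u; isplit; auto; exact (le_lt_trans (lt_succ_le IH2) (Thr_lt K2)).
Qed.

(** Wherever their paths meet, both take the best color, and that color is unique. *)
Lemma onbr_total G a x y : (G ⊩ is_coloring c k a) -> (G ⊩ onbr a x) -> (G ⊩ onbr a y) ->
  (G ⊩ x < y) -> G ⊩ Thr a x y.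
Proof.
intros HC H Hy H3; revert H3; apply imp_e; revert H; apply imp_e.
sinduction (fun g x => onbr (g a) x ⇒ x < g y ⇒ Thr (g a) x (g y)) x.
ii K1 K2; apply Thr_intro; auto; [exact (onbr_node K1)|].
intros G' HG w K3; wk HG; pose proof (IH _ (incl_refl _) w (Thr_lt K3)) as I.
imp I (onbr_down HC K1 K3); impg I; [exact (lt_trans (Thr_lt K3) K2)|].
apply (onbr_best K1 K3); intros G' HG q E1 E2; wk HG.
apply (onbr_best Hy I); intros G' HG q' E3 E4; wk HG.
exact (Best_fun_e E1 E3).
Qed.

(** By induction late nodes pass through the parent of [v]; by [Best_kill] they leave it with the
    color of [v], and [slot] leads them through [v]. *)
Lemma onbr_late G a v r : (G ⊩ is_coloring c k a) -> (G ⊩ onbr a v) ->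
  (forall G', incl G G' -> forall s, (forall G2, incl G' G2 -> forall t, (G2 ⊩ s <= t) ->
    (G2 ⊩ isnode a t) -> G2 ⊩ Thr a v t) -> G' ⊩ r) -> G ⊩ r.
Proof.
intros HC H HR.
enough (E : G ⊩ onbr a v ⇒ ex1 (fun s => all1 (fun t => up 1 s <= t ⇒ isnode (up 2 a) t ⇒
   Thr (up 2 a) (up 2 v) t))).
{ imp E H; dex E s; apply (HR _ (incl_refl _) s); intros G' HG t K1 K2; wk HG.
  ispec E t; imp E K1; exact (imp_e E K2). }
clear H HR.
sinduction (fun g v => onbr (g a) v ⇒ ex1 (fun s => all1 (fun t => up 1 s <= t ⇒
  isnode (up 2 (g a)) t ⇒ Thr (up 2 (g a)) (up 2 v) t))) v.
clear v; rename n into v; ii H.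
pose proof (lt_or_le G zero v) as D; dor D.
- apply (parent (c:=c) (a:=a) D); intros G' HG m K1 K2; wk HG.
  pose proof (IH _ (incl_refl _) m (Thr_lt K1)) as I; imp I (onbr_down HC H K1); dex I s1.
  apply (onbr_best H K1); intros G' HG q E1 E2; wk HG.
  apply (Best_kill HC E1); intros G' HG s2 E3; wk HG.
  pose proof (ub2 G s1 s2) as U; dex U s0; dand U U2.
  pose proof (ub2 G s0 (succ v)) as U3; dex U3 s; dand U3 U4.
  iex s; ii t F1 F2; ispec I t; impg I; [exact (le_trans (le_trans U U3) F1)|]; imp I F2.
  apply (slot (onbr_node H) K1 I); auto.
  + exact (lt_le_trans (lt_S_inv U4) F1).
  + apply (E3 _ (incl_refl _)); auto; exact (le_trans (le_trans U2 U3) F1).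
- assert (E : G ⊩ v == zero) by (apply le_antisym; auto; apply le_0).
  iex (succ (@zero L)); ii t K1 K2; rw E; apply Thr_0; exact (lt_S_inv K1).
Qed.

(** At the first departure from the best color, [Best_kill] cuts off all late nodes. This decides
    [onbr] on nodes, although [EM2] does not apply to that formula directly. *)
Lemma node_em G a v : (G ⊩ is_coloring c k a) -> (G ⊩ isnode a v) ->
  G ⊩ onbr a v ∨ ex1 (fun s => all1 (fun t => up 1 s <= t ⇒ isnode (up 2 a) t ⇒
   ¬ Thr (up 2 a) (up 2 v) t)).
Proof.
intros HC; apply imp_e.
sinduction (fun g v => isnode (g a) v ⇒ onbr (g a) v ∨ ex1 (fun s => all1 (fun t => up 1 s <= t ⇒
  isnode (up 2 (g a)) t ⇒ ¬ Thr (up 2 (g a)) (up 2 v) t))) v.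
clear v; rename n into v; ii H.
pose proof (lt_or_le G zero v) as D; dor D.
- apply (parent (c:=c) (a:=a) D); intros G' HG m K1 K2; wk HG.
  pose proof (IH _ (incl_refl _) m (Thr_lt K1)) as I; imp I (Thr_node K1); dor I.
  + apply (Best_ex (onbr_alive I)); intros G' HG q e E1; wk HG.
    pose proof (eq_dec G (col a m v) e) as Q; dor Q.
    * il; exact (onbr_step HC I E1 H K1 Q K2).
    * ir; apply (Best_kill HC E1); intros G' HG s E3; wk HG.
      iex s; ii t F1 F2 F3; apply (imp_e Q).
      apply (eq_trans_ (Thr_col F3 K1)), (E3 _ (incl_refl _)); auto; exact (Thr_trans K1 F3).
  + ir; dex I s; iex s; ii t F1 F2 F3; ispec I t; imp I F1; imp I F2.
    apply (imp_e I); exact (Thr_trans K1 F3).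
- il; assert (E : G ⊩ v == zero) by (apply le_antisym; auto; apply le_0).
  rw E; exact (onbr_0 HC).
Qed.

Lemma bounded_not_onbr G a v : (G ⊩ is_coloring c k a) ->
  (G ⊩ ex1 (fun s => all1 (fun t => up 1 s <= t ⇒ isnode (up 2 a) t ⇒
   ¬ Thr (up 2 a) (up 2 v) t))) -> (G ⊩ onbr a v) -> G ⊩ Bot.
Proof.
intros HC H K1; dex H s; pose proof (ub2 G s v) as U; dex U n; dand U U2.
apply (onbr_unbounded (n:=n) HC); intros G' HG x E1 E2; wk HG.
ispec H x; impg H; [exact (le_trans U (lt_le E2))|]; imp H (onbr_node E1).
apply (imp_e H), (onbr_total HC K1 E1); exact (le_lt_trans U2 E2).
Qed.

Lemma dec_onbr G a v : (G ⊩ is_coloring c k a) -> (G ⊩ isnode a v) ->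
  G ⊩ onbr a v ∨ ¬ onbr a v.
Proof.
intros HC H; pose proof (node_em HC H) as D; dor D; [now il|ir].
ii E; exact (bounded_not_onbr HC D E).
Qed.

(** The surviving threshold binds nodes off the branch as well. Such a [t] leaves the branch at its
    last branch point [w], against the best color, so [Best_Good] applies at [w]; thresholds do not
    decrease from [v] to [w], and [Good_compose] carries the bound back to [v]. *)
Lemma onbr_Good G a v q e t : (G ⊩ is_coloring c k a) -> (G ⊩ onbr a v) -> (G ⊩ Best a v q e) ->
  (G ⊩ isnode a t) -> (G ⊩ Thr a v t) -> G ⊩ Good a t v q t.
Proof.
intros HC Hv HB Ht H; pose proof (dec_onbr HC Ht) as D; dor D.
{ apply (onbr_best D H); intros G' HG q' E1 E2; wk HG.
  pose proof (Best_fun_q HB E1) as E; rwlin E E2.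
  apply (Alive_e (s:=t) E2); intros G' HG y F1 F2 F3 F4; wk HG.
  pose proof (eq_dec G q zero) as Q; dor Q; [now il|apply Good_i].
  intros G' HG z K1 K2 K3; wk HG.
  pose proof (Good_col F4 Q K1 K2 (Thr_trans K3 F2)) as X; dex X x; dand X X2.
  dand X2 X3; dand X3 X4; pose proof (Thr_chain X3 F2 (lt_trans X (Thr_lt H))) as X5.
  iex x; isplit; auto; isplit; auto; isplit; auto.
  exact (eq_trans_ (Thr_col F2 X5) (eq_trans_ X4 (eq_sym_ (Thr_col F2 K3)))). }
assert (S : schema (fun g z => Thr (g a) z (g t) ∧ onbr (g a) z)) by schema_tac.
apply (greatest (n:=t) S); cbv beta.
- intros G' HG z K1; wk HG; pose proof (dec_Thr c G a z t) as C; dor C.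
  + apply dec_and; [now il|exact (dec_onbr HC (Thr_node C))].
  + ir; ii X; apply (imp_e C); exact (AndE1 X).
- intros G' HG w K1 K2 K3; wk HG; dand K2 K4.
  apply (Best_ex (onbr_alive K4)); intros G' HG qw ew B; wk HG.
  (* With the best color at [w], the next node of the path would be on the branch: it would be a
     later branch point than [w], or [t] itself. *)
  assert (N : G ⊩ ¬ col a w t == ew).
  { ii E; apply (next_node K2); intros G' HG u U1 U2 U3; wk HG.
    assert (Hu : G ⊩ isnode a u).
    { dor U1; [now rw U1|exact (Thr_node U1)]. }
    assert (U4 : G ⊩ onbr a u).
    { apply (onbr_step HC K4 B Hu U2); auto.
      dor U1; [now rw U1|exact (eq_trans_ (Thr_col U1 U2) E)]. }
    dor U1; [apply (imp_e D); now rwin U1 U4|].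
    apply (K3 _ (incl_refl _) u (Thr_lt U2) (Thr_lt U1)); now isplit. }
  pose proof (Best_Good B Ht K2 N) as Gw.
  pose proof (lt_trich G v w) as C; dor C; [|dor C].
  + pose proof (Thr_chain H K2 C) as Hw.
    pose proof (onbr_q K4 Hw HB B) as Q; dand Q Q2.
    apply (Alive_e (s:=w) Q); intros G' HG y' D1 D2 D3 D4; wk HG.
    exact (Good_compose K2 D2 (lt_le C) D4 (Good_anti Gw Q2)).
  + rwlin C B; rwlin C Gw; now rw (Best_fun_q HB B).
  + apply BotE, (K3 _ (incl_refl _) v C (Thr_lt H)); now isplit.
- intros G' HG K1; wk HG; apply BotE, (K1 _ (incl_refl _) v (Thr_lt H)); now isplit.
Qed.
End Limit.

(** * Recurrence of colors *)

Section Colors.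
Variable L : signature.
Variable c : fsym L 3.
Variable k : nat.
Implicit Types (s t u a b A x y z w v m n q e : term L) (p r : form L) (G : list (form L)).
Notation col := (color c).
Notation Thr := (Thr c).
Notation Good := (Good c).
Notation isnode := (isnode c).
Notation Best := (Best c k).
Notation onbr := (onbr c k).
Notation K := (@num L k).

(** The number of colors is a number of Rocq, so the count in [recurrence] can run over a list in
    Rocq instead of a coded set. *)
Lemma num_cases G x i r : (G ⊩ x < num i) ->
  (forall G', incl G G' -> forall j, (j < i)%nat -> (G' ⊩ x == num j) -> G' ⊩ r) -> G ⊩ r.
Proof.
revert G; induction i as [|i IH]; intros G H HR; [exact (nlt_0 _ H)|].
apply lt_succ_cases in H; dor H.
- apply (IH G H); intros G' HG j Hj E; apply (HR G' HG j); auto.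
- apply (HR _ (incl_refl _) i); auto.
Qed.

Definition chd a i x y : form L :=
  isnode a y ∧ Thr a x y ∧ col a x y == i ∧ all1 (fun z => Thr (up 1 a) z (up 1 y) ⇒ z <= up 1 x).
Lemma subst_chd f a i x y : subst f (chd a i x y) =
  chd (tsubst f a) (tsubst f i) (tsubst f x) (tsubst f y).
Proof. unfold chd; substtac. Qed.
Hint Rewrite subst_chd : ha.
Lemma chd_last G a i x y z : (G ⊩ chd a i x y) -> (G ⊩ Thr a z y) -> G ⊩ z <= x.
Proof. intros H; apply AndE2, AndE2, AndE2 in H; ispec H z; apply (imp_e H). Qed.

Lemma onbr_edge G a v x i r : (G ⊩ is_coloring c k a) -> (G ⊩ onbr a v) -> (G ⊩ Thr a x v) ->
  (G ⊩ col a x v == i) ->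
  (forall G', incl G G' -> forall y, (G' ⊩ onbr a x) -> (G' ⊩ onbr a y) -> (G' ⊩ chd a i x y) ->
     G' ⊩ r) -> G ⊩ r.
Proof.
intros HC H K1 K2 HR; apply (next_node K1); intros G' HG y D1 D2 D3; wk HG.
assert (Hy : G ⊩ onbr a y).
{ dor D1; [now rw D1|exact (onbr_down HC H D1)]. }
apply (HR _ (incl_refl _) y); auto; [exact (onbr_down HC H K1)|].
isplit; [exact (onbr_node Hy)|isplit; auto; isplit].
- apply eq_trans_ with (col a x v); auto.
  dor D1; [rw D1; apply eq_refl_|exact (Thr_col D1 D2)].
- ii z E; now apply (D3 _ (incl_refl _)).
Qed.

Definition occurs a n v h : form L := bex v (fun x => up 1 n < x ∧ Thr (up 1 a) x (up 1 v) ∧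
  col (up 1 a) x (up 1 v) == up 1 h).

Lemma dec_occurs G a n v h : G ⊩ occurs a n v h ∨ ¬ occurs a n v h.
Proof.
assert (S : schema (fun g x => g n < x ∧ Thr (g a) x (g v) ∧ col (g a) x (g v) == g h))
  by schema_tac.
apply (bounded_em (n:=v) S); cbv beta.
- intros G' HG x _; apply dec_and; [apply em_D0, D0_eq|].
  apply dec_and; [apply dec_Thr|apply em_D0, D0_eq].
- intros G' HG x H1 H2; il; iex x; now isplit.
- intros G' HG H; ir; ii H1; dex H1 x; dand H1 H2; now apply (H _ (incl_refl _) x).
Qed.

Lemma dec_cover G a v q u z :
  G ⊩ bex v (fun x => up 1 q <= x ∧ Thr (up 1 a) x (up 1 u) ∧
      col (up 1 a) x (up 1 u) == col (up 1 a) (up 1 z) (up 1 u)) ∨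
    ¬ bex v (fun x => up 1 q <= x ∧ Thr (up 1 a) x (up 1 u) ∧
      col (up 1 a) x (up 1 u) == col (up 1 a) (up 1 z) (up 1 u)).
Proof.
assert (S : schema (fun g x => g q <= x ∧ Thr (g a) x (g u) ∧
  col (g a) x (g u) == col (g a) (g z) (g u))) by schema_tac.
apply (bounded_em (n:=v) S); cbv beta.
- intros G' HG x _; apply dec_and; [apply em_D0, D0_eq|].
  apply dec_and; [apply dec_Thr|apply em_D0, D0_eq].
- intros G' HG x H1 H2; il; iex x; now isplit.
- intros G' HG H; ir; ii H1; dex H1 x; dand H1 H2; now apply (H _ (incl_refl _) x).
Qed.

Lemma not_Good G a s v q u r : (G ⊩ ¬ Good a s v q u) ->
  (forall G', incl G G' -> forall z, (G' ⊩ v <= z) -> (G' ⊩ Thr a z u) ->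
    (forall G2, incl G' G2 -> forall x, (G2 ⊩ x < v) -> (G2 ⊩ q <= x) -> (G2 ⊩ Thr a x u) ->
       (G2 ⊩ col a x u == col a z u) -> G2 ⊩ Bot) -> G' ⊩ r) -> G ⊩ r.
Proof.
intros H HR.
assert (S : schema (fun g z => g v <= z ∧ Thr (g a) z (g u) ∧
  ¬ bex (g v) (fun x => up 1 (g q) <= x ∧ Thr (up 1 (g a)) x (up 1 (g u)) ∧
      col (up 1 (g a)) x (up 1 (g u)) == col (up 1 (g a)) (up 1 z) (up 1 (g u))))) by schema_tac.
apply (bounded_em (n:=s) S); cbv beta.
- intros G' HG z _; apply dec_and; [apply em_D0, D0_eq|].
  apply dec_and; [apply dec_Thr|apply dec_neg, dec_cover].
- intros G' HG z _ H1; wk HG; dand H1 H2; dand H2 H3; apply (HR _ (incl_refl _) z); auto.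
  intros G' HG x D1 D2 D3 D4; wk HG; apply (imp_e H3); iex x; isplit; auto; isplit; auto.
  isplit; auto.
- intros G' HG H1; wk HG; apply BotE, (imp_e H), Good_i; intros G' HG z D1 D2 D3; wk HG.
  pose proof (dec_cover G a v q u z) as D; dor D; auto.
  apply BotE, (H1 _ (incl_refl _) z D1); isplit; auto; isplit; auto.
Qed.

(* [l] lists the colors that need not occur beyond [n] on the path of [v]. Each
   threshold reached below [n] forces a color of [l] to occur. *)
Lemma recurrence a n h r N : (h < k)%nat -> forall (l : list nat), (length l <= N)%nat ->
  forall G v, (G ⊩ is_coloring c k a) -> (G ⊩ onbr a v) -> (G ⊩ n < v) ->
  (forall G', incl G G' -> forall j, (j < k)%nat -> ~ List.In j l -> G' ⊩ occurs a n v (num j)) ->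
  (forall G', incl G G' -> forall m r', (forall G2, incl G' G2 -> forall x y, (G2 ⊩ m < y) ->
     (G2 ⊩ chd a (num h) x y) -> G2 ⊩ r') -> G' ⊩ r') ->
  (forall G', incl G G' -> forall x y, (G' ⊩ n < y) -> (G' ⊩ onbr a x) -> (G' ⊩ onbr a y) ->
     (G' ⊩ chd a (num h) x y) -> G' ⊩ r) -> G ⊩ r.
Proof.
intros Hh; induction N as [|N IH]; intros l Hl G v HC Hv Hn Hocc Hinf HR;
  (assert (found : forall G1, incl G G1 -> (G1 ⊩ occurs a n v (num h)) -> G1 ⊩ r);
   [intros G1 HG D; wk HG; dex D x; dand D D2; dand D2 D3; dand D3 D4;
    apply (onbr_edge HC Hv D3 D4); intros G' HG y E1 E2 E3; wk HG;
    apply (HR _ (incl_refl _) x y); auto;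
    exact (lt_trans D2 (Thr_lt (AndE1 (AndE2 E3))))|]).
- destruct l; [|simpl in Hl; lia].
  apply (found _ (incl_refl _)), (Hocc _ (incl_refl _)); auto.
- pose proof (dec_occurs G a n v (num h)) as D; dor D; [now apply (found _ (incl_refl _))|].
  apply (Best_ex (onbr_alive Hv)); intros G' HG q e HB; wk HG.
  pose proof (lt_or_le G n q) as C; dor C.
  (* If [n < q], a late edge of color [h] lies below [v], and by [onbr_Good] its color occurs above
     [v] at some [x' >= q], hence beyond [n], against [D]. *)
  + apply BotE, (onbr_late HC Hv); intros G' HG s Hs; wk HG.
    apply (Hinf _ (incl_refl _) s); intros G' HG x y E1 E2; wk HG.
    pose proof (AndE1 E2) as E3; pose proof (AndE1 (AndE2 E2)) as E4.
    pose proof (AndE1 (AndE2 (AndE2 E2))) as E5.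
    pose proof (Hs _ (incl_refl _) y (lt_le E1) E3) as E6.
    pose proof (Good_e (onbr_Good HC Hv HB E3 E6) (Thr_lt E4) (chd_last E2 E6) E4) as F.
    dor F; [rwin F C; exact (nlt_0 _ C)|].
    dex F x'; dand F F2; dand F2 F3; dand F3 F4.
    pose proof (Thr_chain F3 E6 F) as F5; apply (imp_e D); iex x'; isplit; auto.
    isplit; [exact (lt_le_trans C F2)|isplit; auto].
    exact (eq_trans_ (Thr_col E6 F5) (eq_trans_ F4 E5)).
  (* If [q <= n], the threshold [succ q] is dead. So a late branch point [u] uses, from [v] on, a
     color [j] with no occurrence between [succ q] and [v], in particular none beyond [n]. *)
  + apply (Dead_e (Best_dead2 HB)); intros G' HG s _ Hs; wk HG.
    pose proof (ub2 G s v) as U; dex U s'; dand U U2.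
    apply (onbr_unbounded (n:=s') HC); intros G' HG u Hu Hsu; wk HG.
    pose proof (onbr_total HC Hv Hu (le_lt_trans U2 Hsu)) as Tu.
    assert (NG : G ⊩ ¬ Good a s v (succ q) u).
    { ii E; apply (Hs _ (incl_refl _) s u); auto; [exact (lt_le (le_lt_trans U Hsu))|apply le_refl|].
      exact (col_lt HC (Thr_lt Tu)). }
    apply (not_Good NG); intros G' HG z Z1 Z2 Z3; wk HG.
    apply (num_cases (col_lt HC (Thr_lt Z2))); intros G' HG j Hj Ej; wk HG.
    destruct (in_dec Nat.eq_dec j l) as [I|I].
    (* On the path of [u] the color [j] does occur beyond [n], at [z], so it can leave the list. *)
    * apply (IH (remove Nat.eq_dec j l)) with (v := u); auto.
      -- pose proof (remove_length_lt Nat.eq_dec l j I); lia.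
      -- exact (lt_trans Hn (Thr_lt Tu)).
      -- intros G' HG j' Hj' Nj; wk HG.
         destruct (Nat.eq_dec j' j) as [->|Ne].
         ++ iex z; isplit; [exact (Thr_lt Z2)|isplit; [exact (lt_le_trans Hn Z1)|now isplit]].
         ++ assert (O : G ⊩ occurs a n v (num j')).
            { apply (Hocc _ (incl_refl _)); auto; intros I'; apply Nj, in_in_remove; auto. }
            dex O x; dand O O2; dand O2 O3; dand O3 O4.
            iex x; isplit; [exact (lt_trans O (Thr_lt Tu))|isplit; auto; isplit].
            ** exact (Thr_trans O3 Tu).
            ** exact (eq_trans_ (eq_sym_ (Thr_col Tu O3)) O4).
    * pose proof (Hocc _ (incl_refl _) j Hj I) as O.
      dex O x; dand O O2; dand O2 O3; dand O3 O4.
      apply BotE, (Z3 _ (incl_refl _) x O); [exact (lt_succ_le (le_lt_trans C O2))| |].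
      -- exact (Thr_trans O3 Tu).
      -- exact (eq_trans_ (eq_sym_ (Thr_col Tu O3)) (eq_trans_ O4 (eq_sym_ Ej))).
Qed.
End Colors.

#[export] Hint Rewrite subst_chd : ha.

(** * The theorem *)

Section Final.
Variable L : signature.
Variable c : fsym L 3.
Variable k : nat.
Implicit Types (s t u a b A x y z w v m n q e : term L) (p r : form L) (G : list (form L)).
Notation col := (color c).
Notation K := (@num L k).

#[local] Instance chd_proper G :
  Proper (teq G ==> teq G ==> teq G ==> teq G ==> fle G) (chd c).
Proof. apply natural4_proper; intro; apply subst_chd. Qed.

(** Correct codes exist and agree on [x], so membership in some correct code, which is Sigma2, is
    the same as membership in every correct code, which is Pi2. *)
Lemma isnode_Delta2 a x : Delta2 (isnode c a x).
Proof.
exists (isnode c a x).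
exists (all1 (fun b => ex1 (fun y => correct_at c (up 2 a) (up 1 b) (succ (up 2 x)) y ⇒
   mem (up 1 b) (up 2 x)))).
split; [|split; [|split]].
- eexists; split; [|reflexivity]; eexists; split; [|reflexivity].
  apply D0_and; [apply D0_mem|apply D0_correct_at].
- eexists; split; [|reflexivity]; eexists; split; [|reflexivity].
  apply D0_imp; [apply D0_correct_at|apply D0_mem].
- apply AndI; apply imp_i; auto.
- apply AndI.
  + ii H; ii b.
    assert (D : Delta0 (correct_at c (up 1 a) (up 1 b) (up 1 (succ x)) (Var 0)))
      by apply D0_correct_at.
    pose proof (em_P1 G D) as E; dor E.
    * iex (@zero L); ii _K; exact (isnode_e H E (lt_Sn _ _)).
    * pose proof (em_not_P1 D E) as E'; dex E' y; iex y; ii K1; apply BotE, (imp_e E' K1).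
  + ii H; apply (@correct_ex L c _ a (succ x)); intros G' HG b Cb; wk HG.
    ispec H b; dex H y; apply (isnode_i Cb (lt_Sn _ _)), (imp_e H).
    exact (correct_e y Cb).
Qed.

(** [Thr] also relates nodes to numbers that are not nodes, so the ancestor relation asks in
    addition that the lower end be a node. *)
Definition the_tree : tree L := Tree
  (isnode c (Var 1) (Var 0))
  (isnode c (Var 2) (Var 1) ∧ Thr c (Var 2) (Var 0) (Var 1))
  (chd c (Var 3) (Var 0) (Var 1) (Var 2)).
Definition the_branch : form L := onbr c k (Var 1) (Var 0).

Lemma node_E a x : node the_tree a x = isnode c a x.
Proof. unfold node, papp; cbn [node_ the_tree]; rewrite subst_isnode; reflexivity. Qed.
Lemma anc_E a x y : anc the_tree a x y = (isnode c a y ∧ Thr c a x y).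
Proof.
unfold anc, papp; cbn [anc_ the_tree]; rewrite subst_And, subst_isnode, subst_Thr; reflexivity.
Qed.
Lemma child_E a i x y : child the_tree a i x y = chd c a i x y.
Proof. unfold child, papp; cbn [child_ the_tree]; rewrite subst_chd; reflexivity. Qed.
Lemma branch_E a x : the_branch @ [x; a] = onbr c k a x.
Proof. unfold papp, the_branch; rewrite subst_onbr; reflexivity. Qed.
Lemma subst_papp f p l : subst f (papp p l) = papp p (map (tsubst f) l).
Proof.
unfold papp; rewrite subst_comp; apply subst_ext; intros i; apply tsubst_nth.
Qed.

Ltac the_E := unfold anc_eq, edge; simp_unfold; cbn [map];
  rewrite ?node_E, ?anc_E, ?child_E, ?branch_E; simp.

Lemma chd_col G a i x y : (G ⊩ chd c a i x y) -> G ⊩ col a x y == i.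
Proof. intros H; exact (AndE1 (AndE2 (AndE2 H))). Qed.
Lemma chd_Thr G a i x y : (G ⊩ chd c a i x y) -> G ⊩ Thr c a x y.
Proof. intros H; exact (AndE1 (AndE2 H)). Qed.

(** [slot] would put [y] on the path of [z], beyond the last node [x] of that path. *)
Lemma chd_unique G a i x y z : (G ⊩ chd c a i x y) -> (G ⊩ chd c a i x z) -> (G ⊩ y < z) ->
  G ⊩ Bot.
Proof.
intros H H2 E.
assert (K1 : G ⊩ Thr c a y z).
{ apply (slot (AndE1 H) (chd_Thr H) (chd_Thr H2)); auto.
  - intros G' HG w E2; wk HG; exact (chd_last H E2).
  - exact (eq_trans_ (chd_col H2) (eq_sym_ (chd_col H))). }
exact (lt_not_le _ (Thr_lt (chd_Thr H)) (chd_last H2 K1)).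
Qed.

Lemma the_erdos_tree G a : (G ⊩ is_coloring c k a) -> G ⊩ erdos_tree c k the_tree a.
Proof.
intros HC; isplit; [|isplit].
- the_E; ii x y H; exact (Thr_lt (AndE2 H)).
- isplit; [|isplit; [|isplit; [|isplit]]].
  + the_E; ii i x y H; isplit.
    * rwl (chd_col H); exact (col_lt HC (Thr_lt (chd_Thr H))).
    * isplit; [exact (Thr_node (chd_Thr H))|exact (AndE1 H)].
  + the_E; ii i x j z y; ii H; dand H H2.
    assert (E : G ⊩ x == z).
    { apply le_antisym; [exact (chd_last H2 (chd_Thr H))|exact (chd_last H (chd_Thr H2))]. }
    isplit; auto; apply (eq_trans_ (eq_sym_ (chd_col H))); rw E; exact (chd_col H2).
  + the_E; ii x y; isplit.
    * ii H; dand H H2; apply (next_node H2); intros G' HG z D1 D2 D3; wk HG.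
      iex (col a x z); iex z; isplit.
      -- isplit; [dor D1; [now rw D1|exact (Thr_node D1)]|isplit; auto].
         isplit; [apply eq_refl_|ii w E; now apply (D3 _ (incl_refl _))].
      -- dor D1; [now il|ir; now isplit].
    * ii H; dex H i; dex H z; dand H H2; dor H2.
      -- isplit; [rwl H2; exact (AndE1 H)|rwl H2; exact (chd_Thr H)].
      -- dand H2 H3; isplit; auto; exact (Thr_trans (chd_Thr H) H3).
  + the_E; iex (@zero L); isplit; [apply node_0|]; ii x H.
    pose proof (lt_trich G zero x) as D; dor D; [ir; isplit; auto; now apply Thr_0|].
    dor D; [now il|exact (nlt_0 _ D)].
  + the_E; ii i x y z; ii H; dand H H2.
    pose proof (lt_trich G y z) as D; dor D; [apply BotE, (chd_unique H H2 D)|].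
    dor D; auto; apply BotE, (chd_unique H2 H D).
- the_E; ii i x w y z; ii H; dand H H2; dand H2 H3.
  assert (E : forall u, (G ⊩ w == u ∨ isnode c a u ∧ Thr c a w u) -> G ⊩ col a x u == i).
  { intros u D; dor D; [rwl D; exact (chd_col H)|].
    dand D D2; exact (eq_trans_ (eq_sym_ (Thr_col D2 (chd_Thr H))) (chd_col H)). }
  isplit; now apply E.
Qed.

Lemma the_infinite_branch G a : (G ⊩ is_coloring c k a) ->
  G ⊩ infinite_branch the_tree a the_branch [a].
Proof.
intros HC; isplit; [|isplit; [|isplit]].
- the_E; ii x H; exact (onbr_node H).
- the_E; ii x y H; dand H H2; pose proof (lt_trich G x y) as D; dor D; [|dor D].
  + ir; il; isplit; [exact (onbr_node H2)|exact (onbr_total HC H H2 D)].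
  + now il.
  + ir; ir; isplit; [exact (onbr_node H)|exact (onbr_total HC H2 H D)].
- the_E; ii x y H; dand H H2; exact (onbr_down HC H (AndE2 H2)).
- the_E; ii n; apply (onbr_unbounded (n:=n) HC); intros G' HG x E1 E2; iex x; now isplit.
Qed.

Lemma the_colors G a : (G ⊩ is_coloring c k a) ->
  G ⊩ all1 (fun h => h < K ⇒ inf_edges c the_tree (up 1 a) h ⇒
     inf_edges_in c the_tree (up 1 a) h the_branch [up 1 a]).
Proof.
intros HC; unfold inf_edges, inf_edges_in; the_E; ii h Hh Hinf; ii n.
apply (num_cases Hh); intros G' HG j Hj Ej; wk HG.
apply (onbr_unbounded (n:=n) HC); intros G' HG v Hv Hnv; wk HG.
(* At the start no color is known to occur beyond [n], so the list contains all of them. *)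
apply (@recurrence L c k a n j _ k Hj (seq 0 k)) with (v := v); auto.
- now rewrite length_seq.
- intros G' HG i Hi N; destruct N; apply in_seq; lia.
- intros G' HG m r HR; wk HG; ispec Hinf m; dex Hinf x; dex Hinf y.
  dand Hinf H2; dand H2 H3; dex H2 i.
  apply (HR _ (incl_refl _) x y Hinf).
  pose proof (eq_trans_ H3 Ej) as E; rwin (chd_col H2) E.
  now rwin E H2.
- intros G' HG x y H1 H2 H3 H4; wk HG; iex x; iex y; isplit; auto; isplit; auto.
  isplit; auto; isplit; [iex (@num L j); exact H4|].
  exact (eq_trans_ (chd_col H4) (eq_sym_ Ej)).
Qed.

Lemma map_cons_ (f : term L -> term L) t l : map f (t :: l) = f t :: map f l.
Proof. reflexivity. Qed.
Hint Rewrite subst_papp map_cons_ : ha.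

(** By [node_em], a node off [the_branch] has no late nodes below it, so it lies on no infinite
    branch. Conversely, by [onbr_late], late points of any infinite branch lie below each point of
    [the_branch], and closure under ancestors applies. *)
Lemma the_unique_branch G a r l : (G ⊩ is_coloring c k a) ->
  (G ⊩ infinite_branch the_tree a r l) -> G ⊩ same_set r l the_branch [a].
Proof.
intros HC H; unfold infinite_branch in H; simp in H.
rewrite ?node_E, ?anc_E in H; simp in H; dand H I1; dand I1 I2; dand I2 I3.
unfold same_set; the_E; ii x; isplit; ii Hx.
- pose proof H as H0; ispec H0 x; imp H0 Hx.
  pose proof (node_em HC H0) as D; dor D; auto; apply BotE.
  dex D s; pose proof (ub2 G s x) as U; dex U n; dand U U2.
  ispec I3 n; dex I3 y; dand I3 I4.
  ispec I1 x; ispec I1 y; impg I1; [now isplit|]; dor I1; [|dor I1].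
  + exact (lt_ne _ (le_lt_trans U2 I3) I1).
  + dand I1 I5; ispec D y; impg D; [exact (le_trans U (lt_le I3))|].
    imp D I1; exact (imp_e D I5).
  + apply AndE2, Thr_lt in I1; exact (lt_irrefl _ (lt_trans I1 (le_lt_trans U2 I3))).
- apply (onbr_late HC Hx); intros G' HG s Hs; wk HG.
  ispec I3 s; dex I3 y; dand I3 I4; ispec I2 x; ispec I2 y; apply (imp_e I2).
  ispec H y; imp H I4; isplit; auto; isplit; auto; apply (Hs _ (incl_refl _)); auto.
  exact (lt_le I3).
Qed.
End Final.

Theorem proposition4p1 (L : signature) (k : nat) (hk : (2 <= k)%nat)
    (c : fsym L 3) :
  exists (T : tree L) (r : form L),
    Delta2 (node_ T)
    /\ (HA+EM₂ ⊢ all1 (fun a => is_coloring c k a ⇒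
          erdos_tree c k T a
          ∧ infinite_branch T a r [a]
          ∧ all1 (fun h => h < num k
              ⇒ inf_edges c T (up 1 a) h
              ⇒ inf_edges_in c T (up 1 a) h r [up 1 a])))
    (* s is any arithmetical predicate, with parameters a and qs *)
    /\ (forall (s : form L) (qs : list (term L)),
          let ss a := a :: map (up 1) qs in
          HA+EM₂ ⊢ all1 (fun a => is_coloring c k a ⇒
            infinite_branch T a s (ss a) ⇒ same_set s (ss a) r [a])).
Proof.
exists (the_tree c), (the_branch c k); split; [|split].
- apply isnode_Delta2.
- apply (AllI (G := [])), imp_i; intros G HG H.
  apply AndI; [exact (the_erdos_tree H)|apply AndI].
  + exact (the_infinite_branch H).
  + exact (the_colors H).
- intros s qs ss; apply (AllI (G := [])), imp_i; intros G HG H; apply imp_i; intros G' HG' H'.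
  apply (prv_weak HG') in H; exact (the_unique_branch H H').
Qed.
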